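(* Let $\mathbb{H}$ be the upper half-plane. For $\tau\in\mathbb{H}$ and $s>0$ let $$X_\tau(s)=\left\{\frac{1}{(m\tau+n)^2\,|m\tau+n|^s}\ :\ m,n\in\mathbb{Z},\ \gcd(m,n)=1\right\},\qquad L(X_\tau(s);t)=\prod_{x\in X_\tau(s)}Q_{L}(xt),\qquad Q_{L}(w)=\frac{\sqrt{w}}{\tanh(\sqrt{w})}.$$ Then, as functions of $(z,\tau)\in\mathbb{C}\times\mathbb{H}$ (with $z$ not a nonzero element of the lattice $\mathbb{Z}\tau+\mathbb{Z}$), $$\lim_{s\to0^+}L\big(X_\tau(s);(\pi i z)^2\big)=\pi i z\cdot\frac{\widetilde{\Theta}(2z;\tau)}{\widetilde{\Theta}(z;\tau)^2},$$ where $\widetilde{\Theta}$ is the modified Jacobi theta function $$\widetilde{\Theta}(z;\tau)=\exp\left(\frac{\pi}{2}\cdot\frac{z^2}{\operatorname{Im}(\tau)}\right)\cdot u^{1/2}q^{1/8}\cdot\frac{\theta\left(z+\frac{\tau}{2}+\frac12;\tau\right)}{\eta(\tau)^3}.$$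
   Context: Notation: $u=e^{2\pi i z}$, $q=e^{2\pi i\tau}$, $u^{1/2}=e^{\pi i z}$, and $q^{a}=e^{2\pi i a\tau}$ for rational $a$. The Jacobi theta function is $\theta(z;\tau)=\sum_{n\in\mathbb{Z}}u^nq^{n^2/2}$ and the Dedekind eta function is $\eta(\tau)=q^{1/24}\prod_{n\ge1}(1-q^n)$. $Q_{L}(w)=1+\frac{w}{3}-\frac{w^2}{45}+\frac{2w^3}{945}-\cdots$ is an even function of $\sqrt w$, hence a well-defined meromorphic function of $w\in\mathbb{C}$. $X_\tau(s)$ is a set: the coprime pairs $(m,n)$ and $(-m,-n)$ give the same element, which is counted once in the product. At $z=0$ the right-hand side is understood as its removable-singularity value. *)

(* Defs.v *)
From Stdlib Require Export Reals List.
From Coquelicot Require Export Coquelicot.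
From Stdlib Require Import Lra Classical.

Open Scope R_scope.
Open Scope C_scope.

(** The filter of finite subsets of [A], directed by inclusion: [P] holds for
    every duplicate-free list in [A] that contains some finite part [l0] of [A]. *)
Definition finite_subsets {T : Type} (A : T -> Prop) : (list T -> Prop) -> Prop :=
  fun P => exists l0 : list T,
    (forall x, In x l0 -> A x) /\
    forall l, NoDup l -> (forall x, In x l -> A x) -> incl l0 l -> P l.

Definition finite_sum {T : Type} (f : T -> C) (l : list T) : C :=
  fold_right (fun x acc => f x + acc) (RtoC 0) l.

Definition finite_prod {T : Type} (f : T -> C) (l : list T) : C :=
  fold_right (fun x acc => f x * acc) (RtoC 1) l.

(** Unordered sums and products. As with Coquelicot's [Lim], the value is only
    meaningful when the corresponding limit exists. *)
Definition Csum_over {T : Type} (A : T -> Prop) (f : T -> C) : C :=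
  lim (T := C_CompleteNormedModule) (filtermap (finite_sum f) (finite_subsets A)).

Definition Cprod_over {T : Type} (A : T -> Prop) (f : T -> C) : C :=
  lim (T := C_CompleteNormedModule) (filtermap (finite_prod f) (finite_subsets A)).

Definition ex_Cprod_over {T : Type} (A : T -> Prop) (f : T -> C) : Prop :=
  exists p : C, filterlim (finite_prod f) (finite_subsets A) (locally p).

Definition Cexp (z : C) : C := (exp (Re z) * cos (Im z), exp (Re z) * sin (Im z))%R.
Definition Ccosh (z : C) : C := (Cexp z + Cexp (- z)) / 2.
Definition Csinh (z : C) : C := (Cexp z - Cexp (- z)) / 2.

(** Principal square root. *)
Definition Csqrt (w : C) : C :=
  (sqrt ((Cmod w + Re w) / 2),
   (if Rle_dec 0 (Im w) then 1 else -1) * sqrt ((Cmod w - Re w) / 2))%R.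

(** [sqrt w / tanh (sqrt w)], with [1 / tanh] written [cosh / sinh] so that the
    zeros of [cosh] need no convention. By [Q_L_sqr] the branch of the square
    root is irrelevant. The value at a pole is arbitrary. *)
Definition Q_L (w : C) : C :=
  if Ceq_dec w 0 then RtoC 1
  else Csqrt w * (Ccosh (Csqrt w) / Csinh (Csqrt w)).

Definition Q_L_pole (w : C) : Prop := w <> 0 /\ Csinh (Csqrt w) = 0.

(** [X] is a set of numbers: [(m, n)] and [(-m, -n)] give the same element. *)
Definition X (tau : C) (s : R) : C -> Prop := fun x =>
  exists m n : Z, Z.gcd m n = 1%Z /\
    let omega := IZR m * tau + IZR n in
    x = / (omega ^ 2 * Rpower (Cmod omega) s).

Definition L (S : C -> Prop) (t : C) : C := Cprod_over S (fun x => Q_L (x * t)).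

Definition L_defined (S : C -> Prop) (t : C) : Prop :=
  (forall x, S x -> ~ Q_L_pole (x * t)) /\ ex_Cprod_over S (fun x => Q_L (x * t)).

(** [expi a z] is [e^(2 pi i a z)]: this is [u^a] at [z] and [q^a] at [tau]. *)
Definition expi (a : R) (z : C) : C := Cexp (2 * PI * Ci * a * z).

Definition theta (z tau : C) : C :=
  Csum_over (fun _ : Z => True)
    (fun n => expi (IZR n) z * expi (IZR n ^ 2 / 2) tau).

Definition eta (tau : C) : C :=
  expi (1 / 24) tau *
  Cprod_over (fun n : nat => (1 <= n)%nat) (fun n => 1 - expi (INR n) tau).

Definition Theta (z tau : C) : C :=
  Cexp (PI / 2 * (z ^ 2 / Im tau)) * (expi (1 / 2) z * expi (1 / 8) tau) *
  (theta (z + tau / 2 + 1 / 2) tau / eta tau ^ 3).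

Definition in_lattice (tau z : C) : Prop :=
  exists m n : Z, z = IZR m * tau + IZR n.

(** [v] is the value at [z] of [f], whose singularity at [z0] is removable. *)
Definition removable_value (f : C -> C) (z0 z v : C) : Prop :=
  (z <> z0 -> v = f z) /\ (z = z0 -> filterlim f (locally' z0) (locally v)).

Lemma exists_NoDup {T : Type} (l0 : list T) :
  exists l, NoDup l /\ forall x, In x l <-> In x l0.
Proof.
induction l0 as [| a l0 [l [Hl Hi]]].
- exists nil; split; [constructor | tauto].
- destruct (classic (In a l)) as [Ha | Ha].
  + exists l; split; [exact Hl |]; intros x; rewrite Hi; split; [now right |].
    intros [<- | Hx]; [now apply Hi | exact Hx].
  + exists (a :: l); split; [now constructor |]; intros x; simpl; rewrite Hi; tauto.
Qed.

Global Instance finite_subsets_filter {T : Type} (A : T -> Prop) :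
  ProperFilter (finite_subsets A).
Proof.
constructor.
- intros P [l0 [H0 H]]; destruct (exists_NoDup l0) as [l [Hl Hi]].
  exists l; apply H; [exact Hl | intros x Hx; now apply H0, Hi | intros x; apply Hi].
- constructor.
  + exists nil; split; [intros x [] | trivial].
  + intros P Q [l1 [A1 H1]] [l2 [A2 H2]]; exists (l1 ++ l2); split.
    * intros x Hx; apply in_app_or in Hx; destruct Hx; auto.
    * intros l Hl HA Hi; split; [apply H1 | apply H2]; trivial;
        intros x Hx; apply Hi, in_or_app; auto.
  + intros P Q HPQ [l0 [A0 H]]; exists l0; split; [exact A0 |]; auto.
Qed.

Lemma lim_unique {T : Type} (F : (T -> Prop) -> Prop) {FF : ProperFilter F}
  (f : T -> C) (p : C) :
  filterlim f F (locally p) ->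
  lim (T := C_CompleteNormedModule) (filtermap f F) = p.
Proof.
intros Hp.
apply (filterlim_locally_unique (K := C_AbsRing) (V := C_NormedModule) (F := F) f);
  [| exact Hp].
apply filterlim_locally; intros eps.
apply (complete_cauchy (T := C_CompleteNormedModule) (filtermap f F)).
- apply filtermap_proper_filter, FF.
- intros e; exists p; apply Hp; apply locally_ball.
Qed.

Lemma Cprod_over_unique {T : Type} (A : T -> Prop) (f : T -> C) (p : C) :
  filterlim (finite_prod f) (finite_subsets A) (locally p) -> Cprod_over A f = p.
Proof. apply lim_unique, finite_subsets_filter. Qed.

Lemma Csum_over_unique {T : Type} (A : T -> Prop) (f : T -> C) (p : C) :
  filterlim (finite_sum f) (finite_subsets A) (locally p) -> Csum_over A f = p.
Proof. apply lim_unique, finite_subsets_filter. Qed.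

Lemma Csqrt_sqr (w : C) : Csqrt w * Csqrt w = w.
Proof.
destruct w as [a b].
assert (H2 : (Cmod (a, b) ^ 2 = a ^ 2 + b ^ 2)%R).
{ unfold Cmod; cbn [fst snd]; apply pow2_sqrt; nra. }
assert (H0 := Cmod_ge_0 (a, b)).
unfold Csqrt, Cmult; cbn [fst snd Re Im].
set (r := Cmod (a, b)) in *.
assert (Hp : (0 <= (r + a) / 2)%R) by nra.
assert (Hm : (0 <= (r - a) / 2)%R) by nra.
assert (E1 := sqrt_sqrt _ Hp); assert (E2 := sqrt_sqrt _ Hm).
assert (E3 : (sqrt ((r + a) / 2) * sqrt ((r - a) / 2) = Rabs b / 2)%R).
{ rewrite <- sqrt_mult by assumption.
  replace ((r + a) / 2 * ((r - a) / 2))%R with (Rsqr (b / 2)) by (unfold Rsqr; nra).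
  rewrite sqrt_Rsqr_abs; unfold Rdiv; rewrite Rabs_mult.
  rewrite (Rabs_pos_eq (/ 2)); lra. }
destruct (Rle_dec 0 b) as [Hb | Hb].
- rewrite Rabs_pos_eq in E3 by assumption; apply injective_projections; cbn [fst snd]; nra.
- rewrite Rabs_left in E3 by lra; apply injective_projections; cbn [fst snd]; nra.
Qed.

Lemma Q_L_sqr (y : C) : y <> 0 -> Q_L (y * y) = y * (Ccosh y / Csinh y).
Proof.
intros Hy; unfold Q_L.
destruct (Ceq_dec (y * y) 0) as [H | _].
{ exfalso; exact (Cmult_neq_0 _ _ Hy Hy H). }
assert (Hr : Csqrt (y * y) = y \/ Csqrt (y * y) = - y).
{ assert (H := Csqrt_sqr (y * y)); set (r := Csqrt (y * y)) in *.
  destruct (Ceq_dec (r - y) 0) as [E | E].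
  - left; replace r with (r - y + y) by ring; rewrite E; ring.
  - right; destruct (Ceq_dec (r + y) 0) as [E' | E'].
    + replace r with (r + y - y) by ring; rewrite E'; ring.
    + exfalso; apply (Cmult_neq_0 _ _ E E').
      replace ((r - y) * (r + y)) with (r * r - y * y) by ring; rewrite H; ring. }
assert (Hc : Ccosh (- y) = Ccosh y).
{ unfold Ccosh; replace (- - y) with y by ring; f_equal; ring. }
assert (Hs : Csinh (- y) = - Csinh y).
{ unfold Csinh, Cdiv; replace (- - y) with y by ring; ring. }
destruct Hr as [-> | ->]; [reflexivity |].
rewrite Hc, Hs.
unfold Cdiv.
replace (/ - Csinh y) with (- / Csinh y); [ring |].
destruct (Csinh y) as [a b]; unfold Cinv, Copp; cbn [fst snd].
apply injective_projections; cbn [fst snd];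
  replace ((- a) ^ 2 + (- b) ^ 2)%R with (a ^ 2 + b ^ 2)%R by ring; unfold Rdiv; ring.
Qed.

(* Main.v *)
Require Import Defs.
From Stdlib Require Import Lra Lia Psatz ZArith Permutation Classical ClassicalEpsilon.

(** For a primitive vector [omega = m tau + n] put [a = z / (omega |omega|^(s/2))]. The factor of
    the product at [omega] is [pi a cot (pi a)], and the sine product turns it into the product of
    [(1 - 4 a^2/k^2) / (1 - a^2/k^2)^2] over [k >= 1] ([sine_product], [cot_sinprod]). Formally the
    whole product therefore runs over all nonzero lattice vectors [k omega] modulo sign, but its
    factors are [1 - 2 a^2/k^2] up to terms of higher order, and at [s = 0] they converge only
    conditionally. This is where the limit in [s] acts.

    Multiplying each factor by [exp (2 a^2/k^2)] leaves factors [1 + O(|k omega|^(-4))], uniformly in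
    [s]. The regularised product is absolutely convergent and passes to [s = 0] by dominated
    convergence ([regterm_prod_tends]). The exponentials multiply to [exp (2 zeta(2) z^2 E(s))],
    where [E(s)] is the sum of [1 / (omega^2 |omega|^s)] over primitive vectors modulo sign; sorting
    lattice vectors by content, [zeta(2+s) E(s)] is half the Eisenstein series of weight two with
    Hecke's convergence factor ([primitive_sum]).

    Hecke's limit ([hecke_limit]) says that this half series tends to [G - pi / (2 Im tau)], where [G]
    is half the series summed by rows. Along the rows, the summand agrees with minus the derivative
    of [w^(-1) |w|^(-s)] up to a multiple [s/2] of [w^(-2) |w|^(-s) + |w|^(-2-s)]. Exchanging the
    derivative for a difference, which telescopes, costs only an absolutely convergent remainder
    that is continuous at [s = 0]. The correction is the residue of the Epstein zeta function, the
    sum of [|w|^(-2-s)] ([epstein_residue]); it follows by comparing rows with arctangents and from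
    the pole of [zeta] at 1.

    At [s = 0] the regularised product is evaluated by rows ([lattice_product]): the row [m = 0] is
    [pi z cot (pi z)], and by the sine product the row [m] is a quotient of factors
    [(1 - u q^m) (1 - q^m / u)] at [2 z] and at [z]. These are the factors of the theta function in
    Jacobi's triple product ([jacobi_triple_product], [Theta_product]). The exponentials of [G]
    cancel, and the surviving [exp (pi z^2 / Im tau)] is the quotient of the Gaussian factors of
    [Theta]. *)

Local Notation eventually := Hierarchy.eventually.

(** * Choice *)

Lemma choice_on {T U : Type} (P : T -> Prop) (Q : T -> U -> Prop) (u0 : U) :
  (forall x, P x -> exists y, Q x y) -> exists f, forall x, P x -> Q x (f x).
Proof.
intros H; apply (choice (fun x y => P x -> Q x y)); intros x.
destruct (classic (P x)) as [Hx | Hx]; [destruct (H x Hx) as [y Hy]; now exists y | now exists u0].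
Qed.

(** * Limits of complex functions along a filter *)

Definition tends {T : Type} (F : (T -> Prop) -> Prop) (f : T -> C) (p : C) : Prop :=
  forall eps : R, (0 < eps)%R -> F (fun x => Cmod (f x - p) < eps)%R.

Lemma Cmod_sub_sym (x y : C) : Cmod (x - y) = Cmod (y - x).
Proof. rewrite <- Cmod_opp; f_equal; ring. Qed.

Lemma Cmod_sub_triangle (x y z : C) : (Cmod (x - z) <= Cmod (x - y) + Cmod (y - z))%R.
Proof. replace (x - z) with ((x - y) + (y - z)) by ring; apply Cmod_triangle. Qed.

Lemma Cmod_triangle_sub (x y : C) : (Cmod (x - y) <= Cmod x + Cmod y)%R.
Proof. unfold Cminus; eapply Rle_trans; [apply Cmod_triangle |]; rewrite Cmod_opp; lra. Qed.

Lemma Cmod_triangle_inv (x y : C) : (Cmod x - Cmod y <= Cmod (x - y))%R.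
Proof.
assert (H := Cmod_triangle (x - y) y); replace (x - y + y) with x in H by ring; lra.
Qed.

Lemma tends_filterlim {T : Type} (F : (T -> Prop) -> Prop) {FF : Filter F} (f : T -> C) (p : C) :
  tends F f p <-> filterlim f F (locally p).
Proof.
split.
- intros H; apply filterlim_locally; intros eps.
  assert (H2 := H eps (cond_pos eps)).
  revert H2; apply filter_imp; intros x Hx.
  apply C_NormedModule_mixin_compat1; exact Hx.
- intros H eps Heps.
  assert (Hs : (0 < sqrt 2)%R) by (apply sqrt_lt_R0; lra).
  assert (He : (0 < eps / sqrt 2)%R) by (apply Rdiv_lt_0_compat; lra).
  assert (H2 := proj1 (filterlim_locally f p) H (mkposreal _ He)).
  revert H2; apply filter_imp; intros x Hx.
  assert (H3 := C_NormedModule_mixin_compat2 p (f x) _ Hx).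
  simpl in H3. replace (sqrt 2 * (eps / sqrt 2))%R with eps in H3 by (field; lra).
  exact H3.
Qed.

Lemma tends_unique {T : Type} (F : (T -> Prop) -> Prop) {FF : ProperFilter F} (f : T -> C) (p q : C) :
  tends F f p -> tends F f q -> p = q.
Proof.
intros Hp Hq; destruct (Ceq_dec p q) as [E | E]; [exact E | exfalso].
assert (Hd : (0 < Cmod (p - q) / 2)%R).
{ assert (p - q <> 0) by (intros H; apply E; replace p with (p - q + q) by ring; rewrite H; ring).
  apply Cmod_gt_0 in H; lra. }
destruct (filter_ex _ (filter_and _ _ (Hp _ Hd) (Hq _ Hd))) as [x [H1 H2]].
assert (H3 := Cmod_sub_triangle p (f x) q); rewrite (Cmod_sub_sym p (f x)) in H3; lra.
Qed.

Lemma tends_ext_F {T : Type} (F : (T -> Prop) -> Prop) {FF : Filter F} (f g : T -> C) (p : C) :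
  F (fun x => f x = g x) -> tends F f p -> tends F g p.
Proof.
intros E H eps Heps; generalize (filter_and _ _ E (H eps Heps)); apply filter_imp.
intros x [<- Hx]; exact Hx.
Qed.

Lemma tends_ext {T : Type} (F : (T -> Prop) -> Prop) {FF : Filter F} (f g : T -> C) (p : C) :
  (forall x, f x = g x) -> tends F f p -> tends F g p.
Proof. intros E; apply tends_ext_F; [exact FF |]; now apply filter_forall. Qed.

Lemma tends_const {T : Type} (F : (T -> Prop) -> Prop) {FF : Filter F} (p : C) :
  tends F (fun _ => p) p.
Proof.
intros eps Heps; apply filter_forall; intros _; replace (p - p) with (RtoC 0) by ring.
rewrite Cmod_0; exact Heps.
Qed.

Definition continuous_atC (phi : C -> C) (p : C) : Prop :=
  forall eps : R, (0 < eps)%R ->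
  exists d : R, (0 < d)%R /\ forall x, (Cmod (x - p) < d)%R -> (Cmod (phi x - phi p) < eps)%R.

Lemma tends_comp {T : Type} (F : (T -> Prop) -> Prop) {FF : Filter F} (f : T -> C) (phi : C -> C) (p : C) :
  continuous_atC phi p -> tends F f p -> tends F (fun x => phi (f x)) (phi p).
Proof.
intros Hc Hf eps Heps; destruct (Hc eps Heps) as [d [Hd H]].
generalize (Hf d Hd); apply filter_imp; intros x; apply H.
Qed.

Lemma tends_plus {T : Type} (F : (T -> Prop) -> Prop) {FF : Filter F} (f g : T -> C) (p q : C) :
  tends F f p -> tends F g q -> tends F (fun x => f x + g x) (p + q).
Proof.
intros Hf Hg eps Heps; assert (H2 : (0 < eps / 2)%R) by lra.
generalize (filter_and _ _ (Hf _ H2) (Hg _ H2)); apply filter_imp; intros x [H3 H4].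
replace (f x + g x - (p + q)) with ((f x - p) + (g x - q)) by ring.
assert (H := Cmod_triangle (f x - p) (g x - q)); lra.
Qed.

Lemma tends_opp {T : Type} (F : (T -> Prop) -> Prop) {FF : Filter F} (f : T -> C) (p : C) :
  tends F f p -> tends F (fun x => - f x) (- p).
Proof.
intros Hf eps Heps; generalize (Hf _ Heps); apply filter_imp; intros x H.
replace (- f x - - p) with (- (f x - p)) by ring; rewrite Cmod_opp; exact H.
Qed.

Lemma tends_minus {T : Type} (F : (T -> Prop) -> Prop) {FF : Filter F} (f g : T -> C) (p q : C) :
  tends F f p -> tends F g q -> tends F (fun x => f x - g x) (p - q).
Proof. intros; apply tends_plus; [exact FF | | apply tends_opp]; assumption. Qed.

Lemma Cmult_continuous (p q : C) (eps : R) :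
  (0 < eps)%R -> exists d, (0 < d)%R /\
  forall x y, (Cmod (x - p) < d)%R -> (Cmod (y - q) < d)%R -> (Cmod (x * y - p * q) < eps)%R.
Proof.
intros Heps.
assert (Hp := Cmod_ge_0 p); assert (Hq := Cmod_ge_0 q).
set (K := (1 + Cmod p + Cmod q)%R).
exists (Rmin 1 (eps / K)); split.
{ apply Rmin_glb_lt; [lra |]; apply Rdiv_lt_0_compat; unfold K; lra. }
intros x y Hx Hy.
assert (H1 := Rmin_l 1 (eps / K)); assert (H2 := Rmin_r 1 (eps / K)).
replace (x * y - p * q) with ((x - p) * (y - q) + (p * (y - q) + (x - p) * q)) by ring.
assert (T1 := Cmod_triangle ((x - p) * (y - q)) (p * (y - q) + (x - p) * q)).
assert (T2 := Cmod_triangle (p * (y - q)) ((x - p) * q)).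
rewrite !Cmod_mult in *.
set (a := Cmod (x - p)) in *; set (b := Cmod (y - q)) in *.
assert (Ha : (0 <= a)%R) by apply Cmod_ge_0; assert (Hb : (0 <= b)%R) by apply Cmod_ge_0.
set (d := Rmin 1 (eps / K)) in *.
assert (HdK : (d * K <= eps)%R).
{ apply Rle_trans with (eps / K * K)%R; [apply Rmult_le_compat_r; unfold K in *; lra |].
  right; field; unfold K; lra. }
assert (a * b <= d * 1)%R by (apply Rmult_le_compat; lra).
assert (Cmod p * b <= Cmod p * d)%R by (apply Rmult_le_compat_l; lra).
assert (a * Cmod q <= d * Cmod q)%R by (apply Rmult_le_compat_r; lra).
destruct (Rle_lt_or_eq_dec 0 b Hb) as [Hb0 | Hb0].
- assert (a * b < d * 1)%R.
  { apply Rlt_le_trans with (d * b)%R; [apply Rmult_lt_compat_r; lra |].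
    apply Rmult_le_compat_l; lra. }
  unfold K in HdK; lra.
- rewrite <- Hb0 in *. unfold K in HdK. nra.
Qed.

Lemma tends_mult {T : Type} (F : (T -> Prop) -> Prop) {FF : Filter F} (f g : T -> C) (p q : C) :
  tends F f p -> tends F g q -> tends F (fun x => f x * g x) (p * q).
Proof.
intros Hf Hg eps Heps; destruct (Cmult_continuous p q eps Heps) as [d [Hd H]].
generalize (filter_and _ _ (Hf _ Hd) (Hg _ Hd)); apply filter_imp; intros x [H3 H4]; auto.
Qed.

Lemma Cinv_continuous (p : C) : p <> 0 -> continuous_atC Cinv p.
Proof.
intros Hp eps Heps; assert (Hp0 := proj1 (Cmod_gt_0 p) Hp).
exists (Rmin (Cmod p / 2) (eps * (Cmod p * Cmod p) / 2)); split.
{ apply Rmin_glb_lt; [lra |]; assert (0 < Cmod p * Cmod p)%R by nra; nra. }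
intros x Hx.
assert (H1 := Rmin_l (Cmod p / 2) (eps * (Cmod p * Cmod p) / 2)).
assert (H2 := Rmin_r (Cmod p / 2) (eps * (Cmod p * Cmod p) / 2)).
assert (H3 := Cmod_triangle_inv p x); rewrite Cmod_sub_sym in H3.
assert (Hx0 : (0 < Cmod x)%R) by lra.
assert (Hx1 : x <> 0) by (now apply Cmod_gt_0).
replace (/ x - / p) with (- (x - p) * / (x * p)) by (field; auto).
rewrite Cmod_mult, Cmod_opp, Cmod_inv, Cmod_mult by (now apply Cmult_neq_0).
apply Rmult_lt_reg_r with (Cmod x * Cmod p)%R; [nra |].
rewrite Rmult_assoc, Rinv_l, Rmult_1_r by nra.
apply Rlt_le_trans with (eps * (Cmod p * Cmod p) / 2)%R; [lra |].
assert (Cmod p / 2 * Cmod p <= Cmod x * Cmod p)%R by (apply Rmult_le_compat_r; lra).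
nra.
Qed.

Lemma tends_inv {T : Type} (F : (T -> Prop) -> Prop) {FF : Filter F} (f : T -> C) (p : C) :
  p <> 0 -> tends F f p -> tends F (fun x => / f x) (/ p).
Proof. intros Hp; apply tends_comp; [exact FF | now apply Cinv_continuous]. Qed.

Lemma tends_div {T : Type} (F : (T -> Prop) -> Prop) {FF : Filter F} (f g : T -> C) (p q : C) :
  q <> 0 -> tends F f p -> tends F g q -> tends F (fun x => f x / g x) (p / q).
Proof. intros Hq Hf Hg; apply tends_mult; [exact FF | exact Hf | now apply tends_inv]. Qed.

Lemma tends_pow {T : Type} (F : (T -> Prop) -> Prop) {FF : Filter F} (f : T -> C) (p : C) (n : nat) :
  tends F f p -> tends F (fun x => f x ^ n) (p ^ n).
Proof.
intros Hf; induction n as [| n IH]; simpl; [now apply tends_const | now apply tends_mult].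
Qed.

Lemma Cmod_le_lim {T : Type} (F : (T -> Prop) -> Prop) {FF : ProperFilter F} (f : T -> C) (p q : C) (M : R) :
  tends F f p -> F (fun x => Cmod (f x - q) <= M)%R -> (Cmod (p - q) <= M)%R.
Proof.
intros Hf HM; apply le_epsilon; intros eps Heps.
destruct (filter_ex _ (filter_and _ _ (Hf _ Heps) HM)) as [x [H1 H2]].
assert (H3 := Cmod_sub_triangle p (f x) q); rewrite (Cmod_sub_sym p (f x)) in H3; lra.
Qed.

Lemma tends_cauchy {T : Type} (F : (T -> Prop) -> Prop) {FF : ProperFilter F} (f : T -> C) :
  (forall eps, (0 < eps)%R -> exists c, F (fun x => Cmod (f x - c) < eps)%R) ->
  exists p, tends F f p.
Proof.
intros H; exists (lim (T := C_CompleteNormedModule) (filtermap f F)).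
apply tends_filterlim; [typeclasses eauto |]; apply filterlim_locally; intros eps.
apply (complete_cauchy (T := C_CompleteNormedModule) (filtermap f F)).
- apply filtermap_proper_filter, FF.
- intros e; destruct (H e (cond_pos e)) as [c Hc]; exists c; unfold filtermap.
  revert Hc; apply filter_imp; intros x Hx; apply C_NormedModule_mixin_compat1; exact Hx.
Qed.

(** * Unordered sums and products *)

(** One fold for sums and products, so that rearrangement, iterated limits and dominated
    convergence are proved once for both. *)
Definition big {T : Type} (op : C -> C -> C) (e : C) (f : T -> C) (l : list T) : C :=
  fold_right (fun x acc => op (f x) acc) e l.

Definition rsum {T : Type} (b : T -> R) (l : list T) : R :=
  fold_right (fun x acc => b x + acc)%R 0%R l.

(** Convergence and domination rest on the last field alone: it bounds the effect of adjoining
    the terms of [l2], which is a factor close to 1 for products and a summand close to 0 for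
    sums. *)
Class CMonoid (op : C -> C -> C) (e : C) : Prop := {
  cm_comm : forall x y, op x y = op y x;
  cm_assoc : forall x y z, op x (op y z) = op (op x y) z;
  cm_unit : forall x, op e x = x;
  cm_cont : forall p q eps, (0 < eps)%R -> exists d, (0 < d)%R /\
    forall x y, (Cmod (x - p) < d)%R -> (Cmod (y - q) < d)%R -> (Cmod (op x y - op p q) < eps)%R;
  cm_est : forall (T : Type) (f : T -> C) (l1 l2 : list T),
    (Cmod (op (big op e f l1) (big op e f l2) - big op e f l1) <=
      exp (rsum (fun x => Cmod (f x - e)) l1) *
      (exp (rsum (fun x => Cmod (f x - e)) l2) - 1))%R }.

Lemma rsum_ge_0 {T : Type} (b : T -> R) (l : list T) :
  (forall x, In x l -> 0 <= b x)%R -> (0 <= rsum b l)%R.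
Proof.
induction l as [| a l IH]; simpl; intros H; [lra |].
assert (0 <= b a)%R by auto; assert (0 <= rsum b l)%R by auto; lra.
Qed.

Lemma exp_ge_1p (x : R) : (1 + x <= exp x)%R.
Proof.
destruct (Req_dec x 0) as [-> | H]; [rewrite exp_0; lra |].
left; now apply exp_ineq1.
Qed.

Lemma Csum_est {T : Type} (f : T -> C) (l : list T) :
  (Cmod (big Cplus 0 f l) <= rsum (fun x => Cmod (f x - 0)) l)%R.
Proof.
induction l as [| a l IH]; simpl; [rewrite Cmod_0; lra |].
eapply Rle_trans; [apply Cmod_triangle |].
replace (f a - 0) with (f a) by ring; lra.
Qed.

Lemma Cprod_est {T : Type} (f : T -> C) (l : list T) :
  (Cmod (big Cmult 1 f l) <= exp (rsum (fun x => Cmod (f x - 1)) l))%R /\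
  (Cmod (big Cmult 1 f l - 1) <= exp (rsum (fun x => Cmod (f x - 1)) l) - 1)%R.
Proof.
induction l as [| a l [IH1 IH2]]; simpl.
- rewrite exp_0, Cmod_1; replace (1 - 1) with (RtoC 0) by ring; rewrite Cmod_0; lra.
- set (P := big Cmult 1 f l) in *; set (S := rsum _ l) in *.
  rewrite exp_plus; set (t := Cmod (f a - 1)).
  assert (Ht : (0 <= t)%R) by apply Cmod_ge_0.
  assert (He := exp_ge_1p t); assert (HS := exp_pos S).
  split.
  + rewrite Cmod_mult.
    assert (H : (Cmod (f a) <= 1 + t)%R).
    { replace (f a) with (1 + (f a - 1)) by ring.
      eapply Rle_trans; [apply Cmod_triangle |]; rewrite Cmod_1; unfold t; lra. }
    apply Rmult_le_compat; try apply Cmod_ge_0; lra.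
  + replace (f a * P - 1) with ((f a - 1) * P + (P - 1)) by ring.
    eapply Rle_trans; [apply Cmod_triangle |]; rewrite Cmod_mult; fold t.
    assert (t * Cmod P <= t * exp S)%R by (apply Rmult_le_compat_l; lra).
    nra.
Qed.

Global Instance CMonoid_plus : CMonoid Cplus 0.
Proof.
split; try (intros; ring).
- intros p q eps Heps; exists (eps / 2)%R; split; [lra |]; intros x y Hx Hy.
  replace (x + y - (p + q)) with ((x - p) + (y - q)) by ring.
  assert (H := Cmod_triangle (x - p) (y - q)); lra.
- intros T f l1 l2.
  replace (_ - big Cplus 0 f l1) with (big Cplus 0 f l2) by ring.
  assert (H := Csum_est f l2).
  set (s1 := rsum _ l1); set (s2 := rsum _ l2) in *.
  assert (Hs1 : (0 <= s1)%R) by (apply rsum_ge_0; intros; apply Cmod_ge_0).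
  assert (Hs2 : (0 <= s2)%R) by (apply rsum_ge_0; intros; apply Cmod_ge_0).
  assert (E1 := exp_ge_1p s1); assert (E2 := exp_ge_1p s2); nra.
Qed.

Global Instance CMonoid_mult : CMonoid Cmult 1.
Proof.
split; try (intros; ring).
- exact Cmult_continuous.
- intros T f l1 l2.
  replace (_ - big Cmult 1 f l1) with (big Cmult 1 f l1 * (big Cmult 1 f l2 - 1)) by ring.
  rewrite Cmod_mult; apply Rmult_le_compat; try apply Cmod_ge_0; apply Cprod_est.
Qed.

Lemma cm_unit_r {op e} `{CMonoid op e} (x : C) : op x e = x.
Proof. rewrite cm_comm; apply cm_unit. Qed.

Lemma big_perm {op e} `{CMonoid op e} {T : Type} (f : T -> C) (l l' : list T) :
  Permutation l l' -> big op e f l = big op e f l'.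
Proof.
induction 1; simpl; try congruence.
rewrite !cm_assoc; f_equal; apply cm_comm.
Qed.

Lemma big_app {op e} `{CMonoid op e} {T : Type} (f : T -> C) (l l' : list T) :
  big op e f (l ++ l') = op (big op e f l) (big op e f l').
Proof. induction l as [| a l IH]; simpl; [now rewrite cm_unit | now rewrite IH, cm_assoc]. Qed.

Lemma big_map {op e} {T U : Type} (phi : T -> U) (f : U -> C) (l : list T) :
  big op e f (map phi l) = big op e (fun x => f (phi x)) l.
Proof. induction l as [| a l IH]; simpl; [reflexivity | now rewrite IH]. Qed.

Lemma big_ext {op e} {T : Type} (f g : T -> C) (l : list T) :
  (forall x, In x l -> f x = g x) -> big op e f l = big op e g l.
Proof.
induction l as [| a l IH]; simpl; intros E; [reflexivity |].
rewrite E by auto; rewrite IH; auto.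
Qed.

Lemma big_op {op e} `{CMonoid op e} {T : Type} (f g : T -> C) (l : list T) :
  big op e (fun x => op (f x) (g x)) l = op (big op e f l) (big op e g l).
Proof.
induction l as [| a l IH]; simpl; [now rewrite cm_unit |].
rewrite IH, <- !cm_assoc; f_equal; rewrite !cm_assoc; f_equal; apply cm_comm.
Qed.

Lemma rsum_perm {T : Type} (b : T -> R) (l l' : list T) :
  Permutation l l' -> rsum b l = rsum b l'.
Proof. induction 1; simpl; lra. Qed.

Lemma rsum_app {T : Type} (b : T -> R) (l l' : list T) :
  rsum b (l ++ l') = (rsum b l + rsum b l')%R.
Proof. induction l as [| a l IH]; simpl; lra. Qed.

Lemma rsum_map {T U : Type} (phi : T -> U) (b : U -> R) (l : list T) :
  rsum b (map phi l) = rsum (fun x => b (phi x)) l.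
Proof. induction l as [| a l IH]; simpl; lra. Qed.

Lemma rsum_le {T : Type} (b b' : T -> R) (l : list T) :
  (forall x, In x l -> b x <= b' x)%R -> (rsum b l <= rsum b' l)%R.
Proof.
induction l as [| a l IH]; simpl; intros H; [lra |].
assert (b a <= b' a)%R by auto; assert (rsum b l <= rsum b' l)%R by auto; lra.
Qed.

Lemma rsum_plus {T : Type} (a b : T -> R) (l : list T) :
  rsum (fun x => a x + b x)%R l = (rsum a l + rsum b l)%R.
Proof. induction l as [| x l IH]; simpl; [ring | rewrite IH; ring]. Qed.

Lemma rsum_scal {T : Type} (b : T -> R) (k : R) (l : list T) :
  rsum (fun x => k * b x)%R l = (k * rsum b l)%R.
Proof. induction l as [| a l IH]; simpl; [ring | rewrite IH; ring]. Qed.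

Lemma list_split {T : Type} (P : T -> Prop) (l : list T) :
  NoDup l -> exists l1 l2, Permutation l (l1 ++ l2) /\ NoDup l1 /\ NoDup l2 /\
    (forall x, In x l1 <-> In x l /\ P x) /\ (forall x, In x l2 <-> In x l /\ ~ P x).
Proof.
induction l as [| a l IH]; intros Hl.
- exists nil, nil; repeat split; simpl; try tauto; try constructor.
- inversion_clear Hl as [| ? ? Ha Hl'].
  destruct (IH Hl') as [l1 [l2 [H1 [H2 [H3 [H4 H5]]]]]].
  destruct (classic (P a)) as [HP | HP].
  + exists (a :: l1), l2; split; [simpl; now constructor |].
    split; [constructor; [rewrite H4; tauto | exact H2] |].
    split; [exact H3 |]; split; intros x; simpl; [rewrite H4 | rewrite H5].
    * split; [intros [<- | []]; auto | intros [[-> | ] ]; auto].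
    * split; [intros []; auto |]; intros [[<- | ] ]; tauto.
  + exists l1, (a :: l2); split; [now apply Permutation_cons_app |].
    split; [exact H2 |].
    split; [constructor; [rewrite H5; tauto | exact H3] |].
    split; intros x; simpl; [rewrite H4 | rewrite H5].
    * split; [intros []; auto |]; intros [[<- | ] ]; tauto.
    * split; [intros [<- | []]; auto | intros [[-> | ] ]; auto].
Qed.

Lemma rsum_incl {T : Type} (b : T -> R) (l l' : list T) :
  NoDup l -> incl l l' -> (forall x, In x l' -> 0 <= b x)%R -> (rsum b l <= rsum b l')%R.
Proof.
revert l'; induction l as [| a l IH]; simpl; intros l' Hl Hi Hb; [now apply rsum_ge_0 |].
inversion_clear Hl as [| ? ? Ha Hl'].
destruct (in_split a l') as [l1 [l2 E]]; [apply Hi; now left |]; subst l'.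
rewrite (rsum_perm b (l1 ++ a :: l2) (a :: l1 ++ l2)) by (apply Permutation_sym, Permutation_middle).
simpl; apply Rplus_le_compat_l, IH; trivial.
- intros x Hx; assert (H : In x (l1 ++ a :: l2)) by (apply Hi; now right).
  apply in_app_or in H; apply in_or_app; destruct H as [H | [H | H]]; auto.
  subst; contradiction.
- intros x Hx; apply Hb; apply in_app_or in Hx; apply in_or_app; simpl; tauto.
Qed.

Definition conv {T : Type} (op : C -> C -> C) (e : C) (A : T -> Prop) (f : T -> C) (p : C) : Prop :=
  tends (finite_subsets A) (big op e f) p.

Lemma conv_unique {op e} {T : Type} (A : T -> Prop) (f : T -> C) (p q : C) :
  conv op e A f p -> conv op e A f q -> p = q.
Proof. apply tends_unique, finite_subsets_filter. Qed.

Lemma conv_ext {op e} {T : Type} (A : T -> Prop) (f g : T -> C) (p : C) :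
  (forall x, A x -> f x = g x) -> conv op e A f p -> conv op e A g p.
Proof.
intros E; apply tends_ext_F; [typeclasses eauto |].
exists nil; split; [intros x [] |]; intros l _ HA _; apply big_ext; auto.
Qed.

Lemma conv_iff {op e} {T : Type} (A B : T -> Prop) (f : T -> C) (p : C) :
  (forall x, A x <-> B x) -> conv op e A f p -> conv op e B f p.
Proof.
intros E H eps Heps; destruct (H eps Heps) as [l0 [H0 H1]]; exists l0; split.
- intros x Hx; apply E; auto.
- intros l Hl HB Hi; apply H1; trivial; intros x Hx; apply E; auto.
Qed.

Lemma list_preimage {T U : Type} (A : T -> Prop) (phi : T -> U) (l : list U) :
  (forall y, In y l -> exists x, A x /\ phi x = y) ->
  exists l', map phi l' = l /\ forall x, In x l' -> A x.
Proof.
induction l as [| y l IH]; intros H.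
- exists nil; split; [reflexivity | intros x []].
- destruct (H y (or_introl eq_refl)) as [x [Hx E]].
  destruct IH as [l' [E' H']]; [intros; apply H; now right |].
  exists (x :: l'); simpl; split; [now rewrite E, E' |]; intros t [<- | Ht]; auto.
Qed.

Lemma NoDup_map_on {T U : Type} (A : T -> Prop) (phi : T -> U) (l : list T) :
  (forall x y, A x -> A y -> phi x = phi y -> x = y) ->
  (forall x, In x l -> A x) -> NoDup l -> NoDup (map phi l).
Proof.
intros Hinj; induction l as [| a l IH]; simpl; intros HA Hl; [constructor |].
inversion_clear Hl as [| ? ? Ha Hl']; constructor; [| apply IH; auto].
intros H; apply in_map_iff in H; destruct H as [x [E Hx]].
apply Ha; replace a with x; [exact Hx |]; apply Hinj; auto.
Qed.

Lemma conv_reindex {op e} {T U : Type} (A : T -> Prop) (B : U -> Prop) (phi : T -> U)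
  (f : U -> C) (p : C) :
  (forall x, A x -> B (phi x)) ->
  (forall x y, A x -> A y -> phi x = phi y -> x = y) ->
  (forall y, B y -> exists x, A x /\ phi x = y) ->
  (conv op e A (fun x => f (phi x)) p <-> conv op e B f p).
Proof.
intros Hphi Hinj Hsurj; split; intros H eps Heps; destruct (H eps Heps) as [l0 [H0 H1]].
- exists (map phi l0); split.
  { intros y Hy; apply in_map_iff in Hy; destruct Hy as [x [<- Hx]]; auto. }
  intros l Hl HB Hi; destruct (list_preimage A phi l) as [l' [E' HA']]; [auto |].
  subst l; rewrite big_map; apply H1; trivial.
  + now apply NoDup_map_inv in Hl.
  + intros x Hx; assert (Hy : In (phi x) (map phi l')) by (apply Hi, in_map, Hx).
    apply in_map_iff in Hy; destruct Hy as [x' [E Hx']].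
    replace x with x'; [exact Hx' |]; apply Hinj; auto.
- destruct (list_preimage A phi l0) as [l0' [E0 HA0]]; [auto |]; subst l0.
  exists l0'; split; [exact HA0 |]; intros l Hl HA Hi.
  rewrite <- big_map; apply H1.
  + now apply (NoDup_map_on A).
  + intros y Hy; apply in_map_iff in Hy; destruct Hy as [x [<- Hx]]; auto.
  + intros y Hy; apply in_map_iff in Hy; destruct Hy as [x [<- Hx]]; apply in_map; auto.
Qed.

Lemma NoDup_app_disjoint {T : Type} (l l' : list T) :
  NoDup l -> NoDup l' -> (forall x, In x l -> ~ In x l') -> NoDup (l ++ l').
Proof.
induction l as [| a l IH]; simpl; intros Hl Hl' Hd; [exact Hl' |].
inversion_clear Hl as [| ? ? Ha Hl2]; constructor.
- intros H; apply in_app_or in H; destruct H as [H | H]; [auto | apply (Hd a); auto].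
- apply IH; auto.
Qed.

(** The finite parts that approximate the fibres over a finite set [L] together form one finite
    part of [A], so that convergence along the finite parts of [A] already controls the values
    of [g]. *)
Lemma conv_fibers {op e} `{CMonoid op e} {T U : Type} (A : T -> Prop) (B : U -> Prop)
  (pi : T -> U) (f : T -> C) (g : U -> C) (p : C) :
  (forall x, A x -> B (pi x)) ->
  (forall u, B u -> conv op e (fun x => A x /\ pi x = u) f (g u)) ->
  conv op e A f p -> conv op e B g p.
Proof.
intros Hpi Hfib Hp eps Heps.
assert (He2 : (0 < eps / 2)%R) by lra.
destruct (Hp _ He2) as [l0 [H0 H1]]; exists (map pi l0); split.
{ intros y Hy; apply in_map_iff in Hy; destruct Hy as [x [<- Hx]]; auto. }
(* one finite part of [A] that contains [l0] over [L] and approximates all fibres over [L] *)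
assert (Happ : forall L, NoDup L -> (forall u, In u L -> B u) -> forall d, (0 < d)%R ->
  exists l, NoDup l /\ (forall x, In x l -> A x /\ In (pi x) L) /\
    (forall x, In x l0 -> In (pi x) L -> In x l) /\
    (Cmod (big op e f l - big op e g L) < d)%R).
{ induction L as [| u L IH]; intros HL HB d Hd.
  - exists nil; split; [constructor |]; split; [intros x [] |]; split; [intros x _ [] |].
    simpl; replace (e - e) with (RtoC 0) by ring; rewrite Cmod_0; exact Hd.
  - inversion_clear HL as [| ? ? Hu HL'].
    destruct (cm_cont (g u) (big op e g L) d Hd) as [d' [Hd' Hcont]].
    destruct (IH HL') with (d := d') as [l [G1 [G2 [G3 G4]]]]; [intros; apply HB; now right | exact Hd' |].
    destruct (Hfib u (HB u (or_introl eq_refl)) d' Hd') as [lu [K1 K2]].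
    destruct (exists_NoDup l0) as [l0' [N0 N1]].
    destruct (list_split (fun x => pi x = u) l0' N0) as [m1 [m2 [_ [_ [_ [M1 _]]]]]].
    destruct (exists_NoDup (lu ++ m1)) as [k [Nk Ik]].
    assert (Ak : forall x, In x k -> A x /\ pi x = u).
    { intros x Hx; apply Ik, in_app_or in Hx; destruct Hx as [Hx | Hx]; [auto |].
      apply M1 in Hx; destruct Hx as [Hx E]; split; [apply H0, N1 |]; assumption. }
    exists (k ++ l); split; [| split; [| split]].
    + apply NoDup_app_disjoint; trivial; intros x Hx Hx'.
      apply Hu; destruct (Ak x Hx) as [_ <-]; now apply G2.
    + intros x Hx; apply in_app_or in Hx; simpl; destruct Hx as [Hx | Hx].
      * destruct (Ak x Hx); auto.
      * destruct (G2 x Hx); auto.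
    + intros x Hx [E | E]; apply in_or_app; [left | right; auto].
      apply Ik, in_or_app; right; apply M1; split; [now apply N1 | now symmetry].
    + rewrite big_app; simpl; apply Hcont; trivial; apply K2; trivial.
      intros x Hx; apply Ik, in_or_app; now left. }
intros L HL HB Hi.
destruct (Happ L HL HB (eps / 2)%R He2) as [l [G1 [G2 [G3 G4]]]].
assert (G5 : (Cmod (big op e f l - p) < eps / 2)%R).
{ apply H1; trivial.
  - intros x Hx; now apply G2.
  - intros x Hx; apply G3; trivial; apply Hi, in_map, Hx. }
assert (G6 := Cmod_sub_triangle (big op e g L) (big op e f l) p).
rewrite Cmod_sub_sym in G4; lra.
Qed.

Lemma conv_op {op e} `{CMonoid op e} {T : Type} (A : T -> Prop) (f g : T -> C) (p q : C) :
  conv op e A f p -> conv op e A g q -> conv op e A (fun x => op (f x) (g x)) (op p q).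
Proof.
intros Hf Hg eps Heps; destruct (cm_cont p q eps Heps) as [d [Hd Hc]].
generalize (filter_and _ _ (Hf d Hd) (Hg d Hd)); apply filter_imp; intros l [H1 H2].
rewrite big_op; auto.
Qed.

Lemma conv_morph {op e op' e'} {T : Type} (A : T -> Prop) (f : T -> C) (p : C) (phi : C -> C) :
  (forall x y, phi (op x y) = op' (phi x) (phi y)) -> phi e = e' -> continuous_atC phi p ->
  conv op e A f p -> conv op' e' A (fun x => phi (f x)) (phi p).
Proof.
intros Hop He Hc Hf; unfold conv.
apply (tends_ext _ (fun l => phi (big op e f l))).
- intros l; induction l as [| a l IH]; simpl; [exact He | now rewrite Hop, IH].
- apply tends_comp; [typeclasses eauto | exact Hc | exact Hf].
Qed.

Lemma conv_union {op e} `{CMonoid op e} {T : Type} (A B : T -> Prop) (f : T -> C) (p q : C) :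
  (forall x, A x -> ~ B x) -> conv op e A f p -> conv op e B f q ->
  conv op e (fun x => A x \/ B x) f (op p q).
Proof.
intros Hd Hp Hq eps Heps; destruct (cm_cont p q eps Heps) as [d [Hd' Hc]].
destruct (Hp d Hd') as [l1 [A1 H1]]; destruct (Hq d Hd') as [l2 [A2 H2]].
exists (l1 ++ l2); split.
{ intros x Hx; apply in_app_or in Hx; destruct Hx; auto. }
intros l Hl HAB Hi.
destruct (list_split A l Hl) as [k1 [k2 [P [N1 [N2 [I1 I2]]]]]].
rewrite (big_perm f _ _ P), big_app; apply Hc.
- apply H1; trivial; intros x Hx; [now apply I1 in Hx |].
  apply I1; split; [apply Hi, in_or_app; now left | auto].
- apply H2; trivial; intros x Hx.
  + apply I2 in Hx; destruct Hx as [Hx HA]; destruct (HAB x Hx); tauto.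
  + apply I2; split; [apply Hi, in_or_app; now right |].
    intros HA; apply (Hd x HA); auto.
Qed.

Lemma conv_unit {op e} `{CMonoid op e} {T : Type} (A : T -> Prop) : conv op e A (fun _ : T => e) e.
Proof.
unfold conv; apply (tends_ext _ (fun _ => e)); [| apply tends_const; typeclasses eauto].
intros l; induction l as [| a l IH]; simpl; [reflexivity |]; now rewrite <- IH, cm_unit.
Qed.

Lemma conv_support {op e} `{CMonoid op e} {T : Type} (A B : T -> Prop) (f : T -> C) (p : C) :
  (forall x, A x -> B x) -> (forall x, B x -> ~ A x -> f x = e) ->
  conv op e A f p -> conv op e B f p.
Proof.
intros HAB Hf Hp; rewrite <- (cm_unit_r p).
apply (conv_iff (fun x => A x \/ (B x /\ ~ A x))).
- intros x; destruct (classic (A x)); [|tauto]; split; auto.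
- apply conv_union; [tauto | exact Hp |].
  apply (conv_ext _ (fun _ => e)); [| apply conv_unit].
  intros x [H1 H2]; symmetry; auto.
Qed.

Lemma conv_singleton {op e} `{CMonoid op e} {T : Type} (f : T -> C) (a : T) :
  conv op e (fun x => x = a) f (f a).
Proof.
intros eps Heps; exists (a :: nil); split.
- intros x [<- | []]; reflexivity.
- intros l Hl HA Hi.
  assert (E : l = a :: nil).
  { destruct l as [| b l]; [destruct (Hi a (or_introl eq_refl)) |].
    destruct l as [| c l].
    - f_equal; apply HA; now left.
    - exfalso; inversion_clear Hl as [| ? ? Hb _]; apply Hb; left.
      rewrite (HA c) by (right; now left); symmetry; apply HA; now left. }
  rewrite E; simpl; rewrite (cm_unit_r (op := op) (e := e)).
  replace (f a - f a) with (RtoC 0) by ring; now rewrite Cmod_0.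
Qed.

(** An unordered value can be computed along any exhaustion, in particular by partial sums over
    initial segments or over symmetric intervals, where telescoping is visible. *)
Lemma conv_exhaust {op e} {S T : Type} (F : (S -> Prop) -> Prop) {FF : Filter F}
  (A : T -> Prop) (f : T -> C) (p : C) (L : S -> list T) :
  (forall s, NoDup (L s)) -> (forall s x, In x (L s) -> A x) ->
  (forall x, A x -> F (fun s => In x (L s))) ->
  conv op e A f p -> tends F (fun s => big op e f (L s)) p.
Proof.
intros HN HA HF Hp eps Heps; destruct (Hp eps Heps) as [l0 [H0 H1]].
assert (HI : F (fun s => incl l0 (L s))).
{ clear H1; induction l0 as [| a l0 IH].
  - apply filter_forall; intros s x [].
  - assert (Ha : F (fun s => In a (L s))) by (apply HF, H0; now left).
    assert (Hl : F (fun s => incl l0 (L s))) by (apply IH; intros; apply H0; now right).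
    generalize (filter_and _ _ Ha Hl); apply filter_imp; intros s [Hs1 Hs2] x [<- | Hx]; auto. }
revert HI; apply filter_imp; intros s Hs; apply H1; trivial; apply HA.
Qed.

Notation has_sum := (conv Cplus (RtoC 0)).
Notation has_prod := (conv Cmult (RtoC 1)).

(** * Absolute summability and dominated convergence *)

Definition summable {T : Type} (A : T -> Prop) (b : T -> R) : Prop :=
  (forall x, A x -> 0 <= b x)%R /\
  exists M, forall l, NoDup l -> (forall x, In x l -> A x) -> (rsum b l <= M)%R.

Lemma summable_le {T : Type} (A : T -> Prop) (b b' : T -> R) :
  (forall x, A x -> 0 <= b' x <= b x)%R -> summable A b -> summable A b'.
Proof.
intros Hb [_ [M HM]]; split; [intros x Hx; now apply Hb |]; exists M; intros l Hl HA.
eapply Rle_trans; [apply rsum_le | apply HM; eassumption].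
intros x Hx; apply Hb; auto.
Qed.

Lemma summable_sub {T : Type} (A A' : T -> Prop) (b : T -> R) :
  (forall x, A' x -> A x) -> summable A b -> summable A' b.
Proof. intros H [H0 [M HM]]; split; [auto |]; exists M; auto. Qed.

Lemma summable_scal {T : Type} (A : T -> Prop) (b : T -> R) (k : R) :
  (0 <= k)%R -> summable A b -> summable A (fun x => k * b x)%R.
Proof.
intros Hk [H0 [M HM]]; split; [intros x Hx; apply Rmult_le_pos; auto |].
exists (k * M)%R; intros l Hl HA; rewrite rsum_scal; apply Rmult_le_compat_l; auto.
Qed.

Lemma summable_finite_exception {T : Type} (A : T -> Prop) (E : list T) (b : T -> R) :
  (forall x, A x -> 0 <= b x)%R -> summable (fun x => A x /\ ~ In x E) b -> summable A b.
Proof.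
intros Hb [_ [M HM]]; split; [exact Hb |].
exists (rsum (fun x => Rabs (b x)) E + M)%R; intros l Hl HA.
destruct (list_split (fun x => In x E) l Hl) as [l1 [l2 [P [N1 [N2 [I1 I2]]]]]].
rewrite (rsum_perm b _ _ P), rsum_app; apply Rplus_le_compat.
- apply Rle_trans with (rsum (fun x => Rabs (b x)) l1); [apply rsum_le; intros; apply Rle_abs |].
  apply rsum_incl; trivial; [intros x Hx; now apply I1 in Hx | intros; apply Rabs_pos].
- apply HM; trivial; intros x Hx; apply I2 in Hx; destruct Hx; auto.
Qed.

Lemma summable_inj {T U : Type} (A : T -> Prop) (B : U -> Prop) (phi : T -> U) (b : U -> R) :
  (forall x, A x -> B (phi x)) -> (forall x y, A x -> A y -> phi x = phi y -> x = y) ->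
  summable B b -> summable A (fun x => b (phi x)).
Proof.
intros HAB Hinj [H0 [M HM]]; split; [auto |]; exists M; intros l Hl HA.
rewrite <- (rsum_map phi); apply HM; [now apply (NoDup_map_on A) |].
intros y Hy; apply in_map_iff in Hy; destruct Hy as [x [<- Hx]]; auto.
Qed.

Lemma rsum_list_prod {T U : Type} (a : T -> R) (b : U -> R) (l : list T) (k : list U) :
  rsum (fun x => a (fst x) * b (snd x))%R (list_prod l k) = (rsum a l * rsum b k)%R.
Proof.
induction l as [| x l IH]; simpl; [ring |].
rewrite rsum_app, rsum_map, IH; simpl; rewrite rsum_scal; ring.
Qed.

Lemma summable_prod {T U : Type} (A : T -> Prop) (B : U -> Prop) (a : T -> R) (b : U -> R) :
  summable A a -> summable B b ->
  summable (fun x : T * U => A (fst x) /\ B (snd x)) (fun x => a (fst x) * b (snd x))%R.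
Proof.
intros [Ha [M HM]] [Hb [N HN]]; split.
{ intros x [H1 H2]; apply Rmult_le_pos; auto. }
exists (M * N)%R; intros l Hl HA.
destruct (exists_NoDup (map fst l)) as [l1 [N1 I1]].
destruct (exists_NoDup (map snd l)) as [l2 [N2 I2]].
assert (A1 : forall x, In x l1 -> A x).
{ intros x Hx; apply I1, in_map_iff in Hx; destruct Hx as [y [<- Hy]]; now apply HA. }
assert (A2 : forall x, In x l2 -> B x).
{ intros x Hx; apply I2, in_map_iff in Hx; destruct Hx as [y [<- Hy]]; now apply HA. }
apply Rle_trans with (rsum (fun x => a (fst x) * b (snd x))%R (list_prod l1 l2)).
- apply rsum_incl; trivial.
  + intros [x y] Hx; apply in_prod; [apply I1 | apply I2]; apply in_map_iff;
      exists (x, y); auto.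
  + intros [x y] Hx; apply in_prod_iff in Hx; simpl; apply Rmult_le_pos; [apply Ha | apply Hb];
      [apply A1 | apply A2]; tauto.
- rewrite rsum_list_prod; apply Rmult_le_compat.
  + apply rsum_ge_0; auto.
  + apply rsum_ge_0; auto.
  + apply HM; auto.
  + apply HN; auto.
Qed.

Lemma summable_nat (b : nat -> R) (M : R) :
  (forall n, 0 <= b n)%R -> (forall n, rsum b (seq 0 n) <= M)%R -> summable (fun _ => True) b.
Proof.
intros Hb HM; split; [auto |]; exists M; intros l Hl _.
apply Rle_trans with (rsum b (seq 0 (S (list_max l)))); [| apply HM].
apply rsum_incl; [exact Hl | | auto].
intros x Hx; apply in_seq; split; [lia |].
assert (H := proj1 (list_max_le l (list_max l)) (Nat.le_refl _)).
rewrite Forall_forall in H; specialize (H x Hx); lia.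
Qed.

(** Takes each value at most twice, which reduces bounds over [Z] to sums over initial segments
    of [nat]. *)
Definition zindex (n : Z) : nat := if Z_lt_dec n 0 then Z.to_nat (- n - 1) else Z.to_nat n.

Lemma zindex_bound (b : nat -> R) (M : R) :
  (forall n, 0 <= b n)%R -> (forall n, rsum b (seq 0 n) <= M)%R ->
  forall l, NoDup l -> (rsum (fun n => b (zindex n)) l <= 2 * M)%R.
Proof.
intros Hb HM l Hl.
assert (H : forall l, NoDup l -> (forall x y, In x l -> In y l -> zindex x = zindex y -> x = y) ->
  (rsum (fun n => b (zindex n)) l <= M)%R).
{ clear l Hl; intros l Hl Hinj; rewrite <- (rsum_map zindex).
  set (m := map zindex l).
  apply Rle_trans with (rsum b (seq 0 (S (list_max m)))); [| apply HM].
  apply rsum_incl; [| | auto].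
  - apply (NoDup_map_on (fun x => In x l)); auto.
  - intros x Hx; apply in_seq; split; [lia |].
    assert (H := proj1 (list_max_le m (list_max m)) (Nat.le_refl _)).
    rewrite Forall_forall in H; specialize (H x Hx); lia. }
destruct (list_split (fun n => n < 0)%Z l Hl) as [l1 [l2 [P [N1 [N2 [I1 I2]]]]]].
rewrite (rsum_perm _ _ _ P), rsum_app.
assert (rsum (fun n => b (zindex n)) l1 <= M)%R.
{ apply H; trivial; intros x y Hx Hy; apply I1 in Hx; apply I1 in Hy; unfold zindex.
  destruct (Z_lt_dec x 0), (Z_lt_dec y 0); lia. }
assert (rsum (fun n => b (zindex n)) l2 <= M)%R.
{ apply H; trivial; intros x y Hx Hy; apply I2 in Hx; apply I2 in Hy; unfold zindex.
  destruct (Z_lt_dec x 0), (Z_lt_dec y 0); lia. }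
lra.
Qed.

Lemma summable_tail {T : Type} (A : T -> Prop) (b : T -> R) (eps : R) :
  summable A b -> (0 < eps)%R -> exists l0, NoDup l0 /\ (forall x, In x l0 -> A x) /\
  forall l, NoDup l -> (forall x, In x l -> A x /\ ~ In x l0) -> (rsum b l < eps)%R.
Proof.
intros [Hb [M HM]] Heps.
set (E := fun r => exists l, NoDup l /\ (forall x, In x l -> A x) /\ r = rsum b l).
destruct (completeness E) as [s [Hs1 Hs2]].
- exists M; intros r [l [H1 [H2 ->]]]; auto.
- exists 0%R, nil; repeat split; [constructor | intros x []].
- destruct (classic (exists l0, NoDup l0 /\ (forall x, In x l0 -> A x) /\ (s - eps < rsum b l0)%R))
    as [[l0 [N0 [A0 H0]]] | H].
  + exists l0; split; [exact N0 |]; split; [exact A0 |]; intros l Hl HA.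
    assert (H : (rsum b (l0 ++ l) <= s)%R).
    { apply Hs1; exists (l0 ++ l); split; [| split; [| reflexivity]].
      - apply NoDup_app_disjoint; trivial; intros x H1 H2; now destruct (HA x H2).
      - intros x Hx; apply in_app_or in Hx; destruct Hx as [Hx | Hx]; [auto | now apply HA]. }
    rewrite rsum_app in H; lra.
  + exfalso; assert (Hu : is_upper_bound E (s - eps)%R).
    { intros r [l [H1 [H2 ->]]]; apply Rnot_lt_le; intros Hlt; apply H; exists l; auto. }
    assert (H3 := Hs2 _ Hu); lra.
Qed.

Lemma exp_le (x y : R) : (x <= y)%R -> (exp x <= exp y)%R.
Proof. intros [H | ->]; [left; now apply exp_increasing | apply Rle_refl]. Qed.

Lemma exp_small (K eps : R) : (0 <= K)%R -> (0 < eps)%R ->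
  exists d, (0 < d)%R /\ (K * (exp d - 1) < eps)%R.
Proof.
intros HK Heps.
assert (Hpos : (0 < eps / (K + 1))%R) by (apply Rdiv_lt_0_compat; lra).
exists (ln (1 + eps / (K + 1)))%R; split.
- rewrite <- ln_1; apply ln_increasing; lra.
- rewrite exp_ln by lra.
  replace (K * (1 + eps / (K + 1) - 1))%R with (eps * (K / (K + 1)))%R by (field; lra).
  assert (K / (K + 1) < 1)%R by (apply Rlt_div_l; lra); nra.
Qed.

Lemma rsum_le_on {T : Type} (A : T -> Prop) (a b : T -> R) (l : list T) :
  (forall x, A x -> a x <= b x)%R -> (forall x, In x l -> A x) -> (rsum a l <= rsum b l)%R.
Proof. intros H HA; apply rsum_le; auto. Qed.

(** The set [l0] depends only on the majorant [b]. This uniformity in [f] is what dominated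
    convergence needs. *)
Lemma conv_tail {op e} `{CMonoid op e} {T : Type} (A : T -> Prop) (b : T -> R) (eps : R) :
  summable A b -> (0 < eps)%R -> exists l0, NoDup l0 /\ (forall x, In x l0 -> A x) /\
  forall f, (forall x, A x -> Cmod (f x - e) <= b x)%R ->
  forall l, NoDup l -> (forall x, In x l -> A x) -> incl l0 l ->
    (Cmod (big op e f l - big op e f l0) < eps)%R.
Proof.
intros Hs Heps; destruct (proj2 Hs) as [M HM].
destruct (exp_small (exp M) eps) as [d [Hd Hd2]]; [left; apply exp_pos | exact Heps |].
destruct (summable_tail A b d Hs Hd) as [l0 [N0 [A0 H0]]].
exists l0; split; [exact N0 |]; split; [exact A0 |]; intros f Hf l Hl HA Hi.
destruct (list_split (fun x => In x l0) l Hl) as [l1 [l2 [P [N1 [N2 [I1 I2]]]]]].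
assert (P1 : Permutation l1 l0).
{ apply NoDup_Permutation; trivial; intros x; rewrite I1; split; [tauto | auto]. }
rewrite (big_perm f _ _ P), big_app, (big_perm f _ _ P1).
eapply Rle_lt_trans; [apply cm_est |]; refine (Rle_lt_trans _ _ _ _ Hd2).
assert (E1 : (rsum (fun x => Cmod (f x - e)) l0 <= M)%R).
{ eapply Rle_trans; [apply (rsum_le_on A) | apply HM]; eauto. }
assert (E2 : (rsum (fun x => Cmod (f x - e)) l2 <= d)%R).
{ eapply Rle_trans; [apply (rsum_le_on A) | left; apply H0]; eauto.
  - intros x Hx; apply I2 in Hx; apply HA; tauto.
  - intros x Hx; apply I2 in Hx; split; [apply HA |]; tauto. }
assert (E3 : (0 <= rsum (fun x => Cmod (f x - e)) l2)%R)
  by (apply rsum_ge_0; intros; apply Cmod_ge_0).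
apply Rmult_le_compat; [left; apply exp_pos | | now apply exp_le |].
- apply exp_le in E3; rewrite exp_0 in E3; lra.
- apply exp_le in E2; lra.
Qed.

Lemma conv_exists {op e} `{CMonoid op e} {T : Type} (A : T -> Prop) (f : T -> C) (b : T -> R) :
  summable A b -> (forall x, A x -> Cmod (f x - e) <= b x)%R -> exists p, conv op e A f p.
Proof.
intros Hs Hf; apply tends_cauchy; [typeclasses eauto |]; intros eps Heps.
destruct (conv_tail A b eps Hs Heps) as [l0 [N0 [A0 H0]]].
exists (big op e f l0); exists l0; split; [exact A0 |]; intros; auto.
Qed.

Lemma tends_big {op e} `{CMonoid op e} {S T : Type} (F : (S -> Prop) -> Prop) {FF : Filter F}
  (f : S -> T -> C) (f0 : T -> C) (l : list T) :
  (forall x, In x l -> tends F (fun s => f s x) (f0 x)) ->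
  tends F (fun s => big op e (f s) l) (big op e f0 l).
Proof.
induction l as [| a l IH]; simpl; intros Hl; [now apply tends_const |].
intros eps Heps; destruct (cm_cont (f0 a) (big op e f0 l) eps Heps) as [d [Hd Hc]].
assert (H1 : tends F (fun s => f s a) (f0 a)) by auto.
assert (H2 : tends F (fun s => big op e (f s) l) (big op e f0 l)) by auto.
generalize (filter_and _ _ (H1 d Hd) (H2 d Hd)); apply filter_imp; intros s [H3 H4]; auto.
Qed.

(** Up to [eps / 4], both values are those of one finite part, which passes to the limit
    termwise. *)
Lemma conv_dominated {op e} `{CMonoid op e} {S T : Type} (F : (S -> Prop) -> Prop)
  {FF : ProperFilter F} (A : T -> Prop) (b : T -> R)
  (f : S -> T -> C) (f0 : T -> C) (p : S -> C) (p0 : C) :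
  summable A b -> F (fun s => forall x, A x -> Cmod (f s x - e) <= b x)%R ->
  (forall x, A x -> tends F (fun s => f s x) (f0 x)) ->
  F (fun s => conv op e A (f s) (p s)) -> conv op e A f0 p0 ->
  tends F p p0.
Proof.
intros Hs Hb Hf Hp Hp0 eps Heps.
assert (Hb0 : forall x, A x -> (Cmod (f0 x - e) <= b x)%R).
{ intros x Hx; apply (Cmod_le_lim F (fun s => f s x)); [auto |].
  revert Hb; apply filter_imp; auto. }
assert (H4 : (0 < eps / 4)%R) by lra.
destruct (conv_tail A b (eps / 4) Hs H4) as [l0 [N0 [A0 H0]]].
assert (Hlim : forall g q, (forall x, A x -> Cmod (g x - e) <= b x)%R -> conv op e A g q ->
  (Cmod (q - big op e g l0) <= eps / 4)%R).
{ intros g q Hg Hq; apply (Cmod_le_lim (finite_subsets A) (big op e g)); [exact Hq |].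
  exists l0; split; [exact A0 |]; intros l Hl HA Hi; left; auto. }
assert (Hl0 := tends_big F f f0 l0 (fun x Hx => Hf x (A0 x Hx)) (eps / 4)%R H4).
generalize (filter_and _ _ Hl0 (filter_and _ _ Hb Hp)); apply filter_imp; intros s [G1 [G2 G3]].
assert (L1 := Hlim _ _ G2 G3); assert (L2 := Hlim _ _ Hb0 Hp0).
assert (T1 := Cmod_sub_triangle (p s) (big op e (f s) l0) p0).
assert (T2 := Cmod_sub_triangle (big op e (f s) l0) (big op e f0 l0) p0).
rewrite (Cmod_sub_sym p0) in L2; lra.
Qed.

(** On the finite set [E] the pointwise limits themselves provide an eventual bound. *)
Lemma conv_dominated_except {op e} `{CMonoid op e} {S T : Type} (F : (S -> Prop) -> Prop)
  {FF : ProperFilter F} (A : T -> Prop) (E : list T) (b : T -> R)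
  (f : S -> T -> C) (f0 : T -> C) (p : S -> C) (p0 : C) :
  summable A b ->
  F (fun s => forall x, A x -> ~ In x E -> Cmod (f s x - e) <= b x)%R ->
  (forall x, A x -> tends F (fun s => f s x) (f0 x)) ->
  F (fun s => conv op e A (f s) (p s)) -> conv op e A f0 p0 ->
  tends F p p0.
Proof.
intros Hs Hb Hf.
set (b' := fun x => (b x + if excluded_middle_informative (In x E) then Cmod (f0 x - e) + 1 else 0)%R).
apply (conv_dominated F A b'); [| | exact Hf].
- apply (summable_finite_exception A E).
  + intros x Hx; assert (Hbx := proj1 Hs x Hx); unfold b'.
    assert (H1 := Cmod_ge_0 (f0 x - e)); destruct excluded_middle_informative; lra.
  + apply (summable_le _ b); [| apply (summable_sub A); [tauto | exact Hs]].
    intros x [Hx Hx']; assert (Hbx := proj1 Hs x Hx); unfold b'.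
    destruct excluded_middle_informative; [contradiction | lra].
- assert (HE : F (fun s => forall x, In x E -> A x -> Cmod (f s x - e) <= Cmod (f0 x - e) + 1)%R).
  { clear Hb; induction E as [| a E IH].
    - apply filter_forall; intros s x [].
    - assert (Ha : F (fun s => A a -> Cmod (f s a - e) <= Cmod (f0 a - e) + 1)%R).
      { destruct (classic (A a)) as [Ha | Ha]; [| apply filter_forall; tauto].
        generalize (Hf a Ha 1%R Rlt_0_1); apply filter_imp; intros s Hsa _.
        assert (T1 := Cmod_sub_triangle (f s a) (f0 a) e); lra. }
      generalize (filter_and _ _ Ha IH); apply filter_imp; intros s [H1 H2] x [<- | Hx]; auto. }
  generalize (filter_and _ _ Hb HE); apply filter_imp; intros s [H1 H2] x Hx.
  assert (Hbx := proj1 Hs x Hx); unfold b'.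
  destruct excluded_middle_informative as [Hin | Hin].
  + specialize (H2 x Hin Hx); lra.
  + specialize (H1 x Hx Hin); lra.
Qed.

Lemma big_mult_neq_0 {T : Type} (f : T -> C) (l : list T) :
  (forall x, In x l -> f x <> 0) -> big Cmult 1 f l <> 0.
Proof.
induction l as [| a l IH]; simpl; intros H.
- intros E; injection E; lra.
- apply Cmult_neq_0; auto.
Qed.

(** The factors outside a suitable finite set have a product within [1 / 2] of 1. *)
Lemma has_prod_neq_0 {T : Type} (A : T -> Prop) (f : T -> C) (b : T -> R) (p : C) :
  summable A b -> (forall x, A x -> Cmod (f x - 1) <= b x)%R -> (forall x, A x -> f x <> 0) ->
  has_prod A f p -> p <> 0.
Proof.
intros Hs Hf Hn Hp Hp0.
destruct (exp_small 1 (1 / 2)) as [d [Hd Hd2]]; try lra.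
destruct (summable_tail A b d Hs Hd) as [l0 [N0 [A0 H0]]].
set (P0 := big Cmult 1 f l0).
assert (HP0 : P0 <> 0) by (apply big_mult_neq_0; auto).
assert (HP1 := proj1 (Cmod_gt_0 _) HP0).
assert (H : (Cmod (p - P0) <= Cmod P0 * (1 / 2))%R).
{ apply (Cmod_le_lim (finite_subsets A) (big Cmult 1 f)); [exact Hp |].
  exists l0; split; [exact A0 |]; intros l Hl HA Hi.
  destruct (list_split (fun x => In x l0) l Hl) as [l1 [l2 [P [N1 [N2 [I1 I2]]]]]].
  assert (P1 : Permutation l1 l0).
  { apply NoDup_Permutation; trivial; intros x; rewrite I1; split; [tauto | auto]. }
  rewrite (big_perm f _ _ P), big_app, (big_perm f _ _ P1); fold P0.
  replace (P0 * big Cmult 1 f l2 - P0) with (P0 * (big Cmult 1 f l2 - 1)) by ring.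
  rewrite Cmod_mult; apply Rmult_le_compat_l; [lra |].
  eapply Rle_trans; [apply Cprod_est |].
  assert (E2 : (rsum (fun x => Cmod (f x - 1)) l2 <= d)%R).
  { eapply Rle_trans; [apply (rsum_le_on A) | left; apply H0]; eauto.
    - intros x Hx; apply I2 in Hx; apply HA; tauto.
    - intros x Hx; apply I2 in Hx; split; [apply HA |]; tauto. }
  apply exp_le in E2; lra. }
rewrite Hp0 in H; replace (0 - P0) with (- P0) in H by ring; rewrite Cmod_opp in H; lra.
Qed.

Lemma has_sum_scal {T : Type} (A : T -> Prop) (f : T -> C) (p k : C) :
  has_sum A f p -> has_sum A (fun x => k * f x) (k * p).
Proof.
apply (conv_morph A f p (fun x => k * x)); [intros; ring | ring |].
intros eps Heps; assert (HK := Cmod_ge_0 k).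
exists (eps / (Cmod k + 1))%R; split; [apply Rdiv_lt_0_compat; lra |]; intros x Hx.
replace (k * x - k * p) with (k * (x - p)) by ring; rewrite Cmod_mult.
apply (Rmult_lt_compat_r (Cmod k + 1)) in Hx; [| lra].
unfold Rdiv in Hx; rewrite Rmult_assoc, Rinv_l, Rmult_1_r in Hx by lra.
assert (H0 := Cmod_ge_0 (x - p)); nra.
Qed.

Lemma has_prod_inv {T : Type} (A : T -> Prop) (f : T -> C) (p : C) :
  p <> 0 -> has_prod A f p -> has_prod A (fun x => / f x) (/ p).
Proof.
intros Hp; apply (conv_morph A f p Cinv).
- intros x y; destruct (Ceq_dec x 0) as [-> | Hx].
  { rewrite Cmult_0_l; replace (/ 0) with (RtoC 0); [ring |].
    unfold Cinv; apply injective_projections; simpl; unfold Rdiv; ring. }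
  destruct (Ceq_dec y 0) as [-> | Hy].
  { rewrite Cmult_0_r; replace (/ 0) with (RtoC 0); [ring |].
    unfold Cinv; apply injective_projections; simpl; unfold Rdiv; ring. }
  field; auto.
- field; intros E; injection E; lra.
- now apply Cinv_continuous.
Qed.

Lemma has_prod_pow {T : Type} (A : T -> Prop) (f : T -> C) (p : C) (n : nat) :
  has_prod A f p -> has_prod A (fun x => f x ^ n) (p ^ n).
Proof.
intros Hp; induction n as [| n IH]; simpl; [apply conv_unit | now apply conv_op].
Qed.

(** * The complex exponential *)

Lemma Ceq_components (x y : C) : Re x = Re y -> Im x = Im y -> x = y.
Proof. intros; apply injective_projections; assumption. Qed.

Lemma Cexp_plus (x y : C) : Cexp (x + y) = Cexp x * Cexp y.
Proof.
destruct x as [a b], y as [c d]; unfold Cexp, Cplus, Cmult, Re, Im; cbn [fst snd].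
rewrite exp_plus, cos_plus, sin_plus; apply injective_projections; cbn [fst snd]; ring.
Qed.

Lemma Cexp_0 : Cexp 0 = 1.
Proof. unfold Cexp; simpl; rewrite exp_0, cos_0, sin_0; apply Ceq_components; simpl; ring. Qed.

Lemma Cexp_opp_r (x : C) : Cexp x * Cexp (- x) = 1.
Proof. rewrite <- Cexp_plus; replace (x + - x) with (RtoC 0) by ring; apply Cexp_0. Qed.

Lemma C1_neq_0 : RtoC 1 <> 0.
Proof. intros E; injection E; lra. Qed.

Lemma Cexp_neq_0 (x : C) : Cexp x <> 0.
Proof.
intros E; assert (H := Cexp_opp_r x); rewrite E, Cmult_0_l in H; symmetry in H; now apply C1_neq_0.
Qed.

Lemma Cexp_opp (x : C) : Cexp (- x) = / Cexp x.
Proof.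
assert (H := Cexp_opp_r x); assert (H0 := Cexp_neq_0 x).
replace (Cexp (- x)) with (Cexp x * Cexp (- x) * / Cexp x) by (field; auto).
rewrite H; ring.
Qed.

Lemma Cexp_minus (x y : C) : Cexp (x - y) = Cexp x / Cexp y.
Proof. unfold Cminus; rewrite Cexp_plus, Cexp_opp; reflexivity. Qed.

Lemma Cexp_INR (x : C) (n : nat) : Cexp (INR n * x) = Cexp x ^ n.
Proof.
induction n as [| n IH].
- simpl; replace (0 * x) with (RtoC 0) by ring; apply Cexp_0.
- rewrite S_INR, RtoC_plus, Cpow_S, <- IH, <- Cexp_plus; f_equal; ring.
Qed.

Lemma Cmod_Cexp (z : C) : Cmod (Cexp z) = exp (Re z).
Proof.
unfold Cexp, Cmod; simpl.
assert (H := sin2_cos2 (Im z)); unfold Rsqr in H.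
replace (exp (Re z) * cos (Im z) * (exp (Re z) * cos (Im z) * 1) +
  exp (Re z) * sin (Im z) * (exp (Re z) * sin (Im z) * 1))%R with (Rsqr (exp (Re z)))
  by (unfold Rsqr; nra).
apply sqrt_Rsqr; left; apply exp_pos.
Qed.

Lemma Cmod_le_sum (z : C) : (Cmod z <= Rabs (Re z) + Rabs (Im z))%R.
Proof.
destruct z as [x y]; unfold Cmod, Re, Im, fst, snd.
apply Rsqr_incr_0_var.
- rewrite Rsqr_sqrt by nra; unfold Rsqr.
  assert (H1 := Rabs_pos x); assert (H2 := Rabs_pos y).
  replace (x ^ 2)%R with (Rabs x * Rabs x)%R by (rewrite <- Rabs_mult, Rabs_pos_eq; nra).
  replace (y ^ 2)%R with (Rabs y * Rabs y)%R by (rewrite <- Rabs_mult, Rabs_pos_eq; nra).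
  nra.
- assert (H1 := Rabs_pos x); assert (H2 := Rabs_pos y); lra.
Qed.

Lemma im_le_Cmod (c : C) : (Rabs (Im c) <= Cmod c)%R.
Proof. eapply Rle_trans; [apply Rmax_r | apply Rmax_Cmod]. Qed.

Lemma Rsin_abs_le (x : R) : (Rabs (sin x) <= Rabs x)%R.
Proof.
assert (H : forall y, (0 <= y)%R -> (Rabs (sin y) <= y)%R).
{ intros y [Hy | <-]; [| rewrite sin_0, Rabs_R0; lra].
  apply Rabs_le; split; [| left; now apply sin_lt_x].
  destruct (Rle_dec 1 y) as [H1 | H1]; [assert (H := SIN_bound y); lra |].
  assert (0 <= sin y)%R; [apply sin_ge_0; assert (H := PI2_3_2); lra | lra]. }
destruct (Rle_dec 0 x) as [Hx | Hx]; [rewrite (Rabs_pos_eq x) by exact Hx; auto |].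
rewrite (Rabs_left x) by lra; rewrite <- (Ropp_involutive x) at 1.
rewrite sin_neg, Rabs_Ropp; apply H; lra.
Qed.

Lemma one_minus_cos_bounds (y : R) : (0 <= 1 - cos y <= y ^ 2 / 2 /\ 1 - cos y <= Rabs y)%R.
Proof.
assert (H : (1 - cos y = 2 * (sin (y / 2) * sin (y / 2)))%R).
{ replace y with (2 * (y / 2))%R at 1 by field; rewrite cos_2a_sin; ring. }
assert (H1 := Rsin_abs_le (y / 2)); assert (H2 := SIN_bound (y / 2)).
assert (H3 : (Rabs (y / 2) = Rabs y / 2)%R).
{ unfold Rdiv; rewrite Rabs_mult, (Rabs_pos_eq (/ 2)); lra. }
rewrite H3 in H1.
assert (H4 : (sin (y / 2) * sin (y / 2) = Rabs (sin (y / 2)) * Rabs (sin (y / 2)))%R)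
  by (rewrite <- Rabs_mult, Rabs_pos_eq; nra).
assert (H5 := Rabs_pos (sin (y / 2))).
assert (H6 : (Rabs (sin (y / 2)) <= 1)%R) by (apply Rabs_le; lra).
assert (H7 : (y ^ 2 = Rabs y * Rabs y)%R) by (rewrite <- Rabs_mult, Rabs_pos_eq; nra).
rewrite H, H4, H7; repeat split; nra.
Qed.

Lemma sin_minus_id (y : R) : (Rabs (sin y - y) <= y ^ 2)%R.
Proof.
destruct (MVT_gen sin 0 y cos) as [c [Hc E]].
- intros x _; auto_derive; [trivial | ring].
- intros x _; apply continuity_sin.
- rewrite sin_0 in E; replace (sin y - y)%R with (- ((1 - cos c) * y))%R by lra.
  rewrite Rabs_Ropp, Rabs_mult.
  destruct (one_minus_cos_bounds c) as [[H1 _] H2].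
  rewrite (Rabs_pos_eq (1 - cos c)) by exact H1.
  assert (H3 : (Rabs c <= Rabs y)%R).
  { revert Hc; unfold Rmin, Rmax; destruct (Rle_dec 0 y); intros Hc;
      [rewrite !Rabs_pos_eq | rewrite (Rabs_left y), (Rabs_left1 c)]; lra. }
  assert (H7 : (y ^ 2 = Rabs y * Rabs y)%R) by (rewrite <- Rabs_mult, Rabs_pos_eq; nra).
  rewrite H7; apply Rmult_le_compat_r; [apply Rabs_pos | lra].
Qed.

Lemma exp_est (x : R) :
  (Rabs (exp x - 1) <= Rabs x * exp (Rabs x) /\ Rabs (exp x - 1 - x) <= x ^ 2 * exp (Rabs x))%R.
Proof.
assert (H1 := exp_ge_1p x); assert (H2 := exp_ge_1p (- x)).
assert (H3 : (exp x * exp (- x) = 1)%R) by (rewrite <- exp_plus, Rplus_opp_r; apply exp_0).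
assert (H4 := exp_pos x); assert (H5 : (exp x - 1 <= x * exp x)%R) by nra.
destruct (Rle_dec 0 x) as [Hx | Hx].
- rewrite (Rabs_pos_eq x) by exact Hx; split; rewrite Rabs_pos_eq; nra.
- rewrite (Rabs_left x) by lra.
  assert (H6 := exp_ge_1p (- x)); assert (E : (exp x <= 1)%R) by (rewrite <- exp_0; apply exp_le; lra).
  split.
  + rewrite Rabs_left1 by lra; nra.
  + rewrite Rabs_pos_eq by lra; nra.
Qed.

(** The real and the imaginary part of [exp z - 1 - z] split into the second-order remainders of
    the real exponential, cosine and sine. *)
Lemma Cexp_est2 (z : C) : (Cmod (Cexp z - 1 - z) <= 3 * Cmod z ^ 2 * exp (Cmod z))%R.
Proof.
assert (Hz := Cmod2_alt z).
assert (Hre := re_le_Cmod z); apply exp_le in Hre.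
eapply Rle_trans; [apply Cmod_le_sum |].
replace (3 * Cmod z ^ 2 * exp (Cmod z))%R with (Cmod z ^ 2 * (3 * exp (Cmod z)))%R by ring.
rewrite Hz; clear Hz; unfold Cexp; simpl.
set (x := Re z) in *; set (y := Im z) in *.
set (E := exp (Cmod z)) in *; set (e := exp (Rabs x)) in *.
destruct (exp_est x) as [A1 A2]; fold e in A1, A2.
destruct (one_minus_cos_bounds y) as [[B1 B2] _]; assert (B3 := sin_minus_id y).
assert (B4 := Rsin_abs_le y).
assert (He : (1 + Rabs x <= e)%R) by apply exp_ge_1p.
assert (Hx := Rabs_pos x); assert (Hy := Rabs_pos y).
assert (Hx2 : (x ^ 2 = Rabs x * Rabs x)%R) by (rewrite <- Rabs_mult, Rabs_pos_eq; nra).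
assert (Hy2 : (y ^ 2 = Rabs y * Rabs y)%R) by (rewrite <- Rabs_mult, Rabs_pos_eq; nra).
fold (Re z) (Im z); fold x y.
assert (R1 : (Rabs (exp x * cos y + - (1) + - x) <= e * (x ^ 2 + y ^ 2 / 2))%R).
{ replace (exp x * cos y + - (1) + - x)%R
    with ((exp x - 1 - x) * cos y + - ((1 + x) * (1 - cos y)))%R by ring.
  eapply Rle_trans; [apply Rabs_triang |]; rewrite Rabs_Ropp, !Rabs_mult.
  rewrite (Rabs_pos_eq (1 - cos y)) by exact B1.
  assert (C1 : (Rabs (cos y) <= 1)%R) by (apply Rabs_le; assert (H := COS_bound y); lra).
  assert (C2 : (Rabs (1 + x) <= e)%R)
    by (eapply Rle_trans; [apply Rabs_triang |]; rewrite Rabs_R1; lra).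
  assert (C3 := Rabs_pos (exp x - 1 - x)); assert (C4 := Rabs_pos (cos y)).
  assert (C5 := Rabs_pos (1 + x)).
  assert (Rabs (exp x - 1 - x) * Rabs (cos y) <= x ^ 2 * e * 1)%R
    by (apply Rmult_le_compat; lra).
  assert (Rabs (1 + x) * (1 - cos y) <= e * (y ^ 2 / 2))%R by (apply Rmult_le_compat; lra).
  lra. }
assert (R2 : (Rabs (exp x * sin y + - 0 + - y) <= e * (x ^ 2 / 2 + 3 * y ^ 2 / 2))%R).
{ replace (exp x * sin y + - 0 + - y)%R with ((exp x - 1) * sin y + (sin y - y))%R by ring.
  eapply Rle_trans; [apply Rabs_triang |]; rewrite Rabs_mult.
  assert (C3 := Rabs_pos (exp x - 1)); assert (C4 := Rabs_pos (sin y)).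
  assert (Rabs (exp x - 1) * Rabs (sin y) <= Rabs x * e * Rabs y)%R
    by (apply Rmult_le_compat; lra).
  assert (Rabs x * e * Rabs y <= e * (x ^ 2 / 2 + y ^ 2 / 2))%R.
  { rewrite Hx2, Hy2.
    assert (H9 := Rmult_le_pos e _ ltac:(lra) (Rle_0_sqr (Rabs x - Rabs y))).
    unfold Rsqr in H9; lra. }
  assert (1 * y ^ 2 <= e * y ^ 2)%R by (apply Rmult_le_compat_r; nra).
  lra. }
simpl in *.
assert (e * (x * (x * 1) + y * (y * 1)) <= E * (x * (x * 1) + y * (y * 1)))%R
  by (apply Rmult_le_compat_r; nra).
nra.
Qed.

Lemma Cexp_est1 (z : C) : (Cmod z <= 1)%R -> (Cmod (Cexp z - 1) <= 10 * Cmod z)%R.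
Proof.
intros Hz; assert (H := Cexp_est2 z); assert (H0 := Cmod_ge_0 z).
assert (H1 := exp_le_3); apply exp_le in Hz as Hz'.
assert (H2 := Cmod_sub_triangle (Cexp z - 1) z 0).
replace (Cexp z - 1 - 0) with (Cexp z - 1) in H2 by ring.
replace (z - 0) with z in H2 by ring.
assert (3 * Cmod z ^ 2 * exp (Cmod z) <= 3 * Cmod z ^ 2 * 3)%R
  by (apply Rmult_le_compat_l; nra).
nra.
Qed.

Lemma Cexp_continuous (p : C) : continuous_atC Cexp p.
Proof.
intros eps Heps; assert (Hp : (0 < Cmod (Cexp p))%R) by (apply Cmod_gt_0, Cexp_neq_0).
exists (Rmin 1 (eps / (10 * Cmod (Cexp p)))); split.
{ apply Rmin_glb_lt; [lra | apply Rdiv_lt_0_compat; lra]. }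
intros x Hx; assert (H1 := Rmin_l 1 (eps / (10 * Cmod (Cexp p)))).
assert (H2 := Rmin_r 1 (eps / (10 * Cmod (Cexp p)))).
replace (Cexp x - Cexp p) with (Cexp p * (Cexp (x - p) - 1))
  by (rewrite Cexp_minus; field; apply Cexp_neq_0).
rewrite Cmod_mult.
apply Rle_lt_trans with (Cmod (Cexp p) * (10 * Cmod (x - p)))%R.
- apply Rmult_le_compat_l; [lra | apply Cexp_est1; lra].
- apply Rlt_le_trans with (Cmod (Cexp p) * (10 * (eps / (10 * Cmod (Cexp p)))))%R.
  + apply Rmult_lt_compat_l; lra.
  + right; field; lra.
Qed.

Lemma tends_Cexp {T : Type} (F : (T -> Prop) -> Prop) {FF : Filter F} (f : T -> C) (p : C) :
  tends F f p -> tends F (fun x => Cexp (f x)) (Cexp p).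
Proof. apply tends_comp; [exact FF | apply Cexp_continuous]. Qed.

Create HintDb limits.

(** Descends through the operations of an expression, and leaves the limits that no hypothesis or
    hint provides, together with the nonvanishing of denominators. *)
Ltac lim :=
  lazymatch goal with
  | |- Filter _ => typeclasses eauto
  | |- ProperFilter _ => typeclasses eauto
  | |- tends _ _ _ =>
    first
    [ match goal with H : ?G |- ?G => exact H end
    | solve [eauto with limits]
    | lazymatch goal with
      | |- tends _ (fun _ => ?c) _ => apply tends_const; typeclasses eauto
      | |- tends _ (fun t => @?f t + @?g t) _ => apply tends_plus; lim
      | |- tends _ (fun t => @?f t - @?g t) _ => apply tends_minus; lim
      | |- tends _ (fun t => @?f t * @?g t) _ => apply tends_mult; lim
      | |- tends _ (fun t => @?f t / ?c) _ => apply tends_mult; lim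
      | |- tends _ (fun t => @?f t / @?g t) _ => apply tends_div; lim
      | |- tends _ (fun t => @?f t ^ ?n) _ => apply tends_pow; lim
      | |- tends _ (fun t => - @?f t) _ => apply tends_opp; lim
      | |- tends _ (fun t => / @?f t) _ => apply tends_inv; lim
      | |- tends _ (fun t => Cexp (@?f t)) _ => apply tends_Cexp; lim
      end
    | idtac ]
  | |- _ => try assumption
  end.

Lemma has_prod_Cexp {T : Type} (A : T -> Prop) (f : T -> C) (p : C) :
  has_sum A f p -> has_prod A (fun x => Cexp (f x)) (Cexp p).
Proof. apply conv_morph; [apply Cexp_plus | apply Cexp_0 | apply Cexp_continuous]. Qed.

Lemma Csinh_double (y : C) : Csinh (2 * y) = 2 * Csinh y * Ccosh y.
Proof.
unfold Csinh, Ccosh; replace (2 * y) with (y + y) by ring.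
replace (- (y + y)) with (- y + - y) by ring; rewrite !Cexp_plus.
field; intros E; injection E; lra.
Qed.

Lemma Ccosh_components (z : C) :
  Ccosh z = ((exp (Re z) + exp (- Re z)) / 2 * cos (Im z),
             (exp (Re z) - exp (- Re z)) / 2 * sin (Im z))%R.
Proof.
assert (H2 : / RtoC 2 = RtoC (/ 2)) by (rewrite RtoC_inv; [reflexivity | lra]).
unfold Ccosh, Cdiv; rewrite H2; destruct z as [x y]; unfold Cexp, Cmult, Cminus, Cplus, Copp, RtoC, Re, Im.
cbn [fst snd]; rewrite cos_neg, sin_neg; apply injective_projections; cbn [fst snd]; field.
Qed.

Lemma Csinh_components (z : C) :
  Csinh z = ((exp (Re z) - exp (- Re z)) / 2 * cos (Im z),
             (exp (Re z) + exp (- Re z)) / 2 * sin (Im z))%R.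
Proof.
assert (H2 : / RtoC 2 = RtoC (/ 2)) by (rewrite RtoC_inv; [reflexivity | lra]).
unfold Csinh, Cdiv; rewrite H2; destruct z as [x y]; unfold Cexp, Cmult, Cminus, Cplus, Copp, RtoC, Re, Im.
cbn [fst snd]; rewrite cos_neg, sin_neg; apply injective_projections; cbn [fst snd]; field.
Qed.

Lemma Ccosh_est (z : C) : (Cmod (Ccosh z - 1) <= 3 * Cmod z ^ 2 * exp (Cmod z))%R.
Proof.
assert (H1 := Cexp_est2 z); assert (H2 := Cexp_est2 (- z)); rewrite Cmod_opp in H2.
replace (Ccosh z - 1) with ((/ 2) * ((Cexp z - 1 - z) + (Cexp (- z) - 1 - - z)))
  by (unfold Ccosh; field; intros E; injection E; lra).
rewrite Cmod_mult.
assert (H3 : (Cmod (/ 2) = / 2)%R).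
{ rewrite Cmod_inv by (intros E; injection E; lra); rewrite Cmod_R, Rabs_pos_eq; lra. }
rewrite H3; assert (H4 := Cmod_triangle (Cexp z - 1 - z) (Cexp (- z) - 1 - - z)); lra.
Qed.

(** * Integrals of hyperbolic cosines against powers of the cosine *)

Definition wallis (n : nat) : R := RInt (fun t => cos t ^ n)%R 0 (PI / 2).

(** [chc] and [shs] are the real and imaginary parts of [cosh ((r + i p) t)], and [shc] and
    [chs] those of [sinh ((r + i p) t)]. *)
Definition chc (r p t : R) : R := ((exp (r * t) + exp (- (r * t))) / 2 * cos (p * t))%R.
Definition shs (r p t : R) : R := ((exp (r * t) - exp (- (r * t))) / 2 * sin (p * t))%R.
Definition shc (r p t : R) : R := ((exp (r * t) - exp (- (r * t))) / 2 * cos (p * t))%R.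
Definition chs (r p t : R) : R := ((exp (r * t) + exp (- (r * t))) / 2 * sin (p * t))%R.

(** The integral of [cosh (lam t) cos t ^ n] over the interval from 0 to [pi / 2]. *)
Definition cosh_wallis (lam : C) (n : nat) : C :=
  (RInt (fun t => chc (Re lam) (Im lam) t * cos t ^ n)%R 0 (PI / 2),
   RInt (fun t => shs (Re lam) (Im lam) t * cos t ^ n)%R 0 (PI / 2)).

Lemma ex_RInt_derivable (f : R -> R) (a b : R) : (forall t, ex_derive f t) -> ex_RInt f a b.
Proof.
intros H; apply (ex_RInt_continuous (V := R_CompleteNormedModule)); intros t _.
now apply (ex_derive_continuous (K := R_AbsRing) (V := R_NormedModule)).
Qed.

Lemma ex_RInt_chc (r p a b : R) (n : nat) : ex_RInt (fun t => chc r p t * cos t ^ n)%R a b.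
Proof. apply ex_RInt_derivable; intros t; unfold chc; auto_derive; trivial. Qed.

Lemma ex_RInt_shs (r p a b : R) (n : nat) : ex_RInt (fun t => shs r p t * cos t ^ n)%R a b.
Proof. apply ex_RInt_derivable; intros t; unfold shs; auto_derive; trivial. Qed.

Lemma ex_RInt_cosn (a b : R) (n : nat) : ex_RInt (fun t => cos t ^ n)%R a b.
Proof. apply ex_RInt_derivable; intros t; auto_derive; trivial. Qed.

Lemma RInt_FTC (f F : R -> R) (a b : R) :
  (forall t, is_derive F t (f t)) -> (forall t, ex_derive f t) -> RInt f a b = (F b - F a)%R.
Proof.
intros HF Hf; apply is_RInt_unique, (is_RInt_derive (V := R_CompleteNormedModule) F f).
- intros t _; apply HF.
- intros t _; now apply (ex_derive_continuous (K := R_AbsRing) (V := R_NormedModule)).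
Qed.

(** Integrate the derivative of [v' cos^(n+2) + (n+2) v cos^(n+1) sin], which vanishes at both ends. *)
Lemma wallis_step (v v' w : R -> R) (al be : R) (n : nat) :
  (forall t, is_derive v t (v' t)) -> (forall t, is_derive v' t (al * v t + be * w t)%R) ->
  (forall t, ex_derive w t) -> v' 0%R = 0%R ->
  let I := fun (u : R -> R) k => RInt (fun t => u t * cos t ^ k)%R 0 (PI / 2) in
  (al * I v (n + 2)%nat + be * I w (n + 2)%nat + (INR n + 2) ^ 2 * I v (n + 2)%nat =
    (INR n + 2) * (INR n + 1) * I v n)%R.
Proof.
intros Hv Hv' Hw H0 I.
assert (Ev : forall t, ex_derive v t) by (intros t; eexists; apply Hv).
assert (EI : forall u k, (forall t, ex_derive u t) -> ex_RInt (fun t => u t * cos t ^ k)%R 0 (PI / 2)).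
{ intros u k Hu; apply ex_RInt_derivable; intros t; auto_derive; auto. }
assert (HF := RInt_FTC (fun t => (al * v t + be * w t) * cos t ^ (n + 2) +
    (INR n + 2) ^ 2 * v t * cos t ^ (n + 2) - (INR n + 2) * (INR n + 1) * v t * cos t ^ n)%R
  (fun t => v' t * cos t ^ (n + 2) + (INR n + 2) * v t * cos t ^ (n + 1) * sin t)%R 0 (PI / 2)).
assert (E : RInt (fun t => (al * v t + be * w t) * cos t ^ (n + 2) +
    (INR n + 2) ^ 2 * v t * cos t ^ (n + 2) - (INR n + 2) * (INR n + 1) * v t * cos t ^ n)%R 0 (PI / 2) =
  (al * I v (n + 2)%nat + be * I w (n + 2)%nat + (INR n + 2) ^ 2 * I v (n + 2)%nat -
    (INR n + 2) * (INR n + 1) * I v n)%R).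
{ apply is_RInt_unique.
  assert (K1 := RInt_correct _ _ _ (EI v (n + 2)%nat Ev)).
  assert (K2 := RInt_correct _ _ _ (EI w (n + 2)%nat Hw)).
  assert (K3 := RInt_correct _ _ _ (EI v n Ev)).
  assert (K := is_RInt_plus _ _ _ _ _ _
    (is_RInt_plus _ _ _ _ _ _ (is_RInt_scal _ _ _ (al + (INR n + 2) ^ 2)%R _ K1)
      (is_RInt_scal _ _ _ be _ K2))
    (is_RInt_scal _ _ _ (- ((INR n + 2) * (INR n + 1)))%R _ K3)).
  evar_last; [eapply is_RInt_ext; [| exact K] |].
  - intros t _; unfold plus, scal; simpl; unfold mult; simpl; ring.
  - unfold plus, scal, I; simpl; unfold mult; simpl; ring. }
rewrite E in HF; rewrite cos_PI2, sin_0, H0, !pow_i in HF by lia.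
apply Rminus_diag_uniq; rewrite HF; [ring | |].
- intros t; evar_last.
  + apply @is_derive_plus.
    * apply @is_derive_mult; [apply Hv' | auto_derive; [trivial | reflexivity] | intros; apply Rmult_comm].
    * apply (is_derive_ext (fun t => v t * ((INR n + 2) * cos t ^ (n + 1) * sin t))%R);
        [intros; simpl; ring |].
      apply @is_derive_mult; [apply Hv | auto_derive; [trivial | reflexivity] | intros; apply Rmult_comm].
  + unfold plus, scal, mult; simpl; unfold mult; simpl.
    replace (Init.Nat.pred (n + 2)) with (n + 1)%nat by lia.
    replace (Init.Nat.pred (n + 1)) with n by lia.
    rewrite !plus_INR, !pow_add; simpl.
    assert (S2 := sin2_cos2 t); unfold Rsqr in S2.
    replace (cos t * 1)%R with (cos t) by ring.
    assert (S3 : (sin t * sin t = 1 - cos t * cos t)%R) by lra.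
    ring_simplify. replace (sin t ^ 2)%R with (1 - cos t * cos t)%R by (rewrite <- S3; ring).
    ring.
- intros t; assert (Hvt := Ev t); assert (Hwt := Hw t); auto_derive; auto.
Qed.

Lemma cosh_wallis_step (lam : C) (n : nat) :
  (lam * lam + (INR n + 2) ^ 2) * cosh_wallis lam (n + 2) =
  (INR n + 2) * (INR n + 1) * cosh_wallis lam n.
Proof.
destruct lam as [r p]; unfold cosh_wallis, Re, Im; cbn [fst snd].
assert (H1 := wallis_step (chc r p) (fun t => r * shc r p t - p * chs r p t)%R (shs r p)
  (r ^ 2 - p ^ 2) (- (2 * r * p)) n).
assert (H2 := wallis_step (shs r p) (fun t => r * chs r p t + p * shc r p t)%R (chc r p)
  (r ^ 2 - p ^ 2) (2 * r * p) n).
cbv zeta in H1, H2; unfold chc at 1 in H1; unfold shs at 1 in H2.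
rewrite <- !RtoC_plus, <- RtoC_pow.
apply injective_projections; unfold Cmult, Cplus, RtoC; cbn [fst snd].
- etransitivity; [| etransitivity; [apply H1 |]]; try ring.
  + intros t; unfold chc, shc, chs; auto_derive; [trivial | field].
  + intros t; unfold chc, shc, chs, shs; auto_derive; [trivial | field].
  + intros t; unfold shs; auto_derive; trivial.
  + unfold shc, chs; rewrite !Rmult_0_r, sin_0, Ropp_0, exp_0; field.
- etransitivity; [| etransitivity; [apply H2 |]]; try ring.
  + intros t; unfold shs, shc, chs; auto_derive; [trivial | field].
  + intros t; unfold chc, shc, chs, shs; auto_derive; [trivial | field].
  + intros t; unfold chc; auto_derive; trivial.
  + unfold shc, chs; rewrite !Rmult_0_r, sin_0, Ropp_0, exp_0; field.
Qed.

Lemma wallis_rec (n : nat) : ((INR n + 2) * wallis (n + 2) = (INR n + 1) * wallis n)%R.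
Proof.
assert (H := wallis_step (fun _ => 1%R) (fun _ => 0%R) (fun _ => 0%R) 0 0 n).
cbv zeta in H.
assert (E : forall k, RInt (fun t => 1 * cos t ^ k)%R 0 (PI / 2) = wallis k)
  by (intros k; apply RInt_ext; intros; apply Rmult_1_l).
assert (H' : (0 * wallis (n + 2) + 0 * RInt (fun t => 0 * cos t ^ (n + 2)) 0 (PI / 2) +
  (INR n + 2) ^ 2 * wallis (n + 2) = (INR n + 2) * (INR n + 1) * wallis n)%R).
{ rewrite <- !E; apply H; [| | | reflexivity]; intros t; auto_derive; trivial; ring. }
assert (Hn := pos_INR n); apply Rmult_eq_reg_l with (INR n + 2)%R; lra.
Qed.

Lemma wallis_0 : wallis 0 = (PI / 2)%R.
Proof. unfold wallis; simpl; rewrite RInt_const; unfold scal; simpl; unfold mult; simpl; ring. Qed.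

Lemma wallis_even_pos (k : nat) : (0 < wallis (2 * k))%R.
Proof.
induction k as [| k IH]; [simpl; rewrite wallis_0; assert (H := PI_RGT_0); lra |].
assert (H := wallis_rec (2 * k)); replace (2 * S k)%nat with (2 * k + 2)%nat by lia.
assert (Hn := pos_INR (2 * k)); nra.
Qed.

(** Since [t cos t <= sin t], the integrand is at most [sin^2 cos^n = cos^n - cos^(n+2)], and the
    recurrence makes the difference of these integrals small: the measures [cos^n dt] concentrate
    at 0. *)
Lemma RInt_wallis_t2 (n : nat) :
  (RInt (fun t => t ^ 2 * cos t ^ (n + 2))%R 0 (PI / 2) * (INR n + 1) <= wallis (n + 2))%R.
Proof.
assert (HP := PI_RGT_0).
assert (H : (RInt (fun t => t ^ 2 * cos t ^ (n + 2))%R 0 (PI / 2) <= wallis n - wallis (n + 2))%R).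
{ unfold wallis.
  assert (E : (RInt (fun t => cos t ^ n) 0 (PI / 2) - RInt (fun t => cos t ^ (n + 2)) 0 (PI / 2) =
    RInt (fun t => cos t ^ n - cos t ^ (n + 2)) 0 (PI / 2))%R).
  { symmetry; apply is_RInt_unique; apply (is_RInt_minus (V := R_NormedModule));
      apply (RInt_correct (V := R_CompleteNormedModule)); apply ex_RInt_cosn. }
  rewrite E; apply RInt_le; [lra | | |].
  - apply ex_RInt_derivable; intros t; auto_derive; trivial.
  - apply ex_RInt_derivable; intros t; auto_derive; trivial.
  - intros t Ht; rewrite pow_add.
    assert (Hc : (0 <= cos t)%R) by (apply cos_ge_0; lra).
    assert (Hs : (0 <= sin t)%R) by (apply sin_ge_0; lra).
    assert (Htc : (t * cos t <= sin t)%R).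
    { destruct (MVT_gen (fun t => sin t - t * cos t)%R 0 t (fun t => t * sin t)%R) as [c [Hc1 Hc2]].
      - intros x _; auto_derive; [trivial | ring].
      - intros x _; apply derivable_continuous_pt; reg.
      - rewrite Rmin_left, Rmax_right in Hc1 by lra.
        rewrite sin_0 in Hc2; assert (0 <= sin c)%R by (apply sin_ge_0; lra).
        assert (0 <= c * sin c * (t - 0))%R by (repeat apply Rmult_le_pos; lra); lra. }
    assert (Hk : (0 <= cos t ^ n)%R) by (now apply pow_le).
    assert (S2 := sin2_cos2 t); unfold Rsqr in S2.
    assert (H1 : (t * cos t * (t * cos t) <= sin t * sin t)%R) by (apply Rmult_le_compat; nra).
    replace (t ^ 2 * (cos t ^ n * cos t ^ 2))%R with (cos t ^ n * (t * cos t * (t * cos t)))%R by ring.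
    replace (cos t ^ n - cos t ^ n * cos t ^ 2)%R with (cos t ^ n * (1 - cos t * cos t))%R by ring.
    apply Rmult_le_compat_l; lra. }
assert (H2 := wallis_rec n); assert (Hn := pos_INR n); nra.
Qed.

Lemma cosh_wallis_0 (lam : C) : lam * cosh_wallis lam 0 = Csinh (lam * (PI / 2)).
Proof.
destruct lam as [r p]; unfold cosh_wallis, Re, Im; cbn [fst snd].
set (I1 := RInt _ _ _); set (I2 := RInt (fun t => shs r p t * cos t ^ 0)%R _ _).
assert (HI1 := RInt_correct _ _ _ (ex_RInt_chc r p 0 (PI / 2) 0)); fold I1 in HI1.
assert (HI2 := RInt_correct _ _ _ (ex_RInt_shs r p 0 (PI / 2) 0)); fold I2 in HI2.
assert (E1 : (r * I1 - p * I2 = shc r p (PI / 2))%R).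
{ assert (H := RInt_FTC (fun t => r * chc r p t - p * shs r p t)%R (shc r p) 0 (PI / 2)).
  assert (H0 : shc r p 0 = 0%R) by (unfold shc; rewrite !Rmult_0_r, Ropp_0, exp_0; field).
  rewrite H0, Rminus_0_r in H; rewrite <- H.
  - symmetry; apply is_RInt_unique; evar_last.
    + eapply is_RInt_ext; [| apply (is_RInt_plus _ _ _ _ _ _ (is_RInt_scal _ _ _ r _ HI1)
        (is_RInt_scal _ _ _ (- p)%R _ HI2))].
      intros t _; unfold plus, scal; simpl; unfold mult; simpl; ring.
    + unfold plus, scal; simpl; unfold mult; simpl; ring.
  - intros t; unfold shc, chc, shs; auto_derive; [trivial | field].
  - intros t; unfold chc, shs; auto_derive; trivial. }
assert (E2 : (r * I2 + p * I1 = chs r p (PI / 2))%R).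
{ assert (H := RInt_FTC (fun t => r * shs r p t + p * chc r p t)%R (chs r p) 0 (PI / 2)).
  assert (H0 : chs r p 0 = 0%R) by (unfold chs; rewrite !Rmult_0_r, sin_0; field).
  rewrite H0, Rminus_0_r in H; rewrite <- H.
  - symmetry; apply is_RInt_unique; evar_last.
    + eapply is_RInt_ext; [| apply (is_RInt_plus _ _ _ _ _ _ (is_RInt_scal _ _ _ r _ HI2)
        (is_RInt_scal _ _ _ p _ HI1))].
      intros t _; unfold plus, scal; simpl; unfold mult; simpl; ring.
    + unfold plus, scal; simpl; unfold mult; simpl; ring.
  - intros t; unfold chs, chc, shs; auto_derive; [trivial | field].
  - intros t; unfold chc, shs; auto_derive; trivial. }
replace ((r, p) * (PI / 2)) with ((r * (PI / 2), p * (PI / 2))%R : C).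
2:{ replace (PI / 2) with (RtoC (PI / 2)) by (rewrite RtoC_div; [reflexivity | lra]).
    unfold Cmult, RtoC; apply injective_projections; cbn [fst snd]; ring. }
rewrite Csinh_components; unfold Cmult, Re, Im; cbn [fst snd].
rewrite E1, E2; reflexivity.
Qed.

(** The function [cosh (lam t)] differs from 1 by a multiple of [t^2]. *)
Lemma cosh_wallis_est (lam : C) : exists K, (0 <= K)%R /\ forall n,
  (Cmod (cosh_wallis lam (n + 2) - wallis (n + 2)) * (INR n + 1) <= K * wallis (n + 2))%R.
Proof.
assert (HP := PI_RGT_0).
set (K := (3 * Cmod lam ^ 2 * exp (Cmod lam * (PI / 2)))%R).
assert (HK : (0 <= K)%R).
{ unfold K; assert (H := exp_pos (Cmod lam * (PI / 2))); assert (H1 := pow2_ge_0 (Cmod lam)); nra. }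
assert (Hpt : forall t, (0 <= t <= PI / 2)%R ->
  (Rabs (chc (Re lam) (Im lam) t - 1) <= K * t ^ 2 /\ Rabs (shs (Re lam) (Im lam) t) <= K * t ^ 2)%R).
{ intros t Ht.
  assert (Hc : Ccosh (lam * t) = (chc (Re lam) (Im lam) t, shs (Re lam) (Im lam) t)).
  { rewrite Ccosh_components; destruct lam as [r p]; unfold chc, shs, Cmult, RtoC, Re, Im; cbn [fst snd].
    replace (r * t - p * 0)%R with (r * t)%R by ring.
    replace (r * 0 + p * t)%R with (p * t)%R by ring; reflexivity. }
  assert (H := Ccosh_est (lam * t)); rewrite Cmod_mult, Cmod_R, (Rabs_pos_eq t) in H by lra.
  assert (HK2 : (3 * (Cmod lam * t) ^ 2 * exp (Cmod lam * t) <= K * t ^ 2)%R).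
  { unfold K; replace (3 * Cmod lam ^ 2 * exp (Cmod lam * (PI / 2)) * t ^ 2)%R
      with (3 * (Cmod lam * t) ^ 2 * exp (Cmod lam * (PI / 2)))%R by ring.
    apply Rmult_le_compat_l; [assert (H1 := pow2_ge_0 (Cmod lam * t)); lra |].
    apply exp_le, Rmult_le_compat_l; [apply Cmod_ge_0 | lra]. }
  assert (H1 := re_le_Cmod (Ccosh (lam * t) - 1)); assert (H2 := im_le_Cmod (Ccosh (lam * t) - 1)).
  rewrite Hc in *; simpl in H1, H2; rewrite Ropp_0, Rplus_0_r in H2; split; [unfold Rminus |]; lra. }
exists (2 * K)%R; split; [lra |]; intros n.
set (J := RInt (fun t => t ^ 2 * cos t ^ (n + 2))%R 0 (PI / 2)).
assert (HJ := RInt_wallis_t2 n); fold J in HJ; assert (Hn := pos_INR n).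
assert (Hbd : forall u, (forall t, ex_derive u t) ->
  (forall t, (0 <= t <= PI / 2)%R -> Rabs (u t) <= K * t ^ 2)%R ->
  (Rabs (RInt (fun t => u t * cos t ^ (n + 2)) 0 (PI / 2)) <= K * J)%R).
{ intros u Hu Hb.
  assert (X1 : ex_RInt (fun t => u t * cos t ^ (n + 2))%R 0 (PI / 2)).
  { apply ex_RInt_derivable; intros t; assert (H := Hu t); auto_derive; auto. }
  assert (X2 : ex_RInt (fun t => t ^ 2 * cos t ^ (n + 2))%R 0 (PI / 2)).
  { apply ex_RInt_derivable; intros t; auto_derive; auto. }
  assert (X3 := RInt_correct _ _ _ X2); fold J in X3.
  assert (X4 := is_RInt_scal _ _ _ K _ X3).
  change (norm (RInt (fun t => u t * cos t ^ (n + 2))%R 0 (PI / 2)) <= K * J)%R.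
  apply (norm_RInt_le (V := R_NormedModule) (fun t => u t * cos t ^ (n + 2))%R
     (fun t => K * (t ^ 2 * cos t ^ (n + 2)))%R 0 (PI / 2)); [lra | | |].
  - intros t Ht; change (norm (u t * cos t ^ (n + 2))%R) with (Rabs (u t * cos t ^ (n + 2))).
    assert (Hc : (0 <= cos t ^ (n + 2))%R) by (apply pow_le, cos_ge_0; lra).
    rewrite Rabs_mult, (Rabs_pos_eq (cos t ^ (n + 2))) by exact Hc.
    rewrite <- Rmult_assoc; apply Rmult_le_compat_r; auto.
  - exact (RInt_correct _ _ _ X1).
  - exact X4. }
assert (B1 : (Rabs (Re (cosh_wallis lam (n + 2) - wallis (n + 2))) <= K * J)%R).
{ simpl.
  replace (RInt _ 0 (PI / 2) + - wallis (n + 2))%R with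
    (RInt (fun t => (chc (Re lam) (Im lam) t - 1) * cos t ^ (n + 2))%R 0 (PI / 2)).
  - apply Hbd; [intros t; unfold chc; auto_derive; trivial |]; intros t Ht; now apply Hpt.
  - apply is_RInt_unique; unfold wallis; eapply is_RInt_ext;
      [| apply @is_RInt_minus; apply (RInt_correct (V := R_CompleteNormedModule));
         [apply ex_RInt_chc | apply ex_RInt_cosn]].
    intros t _; unfold minus, plus, opp; simpl; ring. }
assert (B2 : (Rabs (Im (cosh_wallis lam (n + 2) - wallis (n + 2))) <= K * J)%R).
{ simpl; rewrite Ropp_0, Rplus_0_r.
  apply Hbd; [intros t; unfold shs; auto_derive; trivial |]; intros t Ht; now apply Hpt. }
assert (B := Cmod_le_sum (cosh_wallis lam (n + 2) - wallis (n + 2))).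
assert ((Rabs (Re (cosh_wallis lam (n + 2) - wallis (n + 2))) +
  Rabs (Im (cosh_wallis lam (n + 2) - wallis (n + 2)))) * (INR n + 1) <=
  (2 * K * J) * (INR n + 1))%R by (apply Rmult_le_compat_r; lra).
assert (K * (J * (INR n + 1)) <= K * wallis (n + 2))%R by (apply Rmult_le_compat_l; lra).
assert (Cmod (cosh_wallis lam (n + 2) - wallis (n + 2)) * (INR n + 1) <=
  (Rabs (Re (cosh_wallis lam (n + 2) - wallis (n + 2))) +
  Rabs (Im (cosh_wallis lam (n + 2) - wallis (n + 2)))) * (INR n + 1))%R
  by (apply Rmult_le_compat_r; lra).
lra.
Qed.

(** * Sums of powers *)

Lemma Rpower_gt_0 (x y : R) : (0 < Rpower x y)%R.
Proof. apply exp_pos. Qed.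

Lemma Rpower_neg_le (a b c : R) : (0 < a <= b)%R -> (0 <= c)%R -> (Rpower b (- c) <= Rpower a (- c))%R.
Proof.
intros Hab Hc; rewrite !Rpower_Ropp; apply Rinv_le_contravar; [apply Rpower_gt_0 |].
apply Rle_Rpower_l; assumption.
Qed.

Lemma Rpower_neg_pow (x : R) (n : nat) : (0 < x)%R -> Rpower x (- INR n) = (/ x ^ n)%R.
Proof. intros Hx; rewrite Rpower_Ropp, Rpower_pow; auto. Qed.

(** By the mean value theorem, [s c^(-1-s)] is the decrease of [x^(-s)] for some [c] between [x]
    and [x + 1]. *)
Lemma zeta_diff (s x : R) : (0 < s)%R -> (0 < x)%R ->
  (s * Rpower (x + 1) (- (1 + s)) <= Rpower x (- s) - Rpower (x + 1) (- s) <= s * Rpower x (- (1 + s)))%R.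
Proof.
intros Hs Hx.
destruct (MVT_gen (fun t => Rpower t (- s)) x (x + 1) (fun t => - s * Rpower t (- (1 + s)))%R)
  as [c [Hc E]].
- intros t Ht; rewrite Rmin_left in Ht by lra.
  apply is_derive_Reals; replace (- (1 + s))%R with (- s - 1)%R by ring.
  apply derivable_pt_lim_power; lra.
- intros t Ht; rewrite Rmin_left in Ht by lra.
  apply derivable_continuous_pt; exists (- s * Rpower t (- s - 1))%R.
  apply derivable_pt_lim_power; lra.
- rewrite Rmin_left, Rmax_right in Hc by lra.
  assert (H1 : (Rpower (x + 1) (- (1 + s)) <= Rpower c (- (1 + s)))%R) by (apply Rpower_neg_le; lra).
  assert (H2 : (Rpower c (- (1 + s)) <= Rpower x (- (1 + s)))%R) by (apply Rpower_neg_le; lra).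
  replace (x + 1 - x)%R with 1%R in E by ring; nra.
Qed.

Lemma rsum_seq_S (b : nat -> R) (n : nat) : rsum b (seq 0 (S n)) = (rsum b (seq 0 n) + b n)%R.
Proof. rewrite seq_S, rsum_app; simpl; lra. Qed.

Lemma power_sum_le (s y : R) (n : nat) : (0 < s)%R -> (0 < y)%R ->
  (rsum (fun k => Rpower (y + INR k) (- (1 + s))) (seq 0 n) <= Rpower y (- (1 + s)) + Rpower y (- s) / s)%R.
Proof.
intros Hs Hy.
assert (H : forall m, (rsum (fun k => Rpower (y + INR k) (- (1 + s))) (seq 0 (S m)) <=
  Rpower y (- (1 + s)) + (Rpower y (- s) - Rpower (y + INR m) (- s)) / s)%R).
{ induction m as [| m IH].
  - simpl; rewrite !Rplus_0_r; unfold Rdiv; lra.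
  - rewrite rsum_seq_S, S_INR.
    assert (Hm := pos_INR m).
    destruct (zeta_diff s (y + INR m)) as [H1 _]; [lra | lra |].
    replace (y + (INR m + 1))%R with (y + INR m + 1)%R by ring.
    set (u := Rpower (y + INR m) (- s)) in *; set (v := Rpower (y + INR m + 1) (- s)) in *.
    assert (H2 : (Rpower (y + INR m + 1) (- (1 + s)) <= (u - v) / s)%R).
    { apply Rle_div_r; lra. }
    replace ((Rpower y (- s) - v) / s)%R with ((Rpower y (- s) - u) / s + (u - v) / s)%R by (field; lra).
    lra. }
destruct n as [| n].
- simpl; assert (H1 := Rpower_gt_0 y (- (1 + s))).
  assert (0 < Rpower y (- s) / s)%R by (apply Rdiv_lt_0_compat; [apply Rpower_gt_0 | lra]); lra.
- eapply Rle_trans; [apply H |]; apply Rplus_le_compat_l.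
  unfold Rdiv; apply Rmult_le_compat_r; [left; now apply Rinv_0_lt_compat |].
  assert (H1 := Rpower_gt_0 (y + INR n) (- s)); lra.
Qed.

Lemma Rpower_1_l (y : R) : Rpower 1 y = 1%R.
Proof. unfold Rpower; rewrite ln_1, Rmult_0_r; apply exp_0. Qed.

Lemma summable_nat_power (p : R) : (1 < p)%R -> summable (fun _ : nat => True) (fun k => Rpower (1 + INR k) (- p)).
Proof.
intros Hp; apply (summable_nat _ (1 + 1 / (p - 1))).
- intros n; left; apply Rpower_gt_0.
- intros n; assert (H := power_sum_le (p - 1) 1 n ltac:(lra) ltac:(lra)).
  rewrite !Rpower_1_l in H; replace (1 + (p - 1))%R with p in H by ring; exact H.
Qed.

Definition pos (n : nat) : Prop := (1 <= n)%nat.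

Lemma summable_pos_power (p : R) : (1 < p)%R -> summable pos (fun k => Rpower (INR k) (- p)).
Proof.
intros Hp; apply (summable_le _ (fun k => Rpower (1 + INR (Nat.pred k)) (- p))).
- intros k Hk; split; [left; apply Rpower_gt_0 |].
  destruct k as [| k]; [unfold pos in Hk; lia |]; rewrite S_INR; simpl; right; f_equal; ring.
- apply (summable_inj pos (fun _ => True) Nat.pred (fun k => Rpower (1 + INR k) (- p))); [trivial | | now apply summable_nat_power].
  unfold pos; intros; lia.
Qed.

Lemma pos_INR1 (k : nat) : pos k -> (1 <= INR k)%R.
Proof. intros H; apply le_INR in H; exact H. Qed.

Lemma summable_pos_pow (n : nat) : (2 <= n)%nat -> summable pos (fun k => / INR k ^ n)%R.
Proof.
intros Hn; apply (summable_le _ (fun k => Rpower (INR k) (- INR n))).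
- intros k Hk; apply pos_INR1 in Hk; rewrite <- Rpower_neg_pow by lra.
  split; [left; apply Rpower_gt_0 | apply Rle_refl].
- apply summable_pos_power; apply le_INR in Hn; simpl in Hn; lra.
Qed.

Lemma zindex_le (n : Z) : (INR (zindex n) <= Rabs (IZR n))%R.
Proof.
unfold zindex; destruct (Z_lt_dec n 0) as [H | H]; rewrite INR_IZR_INZ, Z2Nat.id by lia; rewrite <- abs_IZR;
  apply IZR_le; lia.
Qed.

Lemma summable_Z_power (p : R) : (1 < p)%R ->
  summable (fun _ : Z => True) (fun n => Rpower (1 + Rabs (IZR n)) (- p)).
Proof.
intros Hp; apply (summable_le _ (fun n => Rpower (1 + INR (zindex n)) (- p))).
- intros n _; split; [left; apply Rpower_gt_0 |].
  apply Rpower_neg_le; [| lra]; assert (H := zindex_le n); assert (H0 := pos_INR (zindex n)); lra.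
- split; [intros n _; left; apply Rpower_gt_0 |].
  exists (2 * (1 + 1 / (p - 1)))%R; intros l Hl _.
  apply (zindex_bound (fun k => Rpower (1 + INR k) (- p))); trivial.
  + intros n; left; apply Rpower_gt_0.
  + intros n; assert (H := power_sum_le (p - 1) 1 n ltac:(lra) ltac:(lra)).
    rewrite !Rpower_1_l in H; replace (1 + (p - 1))%R with p in H by ring; exact H.
Qed.

(** * The sine product *)

Lemma RtoC_neq_0 (x : R) : x <> 0%R -> RtoC x <> 0.
Proof. intros H E; apply H; injection E; trivial. Qed.

Lemma big_seq_S {op e} `{CMonoid op e} (f : nat -> C) (m n : nat) :
  big op e f (seq m (S n)) = op (big op e f (seq m n)) (f (m + n)%nat).
Proof. rewrite seq_S, big_app; simpl; now rewrite (cm_unit_r (op := op) (e := e)). Qed.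

(** The recurrence for [cosh_wallis] gives the partial products exactly: what is missing from
    [sinh (pi i a) / (pi i a)] is a quotient of integrals that tends to 1. *)
Lemma sine_partial_product (a : C) (n : nat) :
  let lam := 2 * Ci * a in
  PI * Ci * a * (big Cmult 1 (fun k => 1 - a ^ 2 / INR k ^ 2) (seq 1 n) *
    (cosh_wallis lam (2 * n) / wallis (2 * n))) = Csinh (PI * Ci * a).
Proof.
intros lam; induction n as [| n IH].
- simpl seq; simpl big; rewrite Nat.mul_0_r, wallis_0.
  replace (PI * Ci * a) with (lam * (PI / 2)) at 2
    by (unfold lam; field; apply RtoC_neq_0; lra).
  rewrite <- cosh_wallis_0, RtoC_div by lra; unfold lam; field.
  assert (H := PI_RGT_0); repeat split; apply RtoC_neq_0; lra.
- rewrite <- IH; f_equal; rewrite big_seq_S, <- Cmult_assoc; f_equal.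
  assert (H1 := cosh_wallis_step lam (2 * n)); assert (H2 := wallis_rec (2 * n)).
  replace (2 * S n)%nat with (2 * n + 2)%nat by lia.
  assert (W1 := wallis_even_pos n); assert (W2 := wallis_even_pos (S n)).
  replace (2 * S n)%nat with (2 * n + 2)%nat in W2 by lia.
  assert (Hn := pos_INR (2 * n)).
  assert (E : RtoC (INR (1 + n)) = (INR (2 * n) + 2) / 2).
  { rewrite <- RtoC_plus, <- RtoC_div by lra; f_equal; rewrite !mult_INR, plus_INR; simpl; field. }
  assert (N2 : RtoC (INR (2 * n)) + 2 <> 0) by (rewrite <- RtoC_plus; apply RtoC_neq_0; lra).
  assert (N1 : RtoC (INR (2 * n)) + 1 <> 0) by (rewrite <- RtoC_plus; apply RtoC_neq_0; lra).
  assert (M1 : RtoC (wallis (2 * n)) <> 0) by (apply RtoC_neq_0; lra).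
  assert (M2 : RtoC (wallis (2 * n + 2)) <> 0) by (apply RtoC_neq_0; lra).
  assert (T0 : RtoC 2 <> 0) by (apply RtoC_neq_0; lra).
  apply (f_equal RtoC) in H2; rewrite !RtoC_mult, !RtoC_plus in H2.
  rewrite E.
  set (x := RtoC (INR (2 * n))) in *; set (A := cosh_wallis lam (2 * n)) in *.
  set (A2 := cosh_wallis lam (2 * n + 2)) in *.
  set (W := RtoC (wallis (2 * n))) in *; set (V := RtoC (wallis (2 * n + 2))) in *.
  assert (HA : A = (lam * lam + (x + 2) ^ 2) * A2 / ((x + 2) * (x + 1))) by (rewrite H1; field; auto).
  assert (HW : W = (x + 2) * V / (x + 1)) by (rewrite H2; field; auto).
  rewrite HA, HW; unfold lam.
  assert (C2 : Ci * Ci = - (1)) by (apply injective_projections; simpl; ring).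
  replace (2 * Ci * a * (2 * Ci * a)) with (4 * (Ci * Ci) * (a * a)) by ring.
  rewrite C2; field; auto.
Qed.

Lemma Cpow2_neq_0 (x : C) : x <> 0 -> x ^ 2 <> 0.
Proof. intros H; now apply Cpow_nz. Qed.

Lemma Cmod_INR (k : nat) : Cmod (INR k) = INR k.
Proof. rewrite Cmod_R; apply Rabs_pos_eq, pos_INR. Qed.

Lemma INR_C_neq_0 (k : nat) : pos k -> RtoC (INR k) <> 0.
Proof. intros H; apply pos_INR1 in H; apply RtoC_neq_0; lra. Qed.

Lemma sine_factor_bound (a : C) (k : nat) : pos k ->
  (Cmod (1 - a ^ 2 / INR k ^ 2 - 1) <= Cmod a ^ 2 * / INR k ^ 2)%R.
Proof.
intros Hk; replace (1 - a ^ 2 / INR k ^ 2 - 1) with (- (a ^ 2 / INR k ^ 2)) by ring.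
rewrite Cmod_opp, Cmod_div, !Cmod_pow, Cmod_INR by (now apply Cpow2_neq_0, INR_C_neq_0).
apply Rle_refl.
Qed.

Lemma tends_seq_of_conv {op e} `{CMonoid op e} (f : nat -> C) (p : C) :
  conv op e pos f p -> tends eventually (fun n => big op e f (seq 1 n)) p.
Proof.
apply conv_exhaust; [lim | intros; apply seq_NoDup | |].
- intros n x Hx; apply in_seq in Hx; unfold pos; lia.
- intros x Hx; exists x; intros n Hn; apply in_seq; unfold pos in Hx; lia.
Qed.

Lemma eventually_INR (M : R) : eventually (fun n => M < INR n)%R.
Proof.
exists (Z.to_nat (up M)); intros n Hn; destruct (archimed M) as [H _].
apply Rlt_le_trans with (1 := H).
destruct (Z_le_dec (up M) 0) as [Hz | Hz].
- apply IZR_le in Hz; assert (H0 := pos_INR n); lra.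
- rewrite INR_IZR_INZ; apply IZR_le; lia.
Qed.

Theorem sine_product (a : C) : exists p,
  has_prod pos (fun k => 1 - a ^ 2 / INR k ^ 2) p /\ PI * Ci * a * p = Csinh (PI * Ci * a).
Proof.
destruct (conv_exists (op := Cmult) pos (fun k => 1 - a ^ 2 / INR k ^ 2) (fun k => Cmod a ^ 2 * / INR k ^ 2)%R)
  as [p Hp].
- apply summable_scal; [apply pow2_ge_0 | now apply summable_pos_pow].
- apply sine_factor_bound.
- exists p; split; [exact Hp |].
  apply tends_seq_of_conv in Hp.
  (* the missing factor of [sine_partial_product] tends to 1 at rate [1 / n] *)
  assert (HQ : tends eventually (fun n => cosh_wallis (2 * Ci * a) (2 * n) / wallis (2 * n)) 1).
  { intros eps Heps; destruct (cosh_wallis_est (2 * Ci * a)) as [K [HK H]].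
    generalize (filter_and _ _ (eventually_INR 1) (eventually_INR (K / eps))).
    apply filter_imp; intros n [Hn1 Hn2].
    destruct n as [| n]; [simpl in Hn1; lra |].
    assert (W := wallis_even_pos (S n)); specialize (H (2 * n)%nat).
    replace (2 * n + 2)%nat with (2 * S n)%nat in H by lia.
    set (w := wallis (2 * S n)) in *; set (A := cosh_wallis _ _) in *.
    assert (Hw : RtoC w <> 0) by (apply RtoC_neq_0; lra).
    replace (A / w - 1) with ((A - w) / w) by (field; auto).
    rewrite Cmod_div, Cmod_R, (Rabs_pos_eq w) by (auto; lra).
    apply Rlt_div_l; [lra |].
    assert (Hn0 := pos_INR n).
    assert (K < eps * INR (S n))%R.
    { apply (Rmult_lt_compat_r eps) in Hn2; [| lra].
      unfold Rdiv in Hn2; rewrite Rmult_assoc, Rinv_l in Hn2 by lra; lra. }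
    rewrite S_INR in *; rewrite mult_INR in H; simpl INR in H.
    assert (H9 := Cmod_ge_0 (A - w)).
    assert (Cmod (A - w) * (INR n + 1) <= K * w)%R by nra.
    assert (K * w < eps * (INR n + 1) * w)%R by (apply Rmult_lt_compat_r; lra).
    apply Rmult_lt_reg_r with (INR n + 1)%R; lra. }
  assert (HL := tends_mult _ _ _ _ _ (tends_const eventually (PI * Ci * a)) (tends_mult _ _ _ _ _ Hp HQ)).
  rewrite Cmult_1_r in HL.
  apply (tends_unique eventually (fun _ => Csinh (PI * Ci * a))); [| lim].
  revert HL; apply tends_ext; [lim |]; intros n; apply sine_partial_product.
Qed.

(** * The Jacobi triple product *)

Lemma expi_plus (a b : R) (z : C) : expi (a + b) z = expi a z * expi b z.
Proof. unfold expi; rewrite <- Cexp_plus; f_equal; rewrite RtoC_plus; ring. Qed.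

Lemma expi_opp (a : R) (z : C) : expi (- a) z = / expi a z.
Proof. unfold expi; rewrite <- Cexp_opp; f_equal; rewrite RtoC_opp; ring. Qed.

Lemma expi_0 (z : C) : expi 0 z = 1.
Proof. unfold expi; rewrite <- Cexp_0; f_equal; ring. Qed.

Lemma expi_neq_0 (a : R) (z : C) : expi a z <> 0.
Proof. apply Cexp_neq_0. Qed.

Lemma expi_INR (k : nat) (z : C) : expi (INR k) z = expi 1 z ^ k.
Proof. unfold expi; rewrite <- Cexp_INR; f_equal; ring. Qed.

Lemma Cmod_expi (a : R) (z : C) : Cmod (expi a z) = exp (- (2 * PI * a * Im z)).
Proof. unfold expi; rewrite Cmod_Cexp; f_equal; destruct z as [x y]; simpl; ring. Qed.

Lemma Cexp_PI_Ci : Cexp (PI * Ci) = - (1).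
Proof.
unfold Cexp, Cmult, RtoC, Ci, Re, Im; cbn [fst snd].
replace (PI * 0 - 0 * 1)%R with 0%R by ring; replace (PI * 1 + 0 * 0)%R with PI by ring.
rewrite exp_0, cos_PI, sin_PI; apply injective_projections; simpl; ring.
Qed.

Lemma Cmod_q_lt_1 (tau : C) : (0 < Im tau)%R -> (0 < Cmod (expi 1 tau) < 1)%R.
Proof.
intros H; rewrite Cmod_expi; split; [apply exp_pos |].
assert (HP := PI_RGT_0); apply Rlt_le_trans with (exp 0); [apply exp_increasing | rewrite exp_0; lra].
assert (0 < 2 * PI * 1 * Im tau)%R by (apply Rmult_lt_0_compat; lra); lra.
Qed.

Lemma summable_geometric (r : R) : (0 <= r < 1)%R -> summable (fun _ : nat => True) (fun k => r ^ k)%R.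
Proof.
intros Hr; apply (summable_nat _ (/ (1 - r))); [intros n; now apply pow_le |].
intros n; assert (H : (rsum (fun k => r ^ k) (seq 0 n) * (1 - r) = 1 - r ^ n)%R).
{ induction n as [| n IH]; [simpl; ring |].
  rewrite rsum_seq_S, Rmult_plus_distr_r, IH; simpl; ring. }
apply Rmult_le_reg_r with (1 - r)%R; [lra |]; rewrite H, Rinv_l by lra.
assert (0 <= r ^ n)%R by (now apply pow_le); lra.
Qed.

(** The product [(w q; q)] over the positive powers of [q]. *)
Definition qpoch (tau w : C) : C := Cprod_over pos (fun n => 1 - w * expi (INR n) tau).

Lemma summable_q (tau w : C) : (0 < Im tau)%R -> summable pos (fun n => Cmod w * Cmod (expi 1 tau) ^ n)%R.
Proof.
intros Ht; apply summable_scal; [apply Cmod_ge_0 |].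
apply (summable_sub (fun _ => True)); [trivial |]; apply summable_geometric.
assert (H := Cmod_q_lt_1 tau Ht); lra.
Qed.

Lemma qpoch_factor_est (tau w : C) (n : nat) :
  (Cmod (1 - w * expi (INR n) tau - 1) <= Cmod w * Cmod (expi 1 tau) ^ n)%R.
Proof.
replace (1 - w * expi (INR n) tau - 1) with (- (w * expi (INR n) tau)) by ring.
rewrite Cmod_opp, Cmod_mult, expi_INR, Cmod_pow; apply Rle_refl.
Qed.

Lemma qpoch_prod (tau w : C) : (0 < Im tau)%R ->
  has_prod pos (fun n => 1 - w * expi (INR n) tau) (qpoch tau w).
Proof.
intros Ht; destruct (conv_exists (op := Cmult) pos (fun n => 1 - w * expi (INR n) tau) _
  (summable_q tau w Ht)) as [p Hp]; [intros; apply qpoch_factor_est |].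
unfold qpoch; rewrite (Cprod_over_unique _ _ p); [exact Hp |].
apply tends_filterlim; [lim | exact Hp].
Qed.

Lemma qpoch_neq_0 (tau w : C) : (0 < Im tau)%R ->
  (forall n, pos n -> 1 - w * expi (INR n) tau <> 0) -> qpoch tau w <> 0.
Proof.
intros Ht Hn; apply (has_prod_neq_0 pos (fun n => 1 - w * expi (INR n) tau) _ _ (summable_q tau w Ht)).
- intros; apply qpoch_factor_est.
- exact Hn.
- now apply qpoch_prod.
Qed.

Lemma one_minus_q_neq_0 (tau : C) (n : nat) : (0 < Im tau)%R -> pos n -> 1 - expi (INR n) tau <> 0.
Proof.
intros Ht Hn E; assert (H : expi (INR n) tau = 1).
{ replace (expi (INR n) tau) with (1 - (1 - expi (INR n) tau)) by ring; rewrite E; ring. }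
apply (f_equal Cmod) in H; rewrite expi_INR, Cmod_pow, Cmod_1 in H.
assert (H1 := Cmod_q_lt_1 tau Ht); assert (H2 := pow_lt_1_compat (Cmod (expi 1 tau)) n).
unfold pos in Hn; destruct H2; [lra | lia | lra].
Qed.

(** The finite product [(q; q)_k]. *)
Definition qfac (tau : C) (k : nat) : C := big Cmult 1 (fun j => 1 - expi (INR j) tau) (seq 1 k).
(** The reciprocal of [(q; q)_k], extended by 0: with this extension the recurrences of the
    Gaussian binomials hold for all integers, and finite sums become sums over [Z]. *)
Definition iqfac (tau : C) (k : Z) : C := if Z_lt_dec k 0 then RtoC 0 else / qfac tau (Z.to_nat k).

Lemma qfac_neq_0 (tau : C) (k : nat) : (0 < Im tau)%R -> qfac tau k <> 0.
Proof.
intros Ht; apply big_mult_neq_0; intros x Hx; apply in_seq in Hx.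
apply one_minus_q_neq_0; [exact Ht | unfold pos; lia].
Qed.

Lemma qfac_S (tau : C) (k : nat) : qfac tau (S k) = qfac tau k * (1 - expi (INR (S k)) tau).
Proof. unfold qfac; rewrite big_seq_S; reflexivity. Qed.

Lemma iqfac_rec (tau : C) (k : Z) : (0 < Im tau)%R ->
  iqfac tau (k - 1) = iqfac tau k * (1 - expi (IZR k) tau).
Proof.
intros Ht; unfold iqfac; destruct (Z_lt_dec (k - 1) 0), (Z_lt_dec k 0); try lia.
- ring.
- replace k with 0%Z by lia; rewrite expi_0; ring.
- replace (Z.to_nat k) with (S (Z.to_nat (k - 1))) by lia.
  rewrite qfac_S; replace (S (Z.to_nat (k - 1))) with (Z.to_nat k) by lia.
  rewrite INR_IZR_INZ, Z2Nat.id by lia.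
  assert (H1 := qfac_neq_0 tau (Z.to_nat (k - 1)) Ht).
  assert (H2 := one_minus_q_neq_0 tau (Z.to_nat k) Ht).
  rewrite INR_IZR_INZ, Z2Nat.id in H2 by lia; assert (H3 : 1 - expi (IZR k) tau <> 0) by (apply H2; unfold pos; lia).
  field; auto.
Qed.

(** The Gaussian binomial coefficient [2N choose N+n]. *)
Definition qbin (tau : C) (N : nat) (n : Z) : C :=
  qfac tau (2 * N) * (iqfac tau (Z.of_nat N + n) * iqfac tau (Z.of_nat N - n)).

(** The term [(-1)^n u^n q^(n(n+1)/2)]. *)
Definition theta_term (tau z : C) (n : Z) : C :=
  Cexp (PI * Ci * IZR n * (1 + 2 * z + (IZR n + 1) * tau)).

Lemma theta_term_succ (tau z : C) (n : Z) :
  theta_term tau z (n + 1) = - expi 1 z * expi (IZR n + 1) tau * theta_term tau z n.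
Proof.
replace (- expi 1 z) with (Cexp (PI * Ci) * expi 1 z) by (rewrite Cexp_PI_Ci; ring).
unfold theta_term, expi; rewrite <- !Cexp_plus; f_equal.
rewrite plus_IZR, !RtoC_plus; field.
Qed.

(** Two steps of the Pascal recurrence. In terms of [A = q^(N+1+n)] and [B = q^(N+1-n)] it is an
    identity between polynomials. *)
Lemma qbin_rec (tau : C) (N : nat) (n : Z) : (0 < Im tau)%R ->
  qbin tau (S N) n =
  (1 + expi (2 * INR N + 1) tau) * qbin tau N n + expi (INR N + 1 - IZR n) tau * qbin tau N (n - 1) +
  expi (INR N + 1 + IZR n) tau * qbin tau N (n + 1).
Proof.
intros Ht; unfold qbin; set (a := (Z.of_nat (S N) + n)%Z); set (b := (Z.of_nat (S N) - n)%Z).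
replace (Z.of_nat N + n)%Z with (a - 1)%Z by lia.
replace (Z.of_nat N - n)%Z with (b - 1)%Z by lia.
replace (Z.of_nat N + (n - 1))%Z with (a - 1 - 1)%Z by lia.
replace (Z.of_nat N - (n - 1))%Z with b by lia.
replace (Z.of_nat N + (n + 1))%Z with a by lia.
replace (Z.of_nat N - (n + 1))%Z with (b - 1 - 1)%Z by lia.
replace (2 * S N)%nat with (S (S (2 * N))) by lia.
rewrite !qfac_S, !(iqfac_rec tau (_ - 1)) by exact Ht.
rewrite (iqfac_rec tau a), (iqfac_rec tau b) by exact Ht.
assert (Ea : (INR N + 1 + IZR n)%R = IZR a)
  by (unfold a; rewrite plus_IZR, Nat2Z.inj_succ, succ_IZR, <- INR_IZR_INZ; ring).
assert (Eb : (INR N + 1 - IZR n)%R = IZR b)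
  by (unfold b; rewrite minus_IZR, Nat2Z.inj_succ, succ_IZR, <- INR_IZR_INZ; ring).
rewrite Ea, Eb, !minus_IZR.
replace (INR (S (S (2 * N)))) with (IZR a + IZR b)%R
  by (rewrite <- Ea, <- Eb, !S_INR, mult_INR; simpl; ring).
replace (INR (S (2 * N))) with (IZR a + IZR b + - (1))%R
  by (rewrite <- Ea, <- Eb, !S_INR, mult_INR; simpl; ring).
replace (2 * INR N + 1)%R with (IZR a + IZR b + - (1))%R
  by (rewrite <- Ea, <- Eb; ring).
unfold Rminus; rewrite !expi_plus, !expi_opp.
field; apply expi_neq_0.
Qed.

Lemma has_sum_Z_shift (f : Z -> C) (p : C) (k : Z) :
  has_sum (fun _ => True) f p -> has_sum (fun _ => True) (fun n => f (n + k)%Z) p.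
Proof.
intros H; apply (conv_reindex (fun _ => True) (fun _ => True) (fun n => n + k)%Z f p); trivial.
- intros x y _ _ E; lia.
- intros y _; exists (y - k)%Z; split; [trivial | lia].
Qed.

(** The finite form of the triple product. Multiplication by the next two factors shifts the sum
    by one in both directions, and the recurrence collects the shifted terms. *)
Lemma finite_triple_product (tau z : C) (N : nat) : (0 < Im tau)%R ->
  has_sum (fun _ => True) (fun n => qbin tau N n * theta_term tau z n)
    (big Cmult 1 (fun k => (1 - expi 1 z * expi (INR k) tau) * (1 - / expi 1 z * expi (INR k - 1) tau)) (seq 1 N)).
Proof.
intros Ht; induction N as [| N IH].
- simpl; apply (conv_support (fun n => n = 0%Z)); [trivial | |].
  + intros n _ Hn; unfold qbin, iqfac; simpl.
    destruct (Z_lt_dec n 0); [ring |]; destruct (Z_lt_dec (- n) 0); [ring | lia].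
  + assert (E : RtoC 1 = qbin tau 0 0 * theta_term tau z 0).
    { unfold qbin, iqfac, theta_term, qfac; simpl; replace (PI * Ci * 0 * (1 + 2 * z + (0 + 1) * tau)) with (RtoC 0) by ring.
      rewrite Cexp_0; field; apply C1_neq_0. }
    rewrite E; apply (conv_singleton (fun n => qbin tau 0 n * theta_term tau z n)).
- rewrite big_seq_S.
  set (S := big _ _ _ _) in *.
  assert (I0 := has_sum_scal _ _ _ (1 + expi (2 * INR N + 1) tau) IH).
  assert (I1 := has_sum_scal _ _ _ (- expi 1 z * expi (INR N + 1) tau) (has_sum_Z_shift _ _ (-1) IH)).
  assert (I2 := has_sum_scal _ _ _ (- / expi 1 z * expi (INR N) tau) (has_sum_Z_shift _ _ 1 IH)).
  assert (I := conv_op _ _ _ _ _ (conv_op _ _ _ _ _ I0 I1) I2).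
  assert (HU := expi_neq_0 1 z).
  replace (S * _) with ((1 + expi (2 * INR N + 1) tau) * S + - expi 1 z * expi (INR N + 1) tau * S +
    - / expi 1 z * expi (INR N) tau * S).
  + revert I; apply conv_ext; intros n _.
    rewrite qbin_rec by exact Ht.
    rewrite theta_term_succ.
    assert (Hs := theta_term_succ tau z (n + -1)).
    replace (n + -1 + 1)%Z with n in Hs by lia.
    replace (n + -1)%Z with (n - 1)%Z in * by lia.
    rewrite minus_IZR in Hs; replace (IZR n - 1 + 1)%R with (IZR n) in Hs by ring.
    assert (HEn := expi_neq_0 (IZR n) tau).
    replace (theta_term tau z (n - 1)) with (- / expi 1 z * / expi (IZR n) tau * theta_term tau z n)
      by (rewrite Hs; field; auto).
    unfold Rminus; rewrite !expi_plus, !expi_opp; field; auto.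
  + replace (1 + N)%nat with (Datatypes.S N) by lia; rewrite S_INR.
    replace (INR N + 1 - 1)%R with (INR N) by ring.
    replace (2 * INR N + 1)%R with (INR N + (INR N + 1))%R by ring; rewrite (expi_plus (INR N) (INR N + 1)).
    field; auto.
Qed.

Lemma tends_bounded (f : nat -> C) (p : C) : tends eventually f p ->
  exists M, forall n, (Cmod (f n) <= M)%R.
Proof.
intros H; destruct (H 1%R Rlt_0_1) as [N HN].
exists (rsum (fun n => Cmod (f n)) (seq 0 N) + (Cmod p + 1))%R; intros n.
assert (Hp := Cmod_ge_0 p).
assert (Hs : (0 <= rsum (fun n => Cmod (f n)) (seq 0 N))%R) by (apply rsum_ge_0; intros; apply Cmod_ge_0).
destruct (le_lt_dec N n) as [Hn | Hn].
- specialize (HN n Hn); assert (T := Cmod_triangle_inv (f n) p); lra.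
- assert (H1 : (rsum (fun n => Cmod (f n)) (n :: nil) <= rsum (fun n => Cmod (f n)) (seq 0 N))%R).
  { apply rsum_incl; [repeat constructor; simpl; tauto | | intros; apply Cmod_ge_0].
    intros x [<- | []]; apply in_seq; lia. }
  simpl in H1; lra.
Qed.

(** Completing the square in the exponent leaves a factor [exp (- 2 |n|)], which is at most
    [(1 + |n|)^(-2)]. *)
Lemma summable_theta_term (tau z : C) : (0 < Im tau)%R ->
  summable (fun _ : Z => True) (fun n => Cmod (theta_term tau z n)).
Proof.
intros Ht; assert (HP := PI_RGT_0).
set (a := (PI * Im tau)%R); assert (Ha : (0 < a)%R) by (unfold a; apply Rmult_lt_0_compat; lra).
set (B := (2 + a + 2 * PI * Rabs (Im z))%R).
apply (summable_le _ (fun n => exp (B ^ 2 / (4 * a)) * Rpower (1 + Rabs (IZR n)) (- (2)))%R).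
2:{ apply summable_scal; [left; apply exp_pos | apply summable_Z_power; lra]. }
intros n _; split; [apply Cmod_ge_0 |].
unfold theta_term; rewrite Cmod_Cexp.
set (t := Rabs (IZR n)); assert (H0 : (0 <= t)%R) by apply Rabs_pos.
assert (Ht2 : (IZR n * IZR n = t * t)%R) by (unfold t; rewrite <- Rabs_mult, Rabs_pos_eq; nra).
replace (Re (PI * Ci * IZR n * (1 + 2 * z + (IZR n + 1) * tau)))
  with (- a * (IZR n * IZR n) - a * IZR n - 2 * PI * (IZR n * Im z))%R
  by (destruct z, tau; unfold a; simpl; ring).
rewrite Ht2.
assert (H1 : (- IZR n <= t)%R) by (unfold t; rewrite <- Rabs_Ropp; apply Rle_abs).
assert (H2 : (- (IZR n * Im z) <= t * Rabs (Im z))%R)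
  by (unfold t; rewrite <- Rabs_mult, <- Rabs_Ropp; apply Rle_abs).
assert (H3 : (- a * (t * t) - a * IZR n - 2 * PI * (IZR n * Im z) <= B ^ 2 / (4 * a) + - (2 * t))%R).
{ apply Rle_trans with (- a * (t * t) + B * t - 2 * t)%R; [unfold B; nra |].
  assert (H4 : (0 <= / (4 * a) * Rsqr (2 * a * t - B))%R).
  { apply Rmult_le_pos; [left; apply Rinv_0_lt_compat; lra | apply Rle_0_sqr]. }
  replace (/ (4 * a) * Rsqr (2 * a * t - B))%R with (a * (t * t) - B * t + B ^ 2 / (4 * a))%R in H4
    by (unfold Rsqr; field; lra).
  lra. }
eapply Rle_trans; [apply exp_le, H3 |]; rewrite exp_plus.
apply Rmult_le_compat_l; [left; apply exp_pos |].
unfold Rpower; apply exp_le.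
assert (ln (1 + t) <= t)%R.
{ rewrite <- (ln_exp t) at 2; apply Rcomplements.ln_le; [lra | apply exp_ge_1p]. }
lra.
Qed.

Lemma has_prod_pos_shift (f : nat -> C) (p : C) :
  has_prod pos f p -> has_prod pos (fun k => f (Nat.pred k)) (f 0%nat * p).
Proof.
intros H.
apply (conv_iff (fun k => k = 1%nat \/ (2 <= k)%nat)); [unfold pos; intros; lia |].
apply conv_union; [lia | apply (conv_singleton (fun k => f (Nat.pred k))) |].
apply (conv_reindex pos (fun k => 2 <= k)%nat S (fun k => f (Nat.pred k)) p); unfold pos.
- intros; lia.
- intros; lia.
- intros y Hy; exists (Nat.pred y); split; lia.
- revert H; apply conv_ext; trivial.
Qed.

Lemma qfac_tends (tau : C) : (0 < Im tau)%R -> tends eventually (qfac tau) (qpoch tau 1).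
Proof.
intros Ht; apply (tends_ext _ (fun n => big Cmult 1 (fun k => 1 - 1 * expi (INR k) tau) (seq 1 n))).
- intros n; apply big_ext; intros x _; ring.
- apply tends_seq_of_conv, qpoch_prod, Ht.
Qed.

Lemma qpoch_1_neq_0 (tau : C) : (0 < Im tau)%R -> qpoch tau 1 <> 0.
Proof.
intros Ht; apply qpoch_neq_0; [exact Ht |]; intros n Hn; rewrite Cmult_1_l; now apply one_minus_q_neq_0.
Qed.

Lemma iqfac_tends (tau : C) (g : nat -> Z) : (0 < Im tau)%R ->
  (forall M : nat, eventually (fun n => Z.of_nat M <= g n)%Z) ->
  tends eventually (fun n => iqfac tau (g n)) (/ qpoch tau 1).
Proof.
intros Ht Hg.
assert (H := tends_inv _ _ _ (qpoch_1_neq_0 tau Ht) (qfac_tends tau Ht)).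
intros eps Heps; destruct (H eps Heps) as [N HN]; generalize (Hg N); apply filter_imp.
intros n Hn; unfold iqfac; destruct (Z_lt_dec (g n) 0); [lia |]; apply HN; lia.
Qed.

Lemma qbin_bounded (tau : C) : (0 < Im tau)%R -> exists M, forall N n, (Cmod (qbin tau N n) <= M)%R.
Proof.
intros Ht; destruct (tends_bounded _ _ (qfac_tends tau Ht)) as [M1 H1].
destruct (tends_bounded _ _ (iqfac_tends tau Z.of_nat Ht (fun M => ex_intro _ M (fun n Hn => inj_le _ _ Hn))))
  as [M2 H2].
assert (H3 : forall k, (Cmod (iqfac tau k) <= M2)%R).
{ intros k; destruct (Z_lt_dec k 0) as [Hk | Hk].
  - assert (H4 := H2 0%nat); assert (H5 := Cmod_ge_0 (iqfac tau (Z.of_nat 0))).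
    unfold iqfac at 1; destruct (Z_lt_dec k 0); [rewrite Cmod_0; lra | lia].
  - rewrite <- (Z2Nat.id k) by lia; apply H2. }
exists (M1 * (M2 * M2))%R; intros N n; unfold qbin; rewrite !Cmod_mult.
repeat apply Rmult_le_compat; auto; try apply Cmod_ge_0.
apply Rmult_le_pos; apply Cmod_ge_0.
Qed.

(** As [N] grows the Gaussian binomials stay bounded and tend to [1 / (q; q)], so that the finite
    identity passes to the limit by domination. *)
Theorem jacobi_triple_product (tau z : C) : (0 < Im tau)%R ->
  has_sum (fun _ => True) (theta_term tau z)
    (qpoch tau 1 * (qpoch tau (expi 1 z) * ((1 - / expi 1 z) * qpoch tau (/ expi 1 z)))).
Proof.
intros Ht; set (u := expi 1 z); set (Q := qpoch tau 1).
assert (HQ : Q <> 0) by (now apply qpoch_1_neq_0).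
destruct (conv_exists (op := Cplus) (fun _ => True) (theta_term tau z) _ (summable_theta_term tau z Ht)) as [T HT].
{ intros n _; replace (theta_term tau z n - 0) with (theta_term tau z n) by ring; apply Rle_refl. }
assert (P2 : has_prod pos (fun k => 1 - / u * expi (INR k - 1) tau) ((1 - / u) * qpoch tau (/ u))).
{ assert (H := has_prod_pos_shift _ _ (qpoch_prod tau (/ u) Ht)); cbv beta in H; simpl (INR 0) in H.
  rewrite expi_0, Cmult_1_r in H; revert H; apply conv_ext; intros k Hk.
  destruct k as [| k]; [unfold pos in Hk; lia |]; simpl Nat.pred; rewrite S_INR.
  now replace (INR k + 1 - 1)%R with (INR k) by ring. }
assert (P := tends_seq_of_conv _ _ (conv_op _ _ _ _ _ (qpoch_prod tau u Ht) P2)).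
destruct (qbin_bounded tau Ht) as [M HM].
assert (HM0 : (0 <= M)%R) by (eapply Rle_trans; [apply Cmod_ge_0 | apply (HM 0%nat 0%Z)]).
assert (HL : has_sum (fun _ => True) (fun n => / Q * theta_term tau z n) (/ Q * T)) by (now apply has_sum_scal).
assert (E : / Q * T = qpoch tau u * ((1 - / u) * qpoch tau (/ u))).
{ apply (tends_unique eventually
    (fun N => big Cmult 1 (fun k => (1 - u * expi (INR k) tau) * (1 - / u * expi (INR k - 1) tau)) (seq 1 N)));
    [| exact P].
  apply (conv_dominated (op := Cplus) eventually (fun _ => True) (fun n => M * Cmod (theta_term tau z n))%R
    (fun N n => qbin tau N n * theta_term tau z n) (fun n => / Q * theta_term tau z n)); trivial.
  - apply summable_scal; [exact HM0 | now apply summable_theta_term].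
  - apply filter_forall; intros N n _; cbv beta.
    replace (qbin tau N n * theta_term tau z n - 0) with (qbin tau N n * theta_term tau z n) by ring.
    rewrite Cmod_mult; apply Rmult_le_compat_r; [apply Cmod_ge_0 | apply HM].
  - intros n _; apply tends_mult; lim.
    replace (/ Q) with (Q * (/ Q * / Q)) by (field; exact HQ).
    apply tends_mult; [lim | | apply tends_mult; [lim | |]].
    + intros eps Heps; destruct (qfac_tends tau Ht eps Heps) as [N HN]; exists N; intros k Hk; apply HN; lia.
    + apply iqfac_tends; [exact Ht |]; intros K; exists (K + Z.to_nat (Z.abs n))%nat; intros k Hk; lia.
    + apply iqfac_tends; [exact Ht |]; intros K; exists (K + Z.to_nat (Z.abs n))%nat; intros k Hk; lia.
  - apply filter_forall; intros N; now apply finite_triple_product. }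
rewrite <- E; replace (Q * (/ Q * T)) with T by (field; exact HQ); exact HT.
Qed.

(** In the triple product, [u^(1/2) (1 - 1/u)] is [2 sinh (pi i z)]; the powers of [q] cancel
    against those of [eta ^ 3]. *)
Lemma Theta_product (tau z : C) : (0 < Im tau)%R ->
  Theta z tau = Cexp (PI / 2 * (z ^ 2 / Im tau)) * (2 * Csinh (PI * Ci * z)) *
    (qpoch tau (expi 1 z) * qpoch tau (/ expi 1 z) / qpoch tau 1 ^ 2).
Proof.
intros Ht; unfold Theta.
assert (Eth : theta (z + tau / 2 + 1 / 2) tau =
  qpoch tau 1 * (qpoch tau (expi 1 z) * ((1 - / expi 1 z) * qpoch tau (/ expi 1 z)))).
{ unfold theta; apply Csum_over_unique, tends_filterlim; [lim |].
  apply (conv_ext (op := Cplus) (e := RtoC 0) _ (theta_term tau z)); [| now apply jacobi_triple_product].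
  intros n _; unfold theta_term, expi; rewrite <- Cexp_plus; f_equal.
  rewrite RtoC_div, RtoC_pow by lra; field; apply RtoC_neq_0; lra. }
assert (Eeta : eta tau = expi (1 / 24) tau * qpoch tau 1).
{ unfold eta; f_equal; apply Cprod_over_unique, tends_filterlim; [lim |].
  apply (conv_ext (op := Cmult) (e := RtoC 1) _ (fun n => 1 - 1 * expi (INR n) tau)); [intros; ring |].
  now apply qpoch_prod. }
rewrite Eth, Eeta.
assert (E8 : expi (1 / 8) tau = expi (1 / 24) tau ^ 3).
{ replace (1 / 8)%R with (1 / 24 + (1 / 24 + 1 / 24))%R by field; rewrite !expi_plus; ring. }
assert (Es : 2 * Csinh (PI * Ci * z) = expi (1 / 2) z * (1 - / expi 1 z)).
{ unfold Csinh; replace (expi 1 z) with (expi (1 / 2) z * expi (1 / 2) z)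
    by (rewrite <- expi_plus; f_equal; field).
  assert (Eh : expi (1 / 2) z = Cexp (PI * Ci * z)).
  { unfold expi; f_equal; rewrite RtoC_div by lra; field; apply RtoC_neq_0; lra. }
  rewrite Eh, Cexp_opp; assert (H := Cexp_neq_0 (PI * Ci * z)); field.
  exact H. }
rewrite Es, E8.
assert (H1 := expi_neq_0 (1 / 24) tau); assert (H2 := expi_neq_0 1 z); assert (H3 := qpoch_1_neq_0 tau Ht).
field; auto.
Qed.

(** * Lattice sums *)

Definition lat (tau : C) (mn : Z * Z) : C := IZR (fst mn) * tau + IZR (snd mn).

Lemma lat_re (tau : C) (mn : Z * Z) : Re (lat tau mn) = (IZR (fst mn) * Re tau + IZR (snd mn))%R.
Proof. destruct tau; unfold lat; simpl; ring. Qed.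

Lemma lat_im (tau : C) (mn : Z * Z) : Im (lat tau mn) = (IZR (fst mn) * Im tau)%R.
Proof. destruct tau; unfold lat; simpl; ring. Qed.

(** The imaginary part of [m tau + n] controls [m], and then the real part controls [n]. *)
Lemma lat_lower (tau : C) : (0 < Im tau)%R -> exists c, (0 < c)%R /\
  forall mn, (c * (Rabs (IZR (fst mn)) + Rabs (IZR (snd mn))) <= Cmod (lat tau mn))%R.
Proof.
intros Ht; set (y := Im tau) in *; set (x := Re tau).
assert (Hx := Rabs_pos x).
assert (HK : (0 < 1 + (1 + Rabs x) / y)%R).
{ assert (0 < (1 + Rabs x) / y)%R by (apply Rdiv_lt_0_compat; lra); lra. }
exists (/ (1 + (1 + Rabs x) / y))%R; split; [now apply Rinv_0_lt_compat |].
intros mn; set (w := lat tau mn).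
assert (H1 := im_le_Cmod w); assert (H2 := re_le_Cmod w).
unfold w in H1, H2; rewrite lat_im, Rabs_mult in H1; rewrite lat_re in H2; fold w in H1, H2.
fold y in H1; rewrite (Rabs_pos_eq y) in H1 by lra.
set (m := IZR (fst mn)) in *; set (n := IZR (snd mn)) in *.
assert (H3 : (Rabs n <= Rabs (m * x + n) + Rabs m * Rabs x)%R).
{ rewrite <- Rabs_mult; replace n with ((m * x + n) + - (m * x))%R at 1 by ring.
  eapply Rle_trans; [apply Rabs_triang |]; rewrite Rabs_Ropp; lra. }
fold x in H2.
assert (H4 : (Rabs m <= Cmod w / y)%R) by (apply Rle_div_r; lra).
assert (H5 : (Rabs m * Rabs x <= Cmod w / y * Rabs x)%R) by (apply Rmult_le_compat_r; lra).
apply Rmult_le_reg_l with (1 := HK); rewrite <- Rmult_assoc, Rinv_r, Rmult_1_l by lra.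
replace ((1 + (1 + Rabs x) / y) * Cmod w)%R with (Cmod w + Cmod w / y + Cmod w / y * Rabs x)%R by (field; lra).
lra.
Qed.

Definition nonzero (mn : Z * Z) : Prop := mn <> (0%Z, 0%Z).

Lemma lat_ge (tau : C) : (0 < Im tau)%R -> exists c, (0 < c)%R /\ forall mn, nonzero mn ->
  (c * (1 + Rabs (IZR (fst mn))) <= Cmod (lat tau mn) /\ c * (1 + Rabs (IZR (snd mn))) <= Cmod (lat tau mn))%R.
Proof.
intros Ht; destruct (lat_lower tau Ht) as [c [Hc H]]; exists (c / 2)%R; split; [lra |].
intros [m n] Hn; specialize (H (m, n)); simpl in *.
assert (H1 : (1 <= Rabs (IZR m) + Rabs (IZR n))%R).
{ rewrite <- !abs_IZR, <- plus_IZR; apply IZR_le.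
  destruct (Z.eq_dec m 0) as [-> | Hm]; [| lia]; destruct (Z.eq_dec n 0) as [-> | Hn0]; [| lia].
  now destruct Hn. }
assert (Hm0 := Rabs_pos (IZR m)); assert (Hn0 := Rabs_pos (IZR n)).
assert (c * 1 <= c * (Rabs (IZR m) + Rabs (IZR n)))%R by (apply Rmult_le_compat_l; lra).
assert (0 <= c * Rabs (IZR m))%R by (apply Rmult_le_pos; lra).
assert (0 <= c * Rabs (IZR n))%R by (apply Rmult_le_pos; lra).
split; lra.
Qed.

Lemma lat_pos (tau : C) (mn : Z * Z) : (0 < Im tau)%R -> nonzero mn -> (0 < Cmod (lat tau mn))%R.
Proof.
intros Ht Hn; destruct (lat_ge tau Ht) as [c [Hc H]]; destruct (H mn Hn) as [H1 _].
assert (H0 := Rabs_pos (IZR (fst mn))); assert (0 <= c * Rabs (IZR (fst mn)))%R by (apply Rmult_le_pos; lra); lra.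
Qed.

Lemma lat_neq_0 (tau : C) (mn : Z * Z) : (0 < Im tau)%R -> nonzero mn -> lat tau mn <> 0.
Proof. intros Ht Hn; now apply Cmod_gt_0, lat_pos. Qed.

(** As [|w|] is at least [c (1 + |m|)] and at least [c (1 + |n|)], splitting the exponent evenly
    dominates the lattice sum by a product of two sums in one variable. *)
Lemma summable_lattice (tau : C) (p : R) : (0 < Im tau)%R -> (2 < p)%R ->
  summable nonzero (fun mn => Rpower (Cmod (lat tau mn)) (- p)).
Proof.
intros Ht Hp; destruct (lat_ge tau Ht) as [c [Hc H]].
apply (summable_le _ (fun mn => Rpower (c * c) (- (p / 2)) *
  (Rpower (1 + Rabs (IZR (fst mn))) (- (p / 2)) * Rpower (1 + Rabs (IZR (snd mn))) (- (p / 2))))%R).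
- intros mn Hn; split; [left; apply Rpower_gt_0 |].
  destruct (H mn Hn) as [H1 H2]; assert (Hw := lat_pos tau mn Ht Hn).
  assert (Hm0 := Rabs_pos (IZR (fst mn))); assert (Hn0 := Rabs_pos (IZR (snd mn))).
  replace (- p)%R with (- (p / 2) + - (p / 2))%R by field.
  rewrite Rpower_plus, !Rpower_mult_distr by nra.
  apply Rpower_neg_le; [| lra]; split; [apply Rmult_lt_0_compat; nra |].
  replace (c * c * ((1 + Rabs (IZR (fst mn))) * (1 + Rabs (IZR (snd mn)))))%R
    with ((c * (1 + Rabs (IZR (fst mn)))) * (c * (1 + Rabs (IZR (snd mn)))))%R by ring.
  apply Rmult_le_compat; nra.
- apply summable_scal; [left; apply Rpower_gt_0 |].
  apply (summable_sub (fun mn : Z * Z => True /\ True)); [auto |].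
  apply (summable_prod (fun _ => True) (fun _ => True) (fun m : Z => Rpower (1 + Rabs (IZR m)) (- (p / 2)))
    (fun n : Z => Rpower (1 + Rabs (IZR n)) (- (p / 2)))); apply summable_Z_power; lra.
Qed.

Lemma summable_lattice_pow (tau : C) (n : nat) : (0 < Im tau)%R -> (3 <= n)%nat ->
  summable nonzero (fun mn => / Cmod (lat tau mn) ^ n)%R.
Proof.
intros Ht Hn; apply (summable_le _ (fun mn => Rpower (Cmod (lat tau mn)) (- INR n))).
- intros mn H; assert (Hw := lat_pos tau mn Ht H); rewrite Rpower_neg_pow by exact Hw.
  split; [left; apply Rinv_0_lt_compat, pow_lt, Hw | apply Rle_refl].
- apply summable_lattice; [exact Ht |]; apply le_INR in Hn; simpl in Hn; lra.
Qed.

Lemma lat_finite (tau : C) (M : R) : (0 < Im tau)%R -> exists E : list (Z * Z),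
  forall mn, (Cmod (lat tau mn) <= M)%R -> In mn E.
Proof.
intros Ht; destruct (lat_lower tau Ht) as [c [Hc H]].
set (N := Z.to_nat (up (M / c))).
set (box := map (fun k => Z.of_nat k - Z.of_nat N)%Z (seq 0 (2 * N + 1))).
exists (list_prod box box); intros [m n] Hmn; specialize (H (m, n)); simpl in H.
assert (Hm0 := Rabs_pos (IZR m)); assert (Hn0 := Rabs_pos (IZR n)).
assert (Hb : forall k, (Rabs (IZR k) <= M / c)%R -> In k box).
{ intros k Hk; destruct (archimed (M / c)) as [H1 _].
  assert (H2 : (Z.abs k < up (M / c))%Z) by (apply lt_IZR; rewrite abs_IZR; lra).
  apply in_map_iff; exists (Z.to_nat (k + Z.of_nat N)); unfold N; split; [lia |].
  apply in_seq; lia. }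
apply in_prod; apply Hb; apply Rle_div_r; try lra;
  (assert (0 <= c * Rabs (IZR m))%R by (apply Rmult_le_pos; lra));
  (assert (0 <= c * Rabs (IZR n))%R by (apply Rmult_le_pos; lra)); lra.
Qed.

(** Shifting by the integer part of [m Re tau] places the points of the row in the unit intervals
    between consecutive integers, which gives a bound uniform in [m]. *)
Lemma row_sum_bound (tau : C) (t : R) : (0 < Im tau)%R -> (0 < t)%R -> exists K, (0 < K)%R /\
  forall m, (1 <= m)%Z -> forall l, NoDup l ->
  (rsum (fun n => Rpower (Cmod (lat tau (m, n))) (- (1 + t))) l <= K * Rpower (IZR m * Im tau) (- t))%R.
Proof.
intros Ht Hs; set (y := Im tau) in *.
exists (Rpower (/ 2) (- (1 + t)) * (2 * (/ y + / t)))%R.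
assert (Hy : (0 < / y)%R) by (now apply Rinv_0_lt_compat).
assert (Htt : (0 < / t)%R) by (now apply Rinv_0_lt_compat).
split; [apply Rmult_lt_0_compat; [apply Rpower_gt_0 | lra] |].
intros m Hm l Hl; set (Y := (IZR m * y)%R).
assert (Hm1 : (1 <= IZR m)%R) by (now apply IZR_le).
assert (HY : (y <= Y)%R) by (unfold Y; nra).
(* the points [x_n = m Re tau + n] satisfy [|x_n| >= zindex (n + a)] *)
set (a := Int_part (IZR m * Re tau)).
assert (Ha : (IZR a <= IZR m * Re tau < IZR a + 1)%R).
{ destruct (base_Int_part (IZR m * Re tau)) as [H1 H2]; fold a in H1, H2; lra. }
apply Rle_trans with (rsum (fun n => Rpower (/ 2) (- (1 + t)) *
  Rpower (Y + INR (zindex (n + a))) (- (1 + t)))%R l).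
- apply rsum_le; intros n _.
  assert (Hz := pos_INR (zindex (n + a))).
  rewrite Rpower_mult_distr by lra; apply Rpower_neg_le; [| lra]; split; [lra |].
  assert (H1 := im_le_Cmod (lat tau (m, n))); rewrite lat_im in H1.
  assert (H2 := re_le_Cmod (lat tau (m, n))); rewrite lat_re in H2; simpl in H1, H2.
  fold y in H1; fold Y in H1; rewrite (Rabs_pos_eq Y) in H1 by lra.
  assert (H3 : (INR (zindex (n + a)) <= Rabs (IZR m * Re tau + IZR n))%R).
  { unfold zindex; destruct (Z_lt_dec (n + a) 0) as [Hn | Hn]; rewrite INR_IZR_INZ, Z2Nat.id by lia.
    - rewrite minus_IZR, opp_IZR, plus_IZR.
      assert (Hn' : (IZR n + IZR a <= -1)%R) by (rewrite <- plus_IZR; apply IZR_le; lia).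
      rewrite Rabs_left by lra; lra.
    - rewrite plus_IZR; eapply Rle_trans; [| apply Rle_abs]; lra. }
  lra.
- rewrite rsum_scal, Rmult_assoc; apply Rmult_le_compat_l; [left; apply Rpower_gt_0 |].
  rewrite <- (rsum_map (fun n => n + a)%Z (fun n => Rpower (Y + INR (zindex n)) (- (1 + t)))).
  eapply Rle_trans.
  + apply (zindex_bound (fun k => Rpower (Y + INR k) (- (1 + t)))
      (Rpower Y (- (1 + t)) + Rpower Y (- t) / t)).
    * intros; left; apply Rpower_gt_0.
    * intros n; apply power_sum_le; lra.
    * apply (NoDup_map_on (fun _ => True)); trivial; intros; lia.
  + replace (- (1 + t))%R with (- (1) + - t)%R by ring.
    rewrite Rpower_plus, Rpower_Ropp, Rpower_1 by lra.
    assert (HP := Rpower_gt_0 Y (- t)).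
    assert (/ Y <= / y)%R by (apply Rinv_le_contravar; lra).
    assert (/ Y * Rpower Y (- t) <= / y * Rpower Y (- t))%R by (apply Rmult_le_compat_r; lra).
    unfold Rdiv; nra.
Qed.

Lemma summable_row (tau : C) (p : R) (m : Z) : (0 < Im tau)%R -> (1 < p)%R -> (1 <= m)%Z ->
  summable (fun _ : Z => True) (fun n => Rpower (Cmod (lat tau (m, n))) (- p)).
Proof.
intros Ht Hp Hm; destruct (row_sum_bound tau (p - 1) Ht ltac:(lra)) as [K [HK H]].
replace (1 + (p - 1))%R with p in H by ring.
split; [intros; left; apply Rpower_gt_0 | eexists; intros l Hl _; apply H; assumption].
Qed.

Lemma telescoping_Z (g : Z -> C) (a b p : C) :
  tends eventually (fun n => g (Z.of_nat n)) a ->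
  tends eventually (fun n => g (- Z.of_nat n)%Z) b ->
  has_sum (fun _ => True) (fun n => g (n + 1)%Z - g n) p -> p = a - b.
Proof.
intros Ha Hb Hp.
set (L := fun n => map (fun k => Z.of_nat k - Z.of_nat n)%Z (seq 0 (2 * n))).
assert (H1 : tends eventually (fun n => big Cplus 0 (fun k => g (k + 1)%Z - g k) (L n)) p).
{ apply (conv_exhaust eventually (fun _ => True)); trivial; unfold L.
  - intros n; apply (NoDup_map_on (fun _ => True)); trivial; [intros; lia | apply seq_NoDup].
  - intros x _; exists (S (Z.to_nat (Z.abs x))); intros n Hn; apply in_map_iff.
    exists (Z.to_nat (x + Z.of_nat n)); split; [lia | apply in_seq; lia]. }
apply (tends_unique eventually (fun n => big Cplus 0 (fun k => g (k + 1)%Z - g k) (L n))); [exact H1 |].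
apply (tends_ext _ (fun n => g (Z.of_nat n) - g (- Z.of_nat n)%Z)); [| lim].
intros n; unfold L; rewrite big_map.
assert (HS : forall k, big Cplus 0 (fun x => g (Z.of_nat x - Z.of_nat n + 1)%Z - g (Z.of_nat x - Z.of_nat n)%Z) (seq 0 k)
  = g (Z.of_nat k - Z.of_nat n)%Z - g (- Z.of_nat n)%Z).
{ induction k as [| k IH]; [simpl; ring |].
  rewrite big_seq_S, IH, Nat.add_0_l.
  replace (Z.of_nat (S k) - Z.of_nat n)%Z with (Z.of_nat k - Z.of_nat n + 1)%Z by lia; ring. }
rewrite HS; do 2 f_equal; lia.
Qed.

Lemma has_sum_bound {T : Type} (A : T -> Prop) (f : T -> C) (b : T -> R) (p : C) (M : R) :
  (forall x, A x -> Cmod (f x) <= b x)%R ->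
  (forall l, NoDup l -> (forall x, In x l -> A x) -> rsum b l <= M)%R ->
  has_sum A f p -> (Cmod p <= M)%R.
Proof.
intros Hf HM Hp; replace p with (p - 0) by ring.
apply (Cmod_le_lim (finite_subsets A) (big Cplus 0 f)); [exact Hp |].
exists nil; split; [intros x [] |]; intros l Hl HA _.
replace (big Cplus 0 f l - 0) with (big Cplus 0 f l) by ring.
eapply Rle_trans; [apply Csum_est |]; eapply Rle_trans; [| apply HM; eassumption].
apply rsum_le; intros x Hx; replace (f x - 0) with (f x) by ring; auto.
Qed.

Lemma has_sum_exists {T : Type} (A : T -> Prop) (f : T -> C) (b : T -> R) :
  summable A b -> (forall x, A x -> Cmod (f x) <= b x)%R -> exists p, has_sum A f p.
Proof.
intros Hs Hf; apply (conv_exists (op := Cplus) A f b Hs); intros x Hx.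
replace (f x - 0) with (f x) by ring; auto.
Qed.

Lemma has_sum_minus {T : Type} (A : T -> Prop) (f g : T -> C) (p q : C) :
  has_sum A f p -> has_sum A g q -> has_sum A (fun x => f x - g x) (p - q).
Proof.
intros Hf Hg; replace (p - q) with (p + - (1) * q) by ring.
apply (conv_ext _ (fun x => f x + - (1) * g x)); [intros; ring |].
apply conv_op; [exact Hf | now apply has_sum_scal].
Qed.

Lemma conv_fst {op e} `{CMonoid op e} {T U : Type} (A : T -> Prop) (B : U -> Prop) (f : T * U -> C) (g : T -> C) (p : C) :
  (forall t, A t -> conv op e B (fun u => f (t, u)) (g t)) ->
  conv op e (fun x => A (fst x) /\ B (snd x)) f p -> conv op e A g p.
Proof.
intros Hg; apply (conv_fibers _ A fst); [tauto |]; intros t Ht.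
apply (conv_reindex B _ (fun u => (t, u)) f (g t)); [auto | | | now apply Hg].
- intros x y _ _ E; now injection E.
- intros [x y] [[H1 H2] H3]; simpl in *; exists y; subst; auto.
Qed.

Lemma conv_snd {op e} `{CMonoid op e} {T U : Type} (A : T -> Prop) (B : U -> Prop) (f : T * U -> C) (g : U -> C) (p : C) :
  (forall u, B u -> conv op e A (fun t => f (t, u)) (g u)) ->
  conv op e (fun x => A (fst x) /\ B (snd x)) f p -> conv op e B g p.
Proof.
intros Hg; apply (conv_fibers _ B snd); [tauto |]; intros u Hu.
apply (conv_reindex A _ (fun t => (t, u)) f (g u)); [auto | | | now apply Hg].
- intros x y _ _ E; now injection E.
- intros [x y] [[H1 H2] H3]; simpl in *; exists x; subst; auto.
Qed.

(** * Hecke's limit of the weight two Eisenstein series *)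

Lemma at_right_0 (P : R -> Prop) (d : R) : (0 < d)%R -> (forall s, (0 < s < d)%R -> P s) -> at_right 0 P.
Proof.
intros Hd H; exists (mkposreal d Hd); intros s Hs Hs0; apply H.
unfold ball in Hs; simpl in Hs; unfold AbsRing_ball, abs, minus, plus, opp in Hs; simpl in Hs.
apply Rabs_def2 in Hs; lra.
Qed.

Lemma tends_at_right_0 (f : R -> R) : ex_derive f 0 ->
  tends (at_right 0) (fun s => RtoC (f s)) (RtoC (f 0)).
Proof.
intros Hf; apply (ex_derive_continuous (K := R_AbsRing) (V := R_NormedModule)) in Hf.
intros eps Heps.
assert (H : locally 0%R (fun s => Rabs (f s - f 0) < eps)%R).
{ exact (proj1 (filterlim_locally f (f 0%R)) Hf (mkposreal eps Heps)). }
apply (filter_le_within (F := locally 0%R)); revert H; apply filter_imp; intros s Hs.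
rewrite <- RtoC_minus, Cmod_R; exact Hs.
Qed.

Lemma tends_Rpower_0 (a : R) : tends (at_right 0) (fun s => RtoC (Rpower a (- s))) 1.
Proof.
replace (RtoC 1) with (RtoC (Rpower a (- 0))) by (unfold Rpower; now rewrite Ropp_0, Rmult_0_l, exp_0).
apply (tends_at_right_0 (fun s => Rpower a (- s))); unfold Rpower; auto_derive; trivial.
Qed.

Lemma tends_id_0 : tends (at_right 0) (fun s => RtoC s) 0.
Proof. apply (tends_at_right_0 (fun s => s)); auto_derive; trivial. Qed.

#[local] Hint Resolve tends_id_0 tends_Rpower_0 : limits.

(** Both bounds are [ln t <= t - 1], at [t = 1 + e] and at its inverse. *)
Lemma ln_bounds (e : R) : (-1 < e)%R -> (e / (1 + e) <= ln (1 + e) <= e)%R.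
Proof.
intros He.
assert (H : forall t, (0 < t)%R -> (ln t <= t - 1)%R).
{ intros t Ht; rewrite <- (ln_exp (t - 1)); apply Rcomplements.ln_le; [exact Ht |].
  assert (H := exp_ge_1p (t - 1)); lra. }
split; [| assert (H1 := H (1 + e)%R); lra].
assert (H1 := H (/ (1 + e))%R); rewrite ln_Rinv in H1 by lra.
assert (H2 := H1 (Rinv_0_lt_compat (1 + e) ltac:(lra))).
replace (e / (1 + e))%R with (1 - / (1 + e))%R by (field; lra); lra.
Qed.

Lemma Rpower_est (sg e : R) : (0 <= sg <= 1 / 2)%R -> (Rabs e <= 3 / 4)%R ->
  (Rabs (Rpower (1 + e) (- sg) - 1 + sg * e) <= 40 * e ^ 2)%R.
Proof.
intros Hs He; assert (He' := He); apply Rabs_le_between in He'.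
destruct (ln_bounds e) as [L1 L2]; [lra |]; set (L := ln (1 + e)) in *.
assert (Hi : (0 < / (1 + e) <= 4)%R).
{ split; [apply Rinv_0_lt_compat; lra |]; replace 4%R with (/ (/ 4))%R by field.
  apply Rinv_le_contravar; lra. }
assert (H1 : (0 <= e - L <= 4 * e ^ 2)%R).
{ split; [lra |]; replace (e / (1 + e))%R with (e - e ^ 2 * / (1 + e))%R in L1 by (field; lra).
  assert (e ^ 2 * / (1 + e) <= e ^ 2 * 4)%R by (apply Rmult_le_compat_l; [apply pow2_ge_0 | lra]); lra. }
assert (H2 : (Rabs L <= 4 * Rabs e)%R).
{ apply Rabs_le; split.
  - destruct (Rle_dec 0 e) as [Hp | Hp].
    + assert (0 <= e / (1 + e))%R by (apply Rmult_le_pos; lra); assert (H9 := Rabs_pos e); lra.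
    + rewrite Rabs_left by lra; unfold Rdiv in L1.
      assert (- e * / (1 + e) <= - e * 4)%R by (apply Rmult_le_compat_l; lra); lra.
  - assert (H := Rle_abs e); assert (H' := Rabs_pos e); lra. }
unfold Rpower; fold L.
destruct (exp_est (- sg * L)) as [_ HE].
assert (H3 : (Rabs (- sg * L) <= 2 * Rabs e)%R).
{ rewrite Rabs_mult, Rabs_Ropp, (Rabs_pos_eq sg) by lra.
  assert (sg * Rabs L <= 1 / 2 * (4 * Rabs e))%R by (apply Rmult_le_compat; try lra; apply Rabs_pos); lra. }
assert (H4 : (exp (Rabs (- sg * L)) <= 9)%R).
{ apply Rle_trans with (exp (1 + 1)); [apply exp_le; lra |].
  rewrite exp_plus; assert (H := exp_le_3); assert (H' := exp_pos 1); nra. }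
assert (H5 : ((- sg * L) ^ 2 <= 4 * e ^ 2)%R).
{ rewrite <- (pow2_abs (- sg * L)), <- (pow2_abs e).
  replace (4 * Rabs e ^ 2)%R with ((2 * Rabs e) ^ 2)%R by ring; apply pow_incr; split; [apply Rabs_pos | exact H3]. }
replace (exp (- sg * L) - 1 + sg * e)%R with ((exp (- sg * L) - 1 - - sg * L) + sg * (e - L))%R by ring.
eapply Rle_trans; [apply Rabs_triang |].
rewrite (Rabs_pos_eq (sg * (e - L))) by (apply Rmult_le_pos; lra).
assert ((- sg * L) ^ 2 * exp (Rabs (- sg * L)) <= 4 * e ^ 2 * 9)%R.
{ apply Rmult_le_compat; [apply pow2_ge_0 | left; apply exp_pos | exact H5 | exact H4]. }
assert (sg * (e - L) <= 1 / 2 * (4 * e ^ 2))%R by (apply Rmult_le_compat; lra).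
assert (H6 := pow2_ge_0 e); lra.
Qed.

Definition eis (s : R) (w : C) : C := / w ^ 2 * Rpower (Cmod w) (- s).
Definition epstein (s : R) (w : C) : C := Rpower (Cmod w) (- (2 + s)).
(** Its derivative along the real direction is [- (1 + s/2) eis s - (s/2) epstein s]. *)
Definition primitive (s : R) (w : C) : C := / w * Rpower (Cmod w) (- s).

(** Replacing the derivative of [primitive s] by a difference, which telescopes along the rows,
    leaves an error of third order in [1 / w]. It is summable over the lattice even at [s = 0],
    where [eis s] is not. *)
Definition hecke_rem (s : R) (w : C) : C :=
  (1 + s / 2) * eis s w + s / 2 * epstein s w + (primitive s (w + 1) - primitive s w).

Lemma Cmod_inv_pow (w : C) (n : nat) : w <> 0 -> Cmod (/ w ^ n) = (/ Cmod w ^ n)%R.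
Proof. intros Hw; rewrite Cmod_inv, Cmod_pow; [reflexivity | now apply Cpow_nz]. Qed.

(** With [x = Re w], the terms of second order in [hecke_rem] add up to
    [1 / w^2 + s x / (w |w|^2)], and [|w + 1|^(-s)] is [|w|^(-s) (1 - s x / |w|^2)] up to second
    order, so that they cancel against the difference of [primitive s]. *)
Lemma hecke_rem_bound (s : R) (w : C) : (0 <= s <= 1)%R -> (4 <= Cmod w)%R ->
  (Cmod (hecke_rem s w) <= 1000 * / Cmod w ^ 3)%R.
Proof.
intros Hs Hw; set (r := Cmod w) in *.
assert (Hw0 : w <> 0) by (apply Cmod_gt_0; fold r; lra).
assert (Hw1r : (r / 2 <= Cmod (w + 1))%R).
{ assert (T := Cmod_triangle_inv w (- (1))); replace (w - - (1)) with (w + 1) in T by ring.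
  rewrite Cmod_opp, Cmod_1 in T; fold r in T; lra. }
assert (Hw1 : w + 1 <> 0) by (apply Cmod_gt_0; lra).
set (x := Re w); set (e := ((2 * x + 1) / r ^ 2)%R).
assert (Hr2 : (0 < r ^ 2)%R) by (apply pow_lt; lra).
assert (Hx : (Rabs x <= r)%R) by apply re_le_Cmod.
assert (He : (Rabs e <= 3 / r)%R).
{ unfold e; unfold Rdiv at 1; rewrite Rabs_mult, (Rabs_pos_eq (/ r ^ 2)) by (left; now apply Rinv_0_lt_compat).
  assert (H1 : (Rabs (2 * x + 1) <= 3 * r)%R).
  { eapply Rle_trans; [apply Rabs_triang |]; rewrite Rabs_mult, Rabs_R1, (Rabs_pos_eq 2) by lra; lra. }
  apply Rle_trans with (3 * r * / r ^ 2)%R; [apply Rmult_le_compat_r; [left; now apply Rinv_0_lt_compat | exact H1] |].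
  right; field; lra. }
assert (He34 : (Rabs e <= 3 / 4)%R).
{ eapply Rle_trans; [apply He |]; unfold Rdiv; apply Rmult_le_compat_l; [lra |]; apply Rinv_le_contravar; lra. }
set (P := Rpower r (- s)).
set (rho := Rpower (1 + e) (- (s / 2))).
assert (HP : (0 < P <= 1)%R).
{ split; [apply Rpower_gt_0 |]; unfold P; rewrite <- (Rpower_1_l (- s)); apply Rpower_neg_le; lra. }
assert (Hrho : Rpower (Cmod (w + 1)) (- s) = (P * rho)%R).
{ assert (Hsq : (Cmod (w + 1) ^ 2 = r ^ 2 * (1 + e))%R).
  { unfold e; rewrite Cmod2_alt; unfold r; field_simplify; [| fold r; lra].
    rewrite Cmod2_alt; fold x; destruct w as [wx wy]; unfold x; simpl; ring. }
  assert (Hp2 : forall a, (0 < a)%R -> Rpower a (- s) = Rpower (a ^ 2) (- (s / 2))).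
  { intros a Ha; rewrite <- Rpower_pow, Rpower_mult by exact Ha; f_equal; simpl; field. }
  unfold P, rho; rewrite !Hp2 by lra; rewrite Hsq, <- Rpower_mult_distr; [reflexivity | exact Hr2 |].
  apply Rabs_le_between in He34; lra. }
assert (HB : epstein s w = / RtoC (r ^ 2) * P).
{ unfold epstein; fold r; rewrite <- RtoC_inv, <- RtoC_mult by lra; f_equal.
  unfold P; rewrite Ropp_plus_distr, Rpower_plus; f_equal; apply (Rpower_neg_pow r 2); lra. }
set (dl := (rho - 1 + s * x / r ^ 2)%R).
assert (Hdl : (Rabs dl <= 361 / r ^ 2)%R).
{ replace dl with ((rho - 1 + s / 2 * e) + - (s / 2 * / r ^ 2))%R
    by (unfold dl, e; field; lra).
  eapply Rle_trans; [apply Rabs_triang |]; rewrite Rabs_Ropp.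
  assert (Hi : (0 < / r ^ 2)%R) by (now apply Rinv_0_lt_compat).
  rewrite (Rabs_pos_eq (s / 2 * / r ^ 2)) by (apply Rmult_le_pos; lra).
  assert (H1 := Rpower_est (s / 2) e ltac:(lra) He34); fold rho in H1.
  assert (H2 : (e ^ 2 <= 9 * / r ^ 2)%R).
  { rewrite <- pow2_abs; apply Rle_trans with ((3 / r) ^ 2)%R; [apply pow_incr; split; [apply Rabs_pos | exact He] |].
    right; field; lra. }
  assert (s / 2 * / r ^ 2 <= 1 * / r ^ 2)%R by (apply Rmult_le_compat_r; lra).
  unfold Rdiv; lra. }
assert (Hcc : RtoC (r ^ 2) = w * Cconj w) by (unfold r; apply Cmod2_conj).
assert (Hcx : RtoC x = (w + Cconj w) / 2) by apply re_alt.
assert (Hwb : Cconj w <> 0).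
{ apply Cmod_gt_0; rewrite Cmod_conj; fold r; lra. }
assert (H2 : RtoC 2 <> 0) by (apply RtoC_neq_0; lra).
assert (Hrho2 : RtoC rho = 1 - s * x / RtoC (r ^ 2) + dl).
{ unfold dl; rewrite RtoC_plus, RtoC_minus, RtoC_div, RtoC_mult by lra; ring. }
(* all second-order terms have cancelled; every summand is now of third order *)
assert (E : hecke_rem s w = P * (/ w ^ 2 * / (w + 1) + s * x / RtoC (r ^ 2) * (/ w * / (w + 1)) + dl * / (w + 1))).
{ unfold hecke_rem; rewrite HB; unfold primitive, eis; rewrite Hrho, RtoC_mult, Hrho2; fold r; fold P.
  rewrite Hcx, Hcc; field; auto. }
rewrite E, Cmod_mult, Cmod_R, (Rabs_pos_eq P) by lra.
assert (Hi1 : (Cmod (/ (w + 1)) <= 2 / r)%R).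
{ rewrite Cmod_inv by exact Hw1; replace (2 / r)%R with (/ (r / 2))%R by (field; lra).
  apply Rinv_le_contravar; lra. }
assert (Hi0 := Cmod_ge_0 (/ (w + 1))).
set (B := (/ w ^ 2 * / (w + 1) + s * x / RtoC (r ^ 2) * (/ w * / (w + 1)) + dl * / (w + 1))).
assert (HBd : (Cmod B <= 1000 * / r ^ 3)%R).
{ unfold B; eapply Rle_trans; [apply Cmod_triangle |].
  assert (T1 : (Cmod (/ w ^ 2 * / (w + 1) + s * x / RtoC (r ^ 2) * (/ w * / (w + 1))) <= 4 * / r ^ 3)%R).
  { eapply Rle_trans; [apply Cmod_triangle |]; rewrite !Cmod_mult, Cmod_inv_pow by exact Hw0; fold r.
    unfold Cdiv; rewrite !Cmod_mult, (Cmod_inv w Hw0), (Cmod_inv (RtoC (r ^ 2))) by (apply RtoC_neq_0; lra).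
    fold r; rewrite !Cmod_R.
    rewrite (Rabs_pos_eq (r ^ 2)), (Rabs_pos_eq s) by lra.
    assert (Q1 : (/ r ^ 2 * Cmod (/ (w + 1)) <= / r ^ 2 * (2 / r))%R)
      by (apply Rmult_le_compat_l; [left; now apply Rinv_0_lt_compat | exact Hi1]).
    assert (Q2 : (s * Rabs x * / r ^ 2 * (/ r * Cmod (/ (w + 1))) <= r * / r ^ 2 * (/ r * (2 / r)))%R).
    { assert (Hir : (0 < / r)%R) by (apply Rinv_0_lt_compat; lra).
      assert (Hir2 : (0 < / r ^ 2)%R) by (now apply Rinv_0_lt_compat).
      assert (Hax := Rabs_pos x).
      apply Rmult_le_compat.
      - repeat apply Rmult_le_pos; lra.
      - apply Rmult_le_pos; lra.
      - apply Rmult_le_compat_r; [lra |]. assert (s * Rabs x <= 1 * r)%R by (apply Rmult_le_compat; lra); lra.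
      - apply Rmult_le_compat_l; lra. }
    replace (4 * / r ^ 3)%R with (/ r ^ 2 * (2 / r) + r * / r ^ 2 * (/ r * (2 / r)))%R by (field; lra).
    lra. }
  assert (T2 : (Cmod (dl * / (w + 1)) <= 722 * / r ^ 3)%R).
  { rewrite Cmod_mult, Cmod_R.
    apply Rle_trans with (361 / r ^ 2 * (2 / r))%R; [apply Rmult_le_compat; auto; apply Rabs_pos |].
    right; field; lra. }
  assert (0 < / r ^ 3)%R by (apply Rinv_0_lt_compat, pow_lt; lra); lra. }
assert (HB0 := Cmod_ge_0 B).
assert (P * Cmod B <= 1 * Cmod B)%R by (apply Rmult_le_compat_r; lra); lra.
Qed.

Definition row_pos (mn : Z * Z) : Prop := (1 <= fst mn)%Z.

Lemma row_pos_nonzero (mn : Z * Z) : row_pos mn -> nonzero mn.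
Proof. unfold row_pos, nonzero; intros H E; subst; simpl in H; lia. Qed.

Lemma lat_plus_1 (tau : C) (m n : Z) : lat tau (m, n) + 1 = lat tau (m, (n + 1)%Z).
Proof. unfold lat; simpl; rewrite plus_IZR, RtoC_plus; ring. Qed.

Lemma primitive_row_tends (tau : C) (s : R) (m : Z) (g : nat -> Z) : (0 < Im tau)%R -> (0 <= s)%R -> (1 <= m)%Z ->
  (forall n, Rabs (IZR (g n)) = INR n) ->
  tends eventually (fun n => primitive s (lat tau (m, g n))) 0.
Proof.
intros Ht Hs Hm Hg eps Heps; destruct (lat_ge tau Ht) as [c [Hc H]].
set (K := Rpower (Im tau) (- s)); assert (HK : (0 < K)%R) by apply Rpower_gt_0.
generalize (eventually_INR (K / (c * eps))); apply filter_imp; intros n Hn.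
assert (Hnz : nonzero (m, g n)) by (apply row_pos_nonzero; exact Hm).
destruct (H _ Hnz) as [_ H2]; simpl in H2; rewrite Hg in H2.
assert (Hw := lat_pos tau _ Ht Hnz); set (w := lat tau (m, g n)) in *.
replace (primitive s w - 0) with (primitive s w) by ring; unfold primitive.
rewrite Cmod_mult, Cmod_R, Cmod_inv, Rabs_pos_eq by (try (now apply Cmod_gt_0); left; apply Rpower_gt_0).
assert (HY : (Im tau <= Cmod w)%R).
{ assert (H3 := im_le_Cmod w); unfold w in H3; rewrite lat_im in H3; simpl in H3; fold w in H3.
  assert (1 <= IZR m)%R by (now apply IZR_le).
  rewrite Rabs_pos_eq in H3 by nra; nra. }
assert (HP : (Rpower (Cmod w) (- s) <= K)%R) by (apply Rpower_neg_le; lra).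
apply Rle_lt_trans with (/ Cmod w * K)%R; [apply Rmult_le_compat_l; [left; now apply Rinv_0_lt_compat | exact HP] |].
apply Rmult_lt_reg_l with (Cmod w); [exact Hw |]; rewrite <- Rmult_assoc, Rinv_r, Rmult_1_l by lra.
assert (Hce : (0 < c * eps)%R) by (now apply Rmult_lt_0_compat).
apply Rlt_le_trans with (c * INR n * eps)%R.
- apply (Rmult_lt_compat_r (c * eps)) in Hn; [| exact Hce].
  unfold Rdiv in Hn; rewrite Rmult_assoc, Rinv_l in Hn by lra; lra.
- apply Rmult_le_compat_r; nra.
Qed.

Lemma primitive_row_sum (tau : C) (s : R) (m : Z) (p : C) : (0 < Im tau)%R -> (0 <= s)%R -> (1 <= m)%Z ->
  has_sum (fun _ => True) (fun n => primitive s (lat tau (m, n) + 1) - primitive s (lat tau (m, n))) p -> p = 0.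
Proof.
intros Ht Hs Hm Hp.
rewrite (telescoping_Z (fun n => primitive s (lat tau (m, n))) 0 0 p); [ring | | |].
- apply (primitive_row_tends tau s m Z.of_nat); trivial; intros n.
  rewrite <- INR_IZR_INZ; apply Rabs_pos_eq, pos_INR.
- apply (primitive_row_tends tau s m (fun n => - Z.of_nat n)%Z); trivial; intros n.
  rewrite opp_IZR, Rabs_Ropp, <- INR_IZR_INZ; apply Rabs_pos_eq, pos_INR.
- revert Hp; apply conv_ext; intros n _; now rewrite lat_plus_1.
Qed.

Lemma Cmod_eis (s : R) (w : C) : w <> 0 -> Cmod (eis s w) = Rpower (Cmod w) (- (2 + s)).
Proof.
intros Hw; assert (H := proj1 (Cmod_gt_0 w) Hw).
unfold eis; rewrite Cmod_mult, Cmod_inv_pow, Cmod_R, Rabs_pos_eq by (trivial; left; apply Rpower_gt_0).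
rewrite Ropp_plus_distr, Rpower_plus; f_equal; symmetry; apply (Rpower_neg_pow (Cmod w) 2 H).
Qed.

Lemma Cmod_epstein (s : R) (w : C) : Cmod (epstein s w) = Rpower (Cmod w) (- (2 + s)).
Proof. unfold epstein; rewrite Cmod_R; apply Rabs_pos_eq; left; apply Rpower_gt_0. Qed.

Lemma eis_lattice_sum (tau : C) (s : R) (A : Z * Z -> Prop) : (0 < Im tau)%R -> (0 < s)%R ->
  (forall x, A x -> nonzero x) ->
  exists p, has_sum A (fun mn => eis s (lat tau mn)) p.
Proof.
intros Ht Hs HA; apply (has_sum_exists _ _ (fun mn => Rpower (Cmod (lat tau mn)) (- (2 + s)))).
- apply (summable_sub nonzero); [exact HA |]; apply summable_lattice; lra.
- intros mn H; right; apply Cmod_eis, lat_neq_0; auto.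
Qed.

Lemma epstein_lattice_sum (tau : C) (s : R) : (0 < Im tau)%R -> (0 < s)%R ->
  exists p, has_sum row_pos (fun mn => epstein s (lat tau mn)) p.
Proof.
intros Ht Hs; apply (has_sum_exists _ _ (fun mn => Rpower (Cmod (lat tau mn)) (- (2 + s)))).
- apply (summable_sub nonzero); [exact row_pos_nonzero |]; apply summable_lattice; lra.
- intros mn H; right; apply Cmod_epstein.
Qed.

Lemma hecke_rem_bound_lat (tau : C) : (0 < Im tau)%R ->
  exists E : list (Z * Z), forall s mn, (0 <= s <= 1)%R -> row_pos mn -> ~ In mn E ->
  (Cmod (hecke_rem s (lat tau mn)) <= 1000 * / Cmod (lat tau mn) ^ 3)%R.
Proof.
intros Ht; destruct (lat_finite tau 4 Ht) as [E HE]; exists E; intros s mn Hs Hmn Hn.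
apply hecke_rem_bound; [exact Hs |]; apply Rnot_lt_le; intros H; apply Hn, HE; lra.
Qed.

Lemma summable_cube (tau : C) : (0 < Im tau)%R ->
  summable row_pos (fun mn => 1000 * / Cmod (lat tau mn) ^ 3)%R.
Proof.
intros Ht; apply summable_scal; [lra |]; apply (summable_sub nonzero); [exact row_pos_nonzero |].
now apply summable_lattice_pow.
Qed.

Lemma hecke_rem_abs (tau : C) (s : R) : (0 < Im tau)%R -> (0 <= s <= 1)%R ->
  summable row_pos (fun mn => Cmod (hecke_rem s (lat tau mn))).
Proof.
intros Ht Hs; destruct (hecke_rem_bound_lat tau Ht) as [E HE].
apply (summable_finite_exception _ E); [intros; apply Cmod_ge_0 |].
apply (summable_le _ (fun mn => 1000 * / Cmod (lat tau mn) ^ 3)%R).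
- intros mn [H1 H2]; split; [apply Cmod_ge_0 | now apply HE].
- apply (summable_sub row_pos); [tauto | now apply summable_cube].
Qed.

Lemma hecke_rem_sum (tau : C) (s : R) : (0 < Im tau)%R -> (0 <= s <= 1)%R ->
  exists p, has_sum row_pos (fun mn => hecke_rem s (lat tau mn)) p.
Proof.
intros Ht Hs; apply (has_sum_exists _ _ _ (hecke_rem_abs tau s Ht Hs)); intros; apply Rle_refl.
Qed.

Lemma hecke_rem_row_sum (tau : C) (s : R) (m : Z) : (0 < Im tau)%R -> (0 <= s <= 1)%R -> (1 <= m)%Z ->
  exists p, has_sum (fun _ => True) (fun n => hecke_rem s (lat tau (m, n))) p.
Proof.
intros Ht Hs Hm; apply (has_sum_exists _ _ (fun n => Cmod (hecke_rem s (lat tau (m, n))))); [| intros; apply Rle_refl].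
apply (summable_inj (fun _ : Z => True) row_pos (fun n => (m, n)) (fun mn => Cmod (hecke_rem s (lat tau mn)))).
- intros; exact Hm.
- intros x y _ _ H; now injection H.
- now apply hecke_rem_abs.
Qed.

Lemma conv_row_pos {op e} `{CMonoid op e} (f : Z * Z -> C) (g : Z -> C) (p : C) :
  (forall m, (1 <= m)%Z -> conv op e (fun _ => True) (fun n => f (m, n)) (g m)) ->
  conv op e row_pos f p -> conv op e (fun m => 1 <= m)%Z g p.
Proof.
intros Hg Hp; apply (conv_fst (fun m => 1 <= m)%Z (fun _ => True) f g p Hg).
revert Hp; apply conv_iff; unfold row_pos; tauto.
Qed.

(** The differences of [primitive s] telescope to 0 along each row, and the double sum converges
    absolutely for positive [s], so that it may be evaluated row by row. *)
Lemma hecke_identity (tau : C) (s : R) (K N D : C) : (0 < Im tau)%R -> (0 < s <= 1)%R ->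
  has_sum row_pos (fun mn => eis s (lat tau mn)) K ->
  has_sum row_pos (fun mn => epstein s (lat tau mn)) N ->
  has_sum row_pos (fun mn => hecke_rem s (lat tau mn)) D ->
  D = (1 + s / 2) * K + s / 2 * N.
Proof.
intros Ht Hs HK HN HD.
assert (HX := conv_op _ _ _ _ _ (has_sum_scal _ _ _ (1 + s / 2) HK) (has_sum_scal _ _ _ (s / 2) HN)).
assert (HT := has_sum_minus _ _ _ _ _ HD HX); cbv beta in HT.
set (T := D - _) in HT.
assert (HT0 : has_sum row_pos (fun mn => primitive s (lat tau mn + 1) - primitive s (lat tau mn)) T).
{ revert HT; apply conv_ext; intros mn _; unfold hecke_rem; ring. }
assert (E : T = 0).
{ apply (conv_unique (op := Cplus) (e := RtoC 0) (fun m => 1 <= m)%Z (fun _ => RtoC 0)); [| apply conv_unit].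
  apply (conv_row_pos _ _ _) with (2 := HT0); intros m Hm.
  assert (Hrow : forall f : C -> C, (forall w : C, w <> RtoC 0 -> Cmod (f w) <= Rpower (Cmod w) (- (2 + s)))%R ->
    exists q, has_sum (fun _ => True) (fun n => f (lat tau (m, n))) q).
  { intros f Hf; apply (has_sum_exists _ _ _ (summable_row tau (2 + s) m Ht ltac:(lra) Hm)).
    intros n _; apply Hf, lat_neq_0; [exact Ht | now apply row_pos_nonzero]. }
  destruct (Hrow (eis s)) as [q1 Hq1]; [intros; right; now apply Cmod_eis |].
  destruct (Hrow (epstein s)) as [q2 Hq2]; [intros; right; apply Cmod_epstein |].
  destruct (hecke_rem_row_sum tau s m Ht ltac:(lra) Hm) as [q3 Hq3].
  assert (Hq := has_sum_minus _ _ _ _ _ Hq3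
    (conv_op _ _ _ _ _ (has_sum_scal _ _ _ (1 + s / 2) Hq1) (has_sum_scal _ _ _ (s / 2) Hq2))).
  cbv beta in Hq; set (q := q3 - _) in Hq.
  assert (Hq' : has_sum (fun _ => True) (fun n => primitive s (lat tau (m, n) + 1) - primitive s (lat tau (m, n))) q).
  { revert Hq; apply conv_ext; intros n _; unfold hecke_rem; ring. }
  rewrite (primitive_row_sum tau s m q Ht ltac:(lra) Hm Hq') in Hq'; exact Hq'. }
unfold T in E; replace D with (D - ((1 + s / 2) * K + s / 2 * N) + ((1 + s / 2) * K + s / 2 * N)) by ring.
rewrite E; ring.
Qed.

Lemma eis_tends (w : C) : tends (at_right 0) (fun s => eis s w) (/ w ^ 2).
Proof.
unfold eis; rewrite <- (Cmult_1_r (/ w ^ 2)) at 1.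
lim.
Qed.

Lemma primitive_tends (w : C) : tends (at_right 0) (fun s => primitive s w) (/ w).
Proof.
unfold primitive; rewrite <- (Cmult_1_r (/ w)) at 1.
lim.
Qed.

#[local] Hint Resolve eis_tends primitive_tends : limits.

Lemma Rpower_0_r (a : R) : Rpower a (- 0) = 1%R.
Proof. unfold Rpower; now rewrite Ropp_0, Rmult_0_l, exp_0. Qed.

Lemma hecke_rem_tends (w : C) : tends (at_right 0) (fun s => hecke_rem s w) (hecke_rem 0 w).
Proof.
assert (E : hecke_rem 0 w = (1 + 0 / 2) * / w ^ 2 + 0 / 2 * epstein 0 w + (/ (w + 1) - / w)).
{ unfold hecke_rem, eis, primitive; rewrite !Rpower_0_r, !Cmult_1_r; reflexivity. }
rewrite E; unfold hecke_rem.
lim.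
apply (tends_at_right_0 (fun s => Rpower (Cmod w) (- (2 + s)))); unfold Rpower; auto_derive; trivial.
Qed.

Lemma hecke_rem_sum_tends (tau : C) (D : R -> C) (D0 : C) : (0 < Im tau)%R ->
  (forall s, (0 < s <= 1)%R -> has_sum row_pos (fun mn => hecke_rem s (lat tau mn)) (D s)) ->
  has_sum row_pos (fun mn => hecke_rem 0 (lat tau mn)) D0 ->
  tends (at_right 0) D D0.
Proof.
intros Ht HD HD0; destruct (hecke_rem_bound_lat tau Ht) as [E HE].
apply (conv_dominated_except (op := Cplus) (at_right 0) row_pos E (fun mn => 1000 * / Cmod (lat tau mn) ^ 3)%R
  (fun s mn => hecke_rem s (lat tau mn)) (fun mn => hecke_rem 0 (lat tau mn))).
- now apply summable_cube.
- apply (at_right_0 _ 1); [lra |]; intros s Hs mn Hmn Hn.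
  replace (hecke_rem s (lat tau mn) - 0) with (hecke_rem s (lat tau mn)) by ring; apply HE; trivial; lra.
- intros mn _; apply hecke_rem_tends.
- apply (at_right_0 _ 1); [lra |]; intros s Hs; apply HD; lra.
- exact HD0.
Qed.

(** * The residue of the Epstein zeta function *)

(** By [atan u = pi / 2 - atan (1 / u)] and the mean value theorem. *)
Lemma atan_pos_bound (u : R) : (0 < u)%R -> (Rabs (atan u - PI / 2) <= / u)%R.
Proof.
intros Hu; assert (Hi : (0 < / u)%R) by (now apply Rinv_0_lt_compat).
replace (atan u - PI / 2)%R with (- atan (/ u))%R by (rewrite atan_inv by exact Hu; ring).
rewrite Rabs_Ropp.
destruct (MVT_gen atan 0 (/ u) (fun t => / (1 + t ^ 2))%R) as [c [_ E]].
- intros t _; apply is_derive_Reals, derivable_pt_lim_atan.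
- intros t _; apply derivable_continuous_pt; eexists; apply derivable_pt_lim_atan.
- rewrite atan_0, !Rminus_0_r in E; rewrite E.
  assert (H : (0 < / (1 + c ^ 2) <= 1)%R).
  { assert (Hc := pow2_ge_0 c); split; [apply Rinv_0_lt_compat; lra |].
    apply Rle_trans with (/ 1)%R; [apply Rinv_le_contravar; lra | rewrite Rinv_1; lra]. }
  rewrite Rabs_pos_eq by nra; nra.
Qed.

Lemma atan_row_tends (b Y : R) : (0 < Y)%R ->
  tends eventually (fun n => RtoC (atan ((b + INR n) / Y))) (RtoC (PI / 2)).
Proof.
intros HY eps Heps.
assert (Hye : (0 < Y / eps)%R) by (now apply Rdiv_lt_0_compat).
generalize (eventually_INR (Rabs b + Y / eps)); apply filter_imp; intros n Hn.
assert (Hb := Rle_abs (- b)); rewrite Rabs_Ropp in Hb.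
assert (Hu : (/ eps < (b + INR n) / Y)%R).
{ apply Rlt_div_r; [exact HY |]; unfold Rdiv in *; lra. }
assert (He : (0 < / eps)%R) by (now apply Rinv_0_lt_compat).
rewrite <- RtoC_minus, Cmod_R.
eapply Rle_lt_trans; [apply atan_pos_bound; lra |].
rewrite <- (Rinv_inv eps); apply Rinv_lt_contravar; [| exact Hu].
apply Rmult_lt_0_compat; lra.
Qed.

(** By the mean value theorem [d] is [1 / (xi^2 + Y^2)] for some [xi] between [x] and [x + 1],
    and [|xi + i Y|] is comparable to [|w|] because [Y] is bounded below. *)
Lemma atan_difference (y x Y : R) (w : C) : (0 < y <= Y)%R -> w = (x, Y) ->
  let d := ((atan ((x + 1) / Y) - atan (x / Y)) / Y)%R in
  (Rabs (/ Cmod w ^ 2 - d) <= 2 * (1 + / y) ^ 2 * / Cmod w ^ 3 /\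
   0 <= d <= (1 + / y) ^ 2 * / Cmod w ^ 2)%R.
Proof.
intros Hy Ew d; set (lam := (1 + / y)%R).
assert (Hlam : (1 <= lam)%R) by (assert (H : (0 < / y)%R) by (apply Rinv_0_lt_compat; lra); unfold lam; lra).
destruct (MVT_gen (fun t => atan (t / Y) / Y)%R x (x + 1) (fun t => / (t ^ 2 + Y ^ 2))%R) as [xi [Hxi E]].
- intros t _; auto_derive; [trivial |]; unfold Rsqr; field; repeat split; nra.
- intros t _; apply derivable_continuous_pt; exists (/ (t ^ 2 + Y ^ 2))%R.
  apply is_derive_Reals; auto_derive; [trivial |]; unfold Rsqr; field; repeat split; nra.
- rewrite Rmin_left, Rmax_right in Hxi by lra.
  replace (x + 1 - x)%R with 1%R in E by ring; rewrite Rmult_1_r in E.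
  assert (Ed : d = (/ (xi ^ 2 + Y ^ 2))%R) by (rewrite <- E; unfold d; field; lra).
  set (v := (xi, Y) : C); set (r := Cmod w); set (q := Cmod v).
  assert (Hq2 : (q ^ 2 = xi ^ 2 + Y ^ 2)%R) by (unfold q; rewrite Cmod2_alt; reflexivity).
  assert (Hr2 : (r ^ 2 = x ^ 2 + Y ^ 2)%R) by (unfold r; rewrite Cmod2_alt, Ew; reflexivity).
  assert (HqY : (Y <= q)%R) by (assert (H := im_le_Cmod v); simpl in H; rewrite Rabs_pos_eq in H by lra; exact H).
  assert (HrY : (Y <= r)%R) by (assert (H := im_le_Cmod w); rewrite Ew in H at 1; simpl in H; rewrite Rabs_pos_eq in H by lra; exact H).
  assert (Hrq : (r <= q + 1)%R).
  { assert (T := Cmod_triangle_inv w v); replace (w - v) with (RtoC (x - xi)) in T.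
    - rewrite Cmod_R in T; assert (Rabs (x - xi) <= 1)%R by (apply Rabs_le; lra); unfold r, q; lra.
    - rewrite Ew; unfold v; apply injective_projections; simpl; ring. }
  assert (Hqr : (/ q <= lam * / r)%R).
  { apply Rmult_le_reg_l with q; [lra |]; rewrite Rinv_r by lra.
    apply Rmult_le_reg_r with r; [lra |].
    replace (q * (lam * / r) * r)%R with (q * lam)%R by (field; lra).
    assert (1 <= q * / y)%R by (apply Rmult_le_reg_r with y; [lra |]; rewrite Rmult_assoc, Rinv_l by lra; lra).
    unfold lam; lra. }
  assert (Hiq : (0 < / q)%R) by (apply Rinv_0_lt_compat; lra).
  assert (Hir : (0 < / r)%R) by (apply Rinv_0_lt_compat; lra).
  rewrite Ed, <- Hq2; rewrite <- !pow_inv.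
  assert (Hsq : (/ q ^ 1 * / q ^ 1 <= lam * / r * (lam * / r))%R) by (rewrite pow_1; apply Rmult_le_compat; lra).
  rewrite pow_1 in Hsq.
  assert (Hax : (Rabs x <= r)%R) by (assert (H := re_le_Cmod w); rewrite Ew in H at 1; exact H).
  assert (Haxi : (Rabs xi <= q)%R) by (exact (re_le_Cmod v)).
  split; [| split].
  + replace ((/ r) ^ 2 - (/ q) ^ 2)%R with ((xi - x) * (xi + x) * ((/ r) ^ 2 * (/ q) ^ 2))%R.
    2:{ replace ((xi - x) * (xi + x))%R with (q ^ 2 - r ^ 2)%R by (rewrite Hq2, Hr2; ring). field; lra. }
    rewrite !Rabs_mult, (Rabs_pos_eq (_ ^ 2)), (Rabs_pos_eq (_ ^ 2)) by apply pow2_ge_0.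
    assert (H1 : (Rabs (xi - x) <= 1)%R) by (apply Rabs_le; lra).
    assert (H2 : (Rabs (xi + x) <= q + r)%R) by (eapply Rle_trans; [apply Rabs_triang |]; lra).
    assert (H3 : (0 <= (/ r) ^ 2 * (/ q) ^ 2)%R) by (apply Rmult_le_pos; apply pow2_ge_0).
    apply Rle_trans with (1 * (q + r) * ((/ r) ^ 2 * (/ q) ^ 2))%R.
    { apply Rmult_le_compat_r; [exact H3 |]; apply Rmult_le_compat; trivial; apply Rabs_pos. }
    replace (1 * (q + r) * ((/ r) ^ 2 * (/ q) ^ 2))%R with ((/ r) ^ 2 * / q + / r * (/ q * / q))%R by (field; lra).
    assert (H4 : ((/ r) ^ 2 * / q <= (/ r) ^ 2 * (lam * / r))%R) by (apply Rmult_le_compat_l; [apply pow2_ge_0 | exact Hqr]).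
    assert (H5 : (/ r * (/ q * / q) <= / r * (lam * / r * (lam * / r)))%R) by (apply Rmult_le_compat_l; lra).
    assert (H6 : (lam * (/ r) ^ 3 <= lam ^ 2 * (/ r) ^ 3)%R).
    { apply Rmult_le_compat_r; [left; now apply pow_lt |]; nra. }
    replace (2 * lam ^ 2 * (/ r) ^ 3)%R with (lam ^ 2 * (/ r) ^ 3 + lam ^ 2 * (/ r) ^ 3)%R by ring.
    replace ((/ r) ^ 2 * (lam * / r))%R with (lam * (/ r) ^ 3)%R in H4 by ring.
    replace (/ r * (lam * / r * (lam * / r)))%R with (lam ^ 2 * (/ r) ^ 3)%R in H5 by ring.
    lra.
  + apply pow2_ge_0.
  + replace ((/ q) ^ 2)%R with (/ q * / q)%R by ring.
    replace (lam ^ 2 * (/ r) ^ 2)%R with (lam * / r * (lam * / r))%R by ring; exact Hsq.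
Qed.

(** From [1 - v^(-s) <= s ln v] and [ln v <= 2 v^(1/2)], with [v = r / Y]. *)
Lemma Rpower_log_diff (s Y r : R) : (0 <= s)%R -> (0 < Y <= r)%R ->
  (0 <= Rpower Y (- s) - Rpower r (- s) <=
    2 * s * Rpower Y (- s) * (Rpower Y (- (1 / 2)) * Rpower r (1 / 2)))%R.
Proof.
intros Hs HY; set (v := (r / Y)%R).
assert (Hv : (1 <= v)%R) by (unfold v; apply Rle_div_r; lra).
assert (Er : r = (Y * v)%R) by (unfold v; field; lra).
assert (E1 : Rpower r (- s) = (Rpower Y (- s) * Rpower v (- s))%R) by (rewrite Er, Rpower_mult_distr by lra; reflexivity).
assert (E2 : (Rpower Y (- (1 / 2)) * Rpower r (1 / 2))%R = Rpower v (1 / 2)).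
{ rewrite Er, <- Rpower_mult_distr by lra; rewrite <- Rmult_assoc, <- Rpower_plus.
  replace (- (1 / 2) + 1 / 2)%R with 0%R by ring; rewrite Rpower_O by lra; ring. }
rewrite E2, E1.
assert (HP := Rpower_gt_0 Y (- s)).
assert (Hl : (0 <= ln v <= 2 * Rpower v (1 / 2))%R).
{ split; [rewrite <- ln_1; apply Rcomplements.ln_le; lra |].
  unfold Rpower; assert (H := exp_ge_1p (1 / 2 * ln v)); lra. }
assert (H1 : (1 - s * ln v <= Rpower v (- s))%R).
{ unfold Rpower; assert (H := exp_ge_1p (- s * ln v)); lra. }
assert (H2 : (Rpower v (- s) <= 1)%R) by (rewrite <- (Rpower_1_l (- s)); apply Rpower_neg_le; lra).
replace (Rpower Y (- s) - Rpower Y (- s) * Rpower v (- s))%R with (Rpower Y (- s) * (1 - Rpower v (- s)))%R by ring.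
split; [apply Rmult_le_pos; lra |].
replace (2 * s * Rpower Y (- s) * Rpower v (1 / 2))%R with (Rpower Y (- s) * (s * (2 * Rpower v (1 / 2))))%R by ring.
apply Rmult_le_compat_l; [lra |].
assert (s * ln v <= s * (2 * Rpower v (1 / 2)))%R by (apply Rmult_le_compat_l; lra); lra.
Qed.

(** Replacing [|w|^(-s)] by [Y^(-s)] costs at most half a power of [|w| / Y], because the logarithm
    comes with a factor [s]; the remaining sum of [Y^(-s) |w|^(-2)] is compared with the
    telescoping sum of arctangents, whose total variation is [pi]. *)
Lemma epstein_row (tau : C) : (0 < Im tau)%R -> exists K, (0 <= K)%R /\
  forall s m a, (0 < s <= 1)%R -> (1 <= m)%Z ->
  has_sum (fun _ => True) (fun n => epstein s (lat tau (m, n))) a ->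
  (Cmod (a - PI * Rpower (IZR m * Im tau) (- (1 + s))) <=
    K * (s * Rpower (IZR m * Im tau) (- (1 + s)) + Rpower (IZR m * Im tau) (- (2 + s))))%R.
Proof.
intros Ht; set (y := Im tau) in *.
destruct (row_sum_bound tau (1 / 2) Ht ltac:(lra)) as [K1 [HK1 B1]].
destruct (row_sum_bound tau 2 Ht ltac:(lra)) as [K2 [HK2 B2]].
fold y in B1, B2.
set (lam := (1 + / y)%R).
assert (Hiy : (0 < / y)%R) by (now apply Rinv_0_lt_compat).
set (Ka := (2 * lam ^ 2)%R).
assert (HKa : (0 <= Ka)%R) by (unfold Ka; assert (H := pow2_ge_0 lam); lra).
assert (Hlam : (1 <= lam)%R) by (unfold lam; lra).
assert (HKK : (0 <= Ka * K2)%R) by (apply Rmult_le_pos; lra).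
exists (2 * K1 + Ka * K2)%R; split; [lra |].
intros s m a Hs Hm Ha; set (Y := (IZR m * y)%R).
assert (Hm1 : (1 <= IZR m)%R) by (now apply IZR_le).
assert (HY : (y <= Y)%R) by (unfold Y; nra).
set (x := fun n : Z => (IZR m * Re tau + IZR n)%R).
set (d := fun n => ((atan ((x n + 1) / Y) - atan (x n / Y)) / Y)%R).
assert (Hw : forall n, lat tau (m, n) = (x n, Y)).
{ intros n; apply Ceq_components; [rewrite lat_re | rewrite lat_im]; reflexivity. }
assert (Hr : forall n, (Y <= Cmod (lat tau (m, n)))%R).
{ intros n; assert (H := im_le_Cmod (lat tau (m, n))); rewrite lat_im in H; simpl in H; fold y in H; fold Y in H.
  rewrite Rabs_pos_eq in H by lra; exact H. }
assert (Hd := fun n => atan_difference y (x n) Y (lat tau (m, n)) ltac:(lra) (Hw n)).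
cbv zeta in Hd; fold lam in Hd.
assert (Hp2 : forall n k, (/ Cmod (lat tau (m, n)) ^ k)%R = Rpower (Cmod (lat tau (m, n))) (- INR k)).
{ intros n k; rewrite Rpower_neg_pow; [reflexivity |]; specialize (Hr n); lra. }
(* the arctangents run from [- pi / 2] to [pi / 2] *)
assert (Sd : has_sum (fun _ => True) (fun n => RtoC (d n)) (PI / Y)).
{ destruct (has_sum_exists (fun _ : Z => True) (fun n => RtoC (d n))
    (fun n => lam ^ 2 * Rpower (Cmod (lat tau (m, n))) (- (2)))%R) as [p Hp].
  - apply summable_scal; [apply pow2_ge_0 | apply summable_row; trivial; lra].
  - intros n _; rewrite Cmod_R; destruct (Hd n) as [_ H]; fold (d n) in H.
    rewrite (Hp2 n 2%nat) in H; rewrite Rabs_pos_eq by apply H; apply H.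
  - replace (PI / Y) with p; [exact Hp |].
    assert (T0 : RtoC 2 <> 0) by (apply RtoC_neq_0; lra).
    assert (TY : RtoC Y <> 0) by (apply RtoC_neq_0; lra).
    rewrite (telescoping_Z (fun n => RtoC (atan (x n / Y)) / Y) (PI / 2 / Y) (- (PI / 2) / Y) p).
    + field; auto.
    + apply tends_mult; lim.
      rewrite <- RtoC_div by lra.
      apply (tends_ext _ (fun n => RtoC (atan ((IZR m * Re tau + INR n) / Y)))); [| apply atan_row_tends; lra].
      intros n; unfold x; now rewrite <- INR_IZR_INZ.
    + apply tends_mult; lim.
      rewrite <- RtoC_div by lra.
      apply (tends_ext _ (fun n => - RtoC (atan ((- (IZR m * Re tau) + INR n) / Y)))).
      * intros n; unfold x; rewrite <- RtoC_opp, <- atan_opp, opp_IZR, <- INR_IZR_INZ; do 2 f_equal; field; lra.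
      * apply tends_opp; [lim | apply atan_row_tends; lra].
    + revert Hp; apply conv_ext; intros n _; unfold d, x; rewrite plus_IZR.
      rewrite RtoC_div, RtoC_minus by lra; rewrite <- Rplus_assoc; field; exact TY. }
assert (Hdiff := has_sum_minus _ _ _ _ _ Ha (has_sum_scal _ _ _ (Rpower Y (- s)) Sd)); cbv beta in Hdiff.
assert (EY : RtoC (Rpower Y (- s)) * (PI / Y) = PI * RtoC (Rpower Y (- (1 + s)))).
{ rewrite Ropp_plus_distr, Rpower_plus, (Rpower_Ropp Y 1), Rpower_1 by lra.
  rewrite RtoC_mult, RtoC_inv by lra; unfold Cdiv; ring. }
rewrite EY in Hdiff.
set (P := Rpower Y (- s)) in *; assert (HP : (0 < P)%R) by apply Rpower_gt_0.
set (Ym := Rpower Y (- (1 / 2))) in *; assert (HYm : (0 < Ym)%R) by apply Rpower_gt_0.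
apply Rle_trans with (2 * s * P * Ym * (K1 * Ym) + P * Ka * (K2 * Rpower Y (- (2))))%R.
- revert Hdiff; apply (has_sum_bound _ _ (fun n => 2 * s * P * Ym * Rpower (Cmod (lat tau (m, n))) (- (1 + 1 / 2)) +
    P * Ka * Rpower (Cmod (lat tau (m, n))) (- (1 + 2)))%R).
  + intros n _; set (r := Cmod (lat tau (m, n))).
    assert (Hrn : (Y <= r)%R) by apply Hr.
    destruct (Rpower_log_diff s Y r ltac:(lra) ltac:(lra)) as [L1 L2]; fold P Ym in L1, L2.
    destruct (Hd n) as [D1 _]; fold (d n) in D1; fold r in D1.
    assert (Hr2 : (0 < / r ^ 2)%R) by (apply Rinv_0_lt_compat, pow_lt; lra).
    assert (E : epstein s (lat tau (m, n)) = RtoC (Rpower r (- s) * / r ^ 2)).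
    { unfold epstein; fold r; f_equal; rewrite Ropp_plus_distr, Rpower_plus, Rmult_comm; f_equal.
      apply (Rpower_neg_pow r 2); lra. }
    rewrite E, <- RtoC_mult, <- RtoC_minus, Cmod_R.
    replace (Rpower r (- s) * / r ^ 2 - P * d n)%R with
      (- ((P - Rpower r (- s)) * / r ^ 2) + P * (/ r ^ 2 - d n))%R by ring.
    eapply Rle_trans; [apply Rabs_triang |]; rewrite Rabs_Ropp, !Rabs_mult.
    rewrite (Rabs_pos_eq (P - Rpower r (- s))), (Rabs_pos_eq (/ r ^ 2)), (Rabs_pos_eq P) by lra.
    apply Rplus_le_compat.
    * replace (Rpower r (- (1 + 1 / 2))) with (Rpower r (1 / 2) * / r ^ 2)%R.
      2:{ replace (- (1 + 1 / 2))%R with (1 / 2 + - (2))%R by field; rewrite Rpower_plus; f_equal.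
          symmetry; apply (Rpower_neg_pow r 2); lra. }
      rewrite <- Rmult_assoc; apply Rmult_le_compat_r; lra.
    * rewrite Rmult_assoc; apply Rmult_le_compat_l; [lra |].
      replace (- (1 + 2))%R with (- INR 3)%R by (simpl; ring); rewrite Rpower_neg_pow by lra; exact D1.
  + intros l Hl _.
    rewrite rsum_plus, !rsum_scal; apply Rplus_le_compat; apply Rmult_le_compat_l; auto.
    * repeat apply Rmult_le_pos; lra.
    * apply Rmult_le_pos; lra.
- assert (E1 : Rpower Y (- (1 + s)) = (P * (Ym * Ym))%R)
    by (unfold P, Ym; rewrite <- !Rpower_plus; f_equal; field).
  assert (E2 : Rpower Y (- (2 + s)) = (P * Rpower Y (- (2)))%R)
    by (unfold P; rewrite <- Rpower_plus; f_equal; ring).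
  rewrite E1, E2; set (B := Rpower Y (- (2))); assert (HB : (0 < B)%R) by apply Rpower_gt_0.
  assert (X1 : (0 <= Ka * K2 * (s * (P * (Ym * Ym))))%R) by (repeat apply Rmult_le_pos; lra).
  assert (X2 : (0 <= K1 * (P * B))%R) by (repeat apply Rmult_le_pos; lra).
  lra.
Qed.

Lemma list_in_seq (l : list nat) : (forall x, In x l -> pos x) -> incl l (seq 1 (list_max l)).
Proof.
intros H x Hx; apply in_seq; split; [now apply H |].
assert (Hm := proj1 (list_max_le l (list_max l)) (Nat.le_refl _)).
rewrite Forall_forall in Hm; specialize (Hm x Hx); lia.
Qed.

Lemma zeta_partial (s : R) (n : nat) : (0 < s)%R ->
  (0 <= s * rsum (fun k => Rpower (INR k) (- (1 + s))) (seq 1 n) - (1 - Rpower (INR n + 1) (- s))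
    <= s * (1 - Rpower (INR n + 1) (- (1 + s))))%R.
Proof.
intros Hs; induction n as [| n IH].
- simpl; rewrite Rplus_0_l, !Rpower_1_l; lra.
- rewrite seq_S, rsum_app; cbn [rsum fold_right]; replace (1 + n)%nat with (S n) by lia.
  rewrite S_INR; assert (Hn := pos_INR n).
  destruct (zeta_diff s (INR n + 1)) as [H1 H2]; lra.
Qed.

Lemma zeta_list_bound (s : R) (l : list nat) : (0 < s)%R -> NoDup l -> (forall x, In x l -> pos x) ->
  (rsum (fun k => Rpower (INR k) (- (1 + s))) l <= 1 + / s)%R.
Proof.
intros Hs Hl HA.
apply Rle_trans with (rsum (fun k => Rpower (INR k) (- (1 + s))) (seq 1 (list_max l))).
- apply rsum_incl; [exact Hl | now apply list_in_seq | intros; left; apply Rpower_gt_0].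
- destruct (zeta_partial s (list_max l) Hs) as [_ H].
  assert (H1 := Rpower_gt_0 (INR (list_max l) + 1) (- s)).
  assert (H2 := Rpower_gt_0 (INR (list_max l) + 1) (- (1 + s))).
  apply Rmult_le_reg_l with s; [exact Hs |].
  rewrite Rmult_plus_distr_l, Rinv_r by lra; nra.
Qed.

(** The sum of [s k^(-1-s)] lies between telescoping sums of [k^(-s)]. *)
Lemma zeta_pole (s : R) (Z1 : C) : (0 < s)%R ->
  has_sum pos (fun k => RtoC (Rpower (INR k) (- (1 + s)))) Z1 -> (Cmod (s * Z1 - 1) <= s)%R.
Proof.
intros Hs HZ; apply tends_seq_of_conv in HZ.
assert (HS : forall n, big Cplus 0 (fun k => RtoC (Rpower (INR k) (- (1 + s)))) (seq 1 n) =
  RtoC (rsum (fun k => Rpower (INR k) (- (1 + s))) (seq 1 n))).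
{ intros n; induction (seq 1 n) as [| a l IH]; simpl; [reflexivity | now rewrite IH, RtoC_plus]. }
apply le_epsilon; intros eps Heps.
assert (HT : tends eventually (fun n => s * big Cplus 0 (fun k => RtoC (Rpower (INR k) (- (1 + s)))) (seq 1 n)) (s * Z1)).
{ lim. }
apply (Cmod_le_lim _ _ _ _ _ HT).
generalize (eventually_INR (Rpower eps (- / s))); apply filter_imp; intros n Hn.
rewrite HS, <- RtoC_mult, <- RtoC_minus, Cmod_R.
destruct (zeta_partial s n Hs) as [H1 H2].
assert (H3 := Rpower_gt_0 (INR n + 1) (- (1 + s))); assert (H4 := Rpower_gt_0 (INR n + 1) (- s)).
assert (H5 : (Rpower (INR n + 1) (- s) <= eps)%R).
{ apply Rle_trans with (Rpower (Rpower eps (- / s)) (- s)).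
  - apply Rpower_neg_le; [| lra]; split; [apply Rpower_gt_0 | lra].
  - rewrite Rpower_mult; replace (- / s * - s)%R with 1%R by (field; lra); rewrite Rpower_1; lra. }
apply Rabs_le; split; nra.
Qed.

Lemma conv_row_nat {op e} `{CMonoid op e} (f : Z * Z -> C) (g : nat -> C) (p : C) :
  (forall k, pos k -> conv op e (fun _ => True) (fun n => f (Z.of_nat k, n)) (g k)) ->
  conv op e row_pos f p -> conv op e pos g p.
Proof.
intros Hg Hp.
assert (H1 : conv op e (fun m => 1 <= m)%Z (fun m => g (Z.to_nat m)) p).
{ apply (conv_row_pos f); [| exact Hp]; intros m Hm.
  apply (conv_ext _ (fun n => f (Z.of_nat (Z.to_nat m), n))); [intros; now rewrite Z2Nat.id by lia |].
  apply Hg; unfold pos; lia. }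
apply (conv_ext _ (fun k => g (Z.to_nat (Z.of_nat k)))); [intros k _; now rewrite Nat2Z.id |].
apply (conv_reindex pos (fun m => 1 <= m)%Z Z.of_nat (fun m => g (Z.to_nat m)) p); trivial; unfold pos.
- intros; lia.
- intros; lia.
- intros m Hm; exists (Z.to_nat m); split; lia.
Qed.

(** The main terms of the rows add up to a multiple of [zeta (1 + s)], which contributes its pole.
    The errors of the rows have a bounded sum. *)
Lemma epstein_residue (tau : C) (N : R -> C) : (0 < Im tau)%R ->
  (forall s, (0 < s <= 1)%R -> has_sum row_pos (fun mn => epstein s (lat tau mn)) (N s)) ->
  tends (at_right 0) (fun s => s * N s) (PI / Im tau).
Proof.
intros Ht HN; destruct (epstein_row tau Ht) as [K [HK HR]]; set (y := Im tau) in *.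
assert (Hiy : (0 < / y)%R) by (now apply Rinv_0_lt_compat).
assert (HPI := PI_RGT_0).
assert (Hest : forall s, (0 < s <= 1)%R ->
  (Cmod (s * N s - PI * Rpower y (- (1 + s))) <=
    s * (K * ((1 + s) * Rpower y (- (1 + s)) + 2 * Rpower y (- (2 + s))) + PI * Rpower y (- (1 + s))))%R).
{ intros s Hs.
  destruct (has_sum_exists pos (fun k => RtoC (Rpower (INR k) (- (1 + s)))) (fun k => Rpower (INR k) (- (1 + s)))) as [Z1 HZ1].
  { apply summable_pos_power; lra. }
  { intros k _; rewrite Cmod_R, Rabs_pos_eq by (left; apply Rpower_gt_0); apply Rle_refl. }
  assert (HZ := zeta_pole s Z1 (proj1 Hs) HZ1).
  destruct (choice_on pos (fun k a => has_sum (fun _ => True) (fun n => epstein s (lat tau (Z.of_nat k, n))) a) 0)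
    as [a Ha].
  { intros k Hk; apply (has_sum_exists _ _ _ (summable_row tau (2 + s) (Z.of_nat k) Ht ltac:(lra) ltac:(unfold pos in Hk; lia))).
    intros n _; right; apply Cmod_epstein. }
  assert (HNa := conv_row_nat _ a _ Ha (HN s Hs)).
  set (q := Rpower y (- (1 + s))).
  assert (Hdiff := has_sum_minus _ _ _ _ _ HNa (has_sum_scal _ _ _ (PI * q) HZ1)); cbv beta in Hdiff.
  set (q2 := Rpower y (- (2 + s))); assert (Hq : (0 < q)%R) by apply Rpower_gt_0.
  assert (Hq2 : (0 < q2)%R) by apply Rpower_gt_0.
  assert (Hb : (Cmod (N s - PI * q * Z1) <= K * ((1 + s) * q + 2 * q2))%R).
  { revert Hdiff; apply (has_sum_bound _ _ (fun k => K *
      (s * q * Rpower (INR k) (- (1 + s)) + q2 * Rpower (INR k) (- (1 + (1 + s)))))%R).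
    - intros k Hk; assert (H1 := HR s (Z.of_nat k) (a k) Hs ltac:(unfold pos in Hk; lia) (Ha k Hk)).
      rewrite <- INR_IZR_INZ in H1; assert (Hk1 := pos_INR1 k Hk).
      rewrite <- !Rpower_mult_distr in H1 by lra; fold q q2 in H1.
      replace (1 + (1 + s))%R with (2 + s)%R by ring.
      replace (PI * q * RtoC (Rpower (INR k) (- (1 + s)))) with (PI * RtoC (Rpower (INR k) (- (1 + s)) * q))
        by (rewrite RtoC_mult; ring).
      eapply Rle_trans; [exact H1 | right; ring].
    - intros l Hl HA; rewrite rsum_scal; apply Rmult_le_compat_l; [exact HK |].
      rewrite rsum_plus, !rsum_scal.
      assert (B1 := zeta_list_bound (1 + s) l ltac:(lra) Hl HA); assert (B2 := zeta_list_bound s l (proj1 Hs) Hl HA).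
      assert (Hi : (/ (1 + s) <= 1)%R) by (rewrite <- Rinv_1; apply Rinv_le_contravar; lra).
      apply (Rmult_le_compat_l (s * q)) in B2; [| apply Rmult_le_pos; lra].
      apply (Rmult_le_compat_l q2) in B1; [| lra].
      replace (s * q * (1 + / s))%R with ((1 + s) * q)%R in B2 by (field; lra).
      assert (q2 * (1 + / (1 + s)) <= q2 * 2)%R by (apply Rmult_le_compat_l; lra); lra. }
  replace (s * N s - PI * q) with (s * (N s - PI * q * Z1) + PI * q * (s * Z1 - 1)) by ring.
  eapply Rle_trans; [apply Cmod_triangle |]; rewrite !Cmod_mult, !Cmod_R.
  rewrite (Rabs_pos_eq s), (Rabs_pos_eq PI), (Rabs_pos_eq q) by lra.
  assert (X1 := Rmult_le_compat_l s _ _ ltac:(lra) Hb).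
  assert (X2 : (PI * q * Cmod (s * Z1 - 1) <= PI * q * s)%R) by (apply Rmult_le_compat_l; [apply Rmult_le_pos |]; lra).
  lra. }
assert (Hq : tends (at_right 0) (fun s => PI * RtoC (Rpower y (- (1 + s)))) (PI / y)).
{ replace (PI / y) with (PI * RtoC (Rpower y (- (1 + 0)))).
  - lim.
    apply (tends_at_right_0 (fun s => Rpower y (- (1 + s)))); unfold Rpower; auto_derive; trivial.
  - rewrite Rplus_0_r, Rpower_Ropp, Rpower_1, RtoC_inv by lra; reflexivity. }
replace (PI / y) with (0 + PI / y) by ring.
apply (tends_ext _ (fun s : R => (s * N s - PI * RtoC (Rpower y (- (1 + s)))) + PI * RtoC (Rpower y (- (1 + s)))));
  [intros; ring |].
apply tends_plus; [lim | | exact Hq].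
set (g := fun s => (s * (K * ((1 + s) * Rpower y (- (1 + s)) + 2 * Rpower y (- (2 + s))) + PI * Rpower y (- (1 + s))))%R) in Hest.
assert (Hg : tends (at_right 0) (fun s => RtoC (g s)) 0).
{ replace (RtoC 0) with (RtoC (g 0%R)) by (unfold g; now rewrite Rmult_0_l).
  apply tends_at_right_0; unfold g, Rpower; auto_derive; trivial. }
intros eps Heps.
assert (H01 : at_right 0 (fun s => 0 < s <= 1)%R) by (apply (at_right_0 _ 1); [lra | intros; lra]).
generalize (filter_and _ _ (Hg eps Heps) H01); apply filter_imp; intros s [H1 H2].
assert (E0 : forall x : C, x - 0 = x) by (intros; ring); rewrite E0.
eapply Rle_lt_trans; [apply Hest, H2 |].
rewrite <- RtoC_minus, Cmod_R, Rminus_0_r in H1; eapply Rle_lt_trans; [apply Rle_abs | exact H1].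
Qed.

(** * The limit of the Eisenstein series *)

(** In the identity [(1 + s/2) K = D - (s/2) N] the remainder sum [D] is continuous at [s = 0],
    and the residue of [N] survives as the correction [- pi / (2 Im tau)]. *)
Theorem hecke_limit (tau : C) (K : R -> C) (D0 : C) : (0 < Im tau)%R ->
  (forall s, (0 < s <= 1)%R -> has_sum row_pos (fun mn => eis s (lat tau mn)) (K s)) ->
  has_sum row_pos (fun mn => hecke_rem 0 (lat tau mn)) D0 ->
  tends (at_right 0) K (D0 - PI / (2 * Im tau)).
Proof.
intros Ht HK HD0.
destruct (choice_on (fun s => 0 < s <= 1)%R (fun s p => has_sum row_pos (fun mn => epstein s (lat tau mn)) p) 0)
  as [N HN']; [intros s [Hs _]; now apply epstein_lattice_sum |].
destruct (choice_on (fun s => 0 < s <= 1)%R (fun s p => has_sum row_pos (fun mn => hecke_rem s (lat tau mn)) p) 0)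
  as [D HD']; [intros s Hs; apply hecke_rem_sum; trivial; lra |].
assert (LN := epstein_residue tau N Ht HN').
assert (LD := hecke_rem_sum_tends tau D D0 Ht HD' HD0).
assert (T2 : RtoC 2 <> 0) by (apply RtoC_neq_0; lra).
assert (Ty : RtoC (Im tau) <> 0) by (apply RtoC_neq_0; lra).
apply (tends_ext_F _ (fun s : R => (D s - / 2 * (s * N s)) / (1 + s / 2))).
- apply (at_right_0 _ 1); [lra |]; intros s Hs.
  assert (Hs1 : (0 < s <= 1)%R) by lra.
  rewrite (hecke_identity tau s (K s) (N s) (D s) Ht Hs1 (HK s Hs1) (HN' s Hs1) (HD' s Hs1)).
  assert (Hs2 : 1 + s / 2 <> 0) by (rewrite <- RtoC_div, <- RtoC_plus by lra; apply RtoC_neq_0; lra).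
  field.
  intros E; apply Hs2; rewrite <- (Cmult_1_l (1 + s / 2)).
  replace (1 * (1 + s / 2)) with (/ 2 * (2 + s)) by (field; exact T2); rewrite E; ring.
- replace (D0 - PI / (2 * Im tau)) with ((D0 - / 2 * (PI / Im tau)) / (1 + 0 / 2)).
  2:{ replace (1 + 0 / 2) with (RtoC 1) by (field; exact T2); field; auto. }
  lim; replace (1 + 0 / 2) with (RtoC 1) by (field; exact T2); apply C1_neq_0.
Qed.

(** At [s = 0] the differences of [1 / w] still telescope along each row, so that the remainder sum
    is the Eisenstein series summed by rows. *)
Lemma eisenstein_rows (tau : C) (D0 : C) : (0 < Im tau)%R ->
  has_sum row_pos (fun mn => hecke_rem 0 (lat tau mn)) D0 ->
  exists Rw : nat -> C, has_sum pos Rw D0 /\ forall k, pos k -> has_sum (fun _ => True) (fun n => / lat tau (Z.of_nat k, n) ^ 2) (Rw k).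
Proof.
intros Ht HD0.
destruct (choice_on pos (fun k p => has_sum (fun _ => True) (fun n => / lat tau (Z.of_nat k, n) ^ 2) p) 0) as [Rw HRw].
{ intros k Hk; apply (has_sum_exists _ _ (fun n => Rpower (Cmod (lat tau (Z.of_nat k, n))) (- (2)))).
  - apply summable_row; [exact Ht | lra | unfold pos in Hk; lia].
  - intros n _.
    assert (Hnz : nonzero (Z.of_nat k, n)) by (apply row_pos_nonzero; unfold row_pos, pos in *; simpl; lia).
    rewrite Cmod_inv_pow by (now apply lat_neq_0); right; symmetry; apply (Rpower_neg_pow _ 2).
    now apply lat_pos. }
exists Rw; split; [| exact HRw].
apply (conv_row_nat (fun mn => hecke_rem 0 (lat tau mn))); [| exact HD0]; intros k Hk.
assert (Hk' : (1 <= Z.of_nat k)%Z) by (unfold pos in Hk; lia).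
destruct (hecke_rem_row_sum tau 0 (Z.of_nat k) Ht ltac:(lra) Hk') as [q Hq]; assert (Hdiff := has_sum_minus _ _ _ _ _ Hq (HRw k Hk)); cbv beta in Hdiff.
assert (Hprim : has_sum (fun _ => True) (fun n => primitive 0 (lat tau (Z.of_nat k, n) + 1) -
  primitive 0 (lat tau (Z.of_nat k, n))) (q - Rw k)).
{ revert Hdiff; apply conv_ext; intros n _; unfold hecke_rem, eis; rewrite Rpower_0_r.
  unfold Cdiv; ring. }
apply primitive_row_sum in Hprim; [| exact Ht | lra | exact Hk'].
replace (Rw k) with q; [exact Hq |]; replace q with (q - Rw k + Rw k) by ring; rewrite Hprim; ring.
Qed.

(** * Products over the lattice *)

Definition sinprod (a : C) : C := Cprod_over pos (fun k => 1 - a ^ 2 / INR k ^ 2).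

Lemma sinprod_prod (a : C) : has_prod pos (fun k => 1 - a ^ 2 / INR k ^ 2) (sinprod a).
Proof.
destruct (sine_product a) as [p [Hp _]]; unfold sinprod; rewrite (Cprod_over_unique _ _ p); [exact Hp |].
apply tends_filterlim; [lim | exact Hp].
Qed.

Lemma sinprod_sinh (a : C) : PI * Ci * a * sinprod a = Csinh (PI * Ci * a).
Proof.
destruct (sine_product a) as [p [Hp E]]; rewrite <- E; f_equal.
exact (conv_unique _ _ _ _ (sinprod_prod a) Hp).
Qed.

Lemma sinprod_0 : sinprod 0 = 1.
Proof.
apply (conv_unique (op := Cmult) (e := RtoC 1) pos (fun _ => RtoC 1)); [| apply conv_unit].
generalize (sinprod_prod 0); apply conv_ext; intros k Hk; field; now apply INR_C_neq_0.
Qed.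

Lemma tends_eventually_bounded {T : Type} (F : (T -> Prop) -> Prop) {FF : Filter F} (f : T -> C) (p : C) :
  tends F f p -> F (fun x => Cmod (f x) <= Cmod p + 1)%R.
Proof.
intros H; generalize (H 1%R Rlt_0_1); apply filter_imp; intros x Hx.
assert (T1 := Cmod_triangle_inv (f x) p); lra.
Qed.

Lemma tends_eventually_neq_0 {T : Type} (F : (T -> Prop) -> Prop) {FF : Filter F} (f : T -> C) (p : C) :
  p <> 0 -> tends F f p -> F (fun x => f x <> 0).
Proof.
intros Hp H; generalize (H _ (proj1 (Cmod_gt_0 p) Hp)); apply filter_imp; intros x Hx E.
rewrite E in Hx; replace (0 - p) with (- p) in Hx by ring; rewrite Cmod_opp in Hx; lra.
Qed.

Lemma sinprod_tends {T : Type} (F : (T -> Prop) -> Prop) {FF : ProperFilter F} (w : T -> C) (w0 : C) :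
  tends F w w0 -> tends F (fun t => sinprod (w t)) (sinprod w0).
Proof.
intros Hw.
apply (conv_dominated (op := Cmult) F pos (fun k => (Cmod w0 + 1) ^ 2 * / INR k ^ 2)%R
  (fun t k => 1 - w t ^ 2 / INR k ^ 2) (fun k => 1 - w0 ^ 2 / INR k ^ 2)).
- apply summable_scal; [apply pow2_ge_0 | now apply summable_pos_pow].
- generalize (tends_eventually_bounded F w w0 Hw); apply filter_imp; intros t Ht k Hk.
  eapply Rle_trans; [now apply sine_factor_bound |].
  assert (Hk1 := pos_INR1 k Hk).
  apply Rmult_le_compat_r; [left; apply Rinv_0_lt_compat, pow_lt; lra |].
  apply pow_incr; split; [apply Cmod_ge_0 | exact Ht].
- intros k Hk; lim.
- apply filter_forall; intros t; apply sinprod_prod.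
- apply sinprod_prod.
Qed.

Lemma qpoch_tends {T : Type} (F : (T -> Prop) -> Prop) {FF : ProperFilter F} (tau : C) (w : T -> C) (w0 : C) :
  (0 < Im tau)%R -> tends F w w0 -> tends F (fun t => qpoch tau (w t)) (qpoch tau w0).
Proof.
intros Ht Hw.
apply (conv_dominated (op := Cmult) F pos (fun n => Cmod (Cmod w0 + 1) * Cmod (expi 1 tau) ^ n)%R
  (fun t n => 1 - w t * expi (INR n) tau) (fun n => 1 - w0 * expi (INR n) tau)).
- now apply summable_q.
- generalize (tends_eventually_bounded F w w0 Hw); apply filter_imp; intros t Hwt n Hn.
  eapply Rle_trans; [apply qpoch_factor_est |].
  apply Rmult_le_compat_r; [apply pow_le, Cmod_ge_0 |].
  rewrite <- RtoC_plus, Cmod_R; eapply Rle_trans; [exact Hwt | apply Rle_abs].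
- intros n _; lim.
- apply filter_forall; intros t; now apply qpoch_prod.
- now apply qpoch_prod.
Qed.

Lemma PICi_neq_0 : PI * Ci <> 0.
Proof.
apply Cmult_neq_0; [apply RtoC_neq_0; assert (H := PI_RGT_0); lra |].
intros E; injection E; lra.
Qed.

Lemma sinprod_neq_0 (a : C) : Csinh (PI * Ci * a) <> 0 -> sinprod a <> 0.
Proof. intros H E; apply H; rewrite <- sinprod_sinh, E; ring. Qed.

(** As [sinh (2 y) = 2 sinh y cosh y], the cotangent is a quotient of two sines by a squared sine. *)
Lemma cot_sinprod (a : C) : Csinh (PI * Ci * a) <> 0 ->
  PI * Ci * a * (Ccosh (PI * Ci * a) / Csinh (PI * Ci * a)) = sinprod (2 * a) / sinprod a ^ 2.
Proof.
intros H; assert (HS := sinprod_neq_0 a H); assert (HP := PICi_neq_0).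
assert (E2 := sinprod_sinh (2 * a)); assert (E1 := sinprod_sinh a).
replace (PI * Ci * (2 * a)) with (2 * (PI * Ci * a)) in E2 by ring.
rewrite Csinh_double, <- E1 in E2; rewrite <- E1.
assert (Ha : a <> 0).
{ intros E; apply H; rewrite <- E1, E; ring. }
assert (H2 : RtoC 2 <> 0) by (apply RtoC_neq_0; lra).
set (c := Ccosh (PI * Ci * a)) in *; set (S1 := sinprod a) in *; set (S2 := sinprod (2 * a)) in *.
set (y := PI * Ci * a) in *; assert (Hy : y <> 0) by (apply Cmult_neq_0; assumption).
assert (ES : S2 = S1 * c).
{ replace S2 with (2 * y * S2 / (2 * y)) by (field; auto); rewrite E2; field; auto. }
rewrite ES; field; auto.
Qed.

Lemma Csinh_zero (a : C) : Csinh (PI * Ci * a) = 0 -> exists n : Z, a = IZR n.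
Proof.
intros H; rewrite Csinh_components in H.
assert (HPI := PI_RGT_0).
destruct a as [x y]; set (v := Re (PI * Ci * (x, y))) in *; set (t := Im (PI * Ci * (x, y))) in *.
assert (Ev : v = (- (PI * y))%R) by (unfold v; simpl; ring).
assert (Et : t = (PI * x)%R) by (unfold t; simpl; ring).
injection H; intros H2 H1.
assert (He : (0 < exp v + exp (- v))%R) by (assert (A := exp_pos v); assert (B := exp_pos (- v)); lra).
assert (Hs : sin t = 0%R).
{ apply Rmult_eq_reg_l with ((exp v + exp (- v)) / 2)%R; [rewrite Rmult_0_r; exact H2 | lra]. }
assert (Hc : cos t <> 0%R).
{ intros E; assert (A := sin2_cos2 t); rewrite Hs, E in A; unfold Rsqr in A; lra. }
assert (Hv : exp v = exp (- v)).
{ assert (((exp v - exp (- v)) / 2)%R = 0%R); [| lra].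
  apply Rmult_eq_reg_r with (cos t); [rewrite Rmult_0_l; exact H1 | exact Hc]. }
apply exp_inv in Hv; destruct (sin_eq_0_0 t Hs) as [n Hn]; exists n.
rewrite Et in Hn; apply injective_projections; simpl.
- apply Rmult_eq_reg_l with PI; lra.
- apply Rmult_eq_reg_l with PI; lra.
Qed.

Lemma Csinh_expi (a : C) : Csinh (PI * Ci * a) = - / 2 * Cexp (- (PI * Ci * a)) * (1 - expi 1 a).
Proof.
unfold Csinh; replace (expi 1 a) with (Cexp (PI * Ci * a) * Cexp (PI * Ci * a)).
- rewrite Cexp_opp; assert (H := Cexp_neq_0 (PI * Ci * a)); field.
  exact H.
- unfold expi; rewrite <- Cexp_plus; f_equal; ring.
Qed.

Lemma expi_eq_1 (a : C) : 1 - expi 1 a = 0 -> exists n : Z, a = IZR n.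
Proof. intros H; apply Csinh_zero; rewrite Csinh_expi, H; ring. Qed.

Fixpoint symlist (n : nat) : list Z :=
  match n with
  | O => (0%Z :: nil)
  | S k => (Z.of_nat (S k) :: - Z.of_nat (S k) :: symlist k)%Z
  end.

Lemma in_symlist (n : nat) (x : Z) : In x (symlist n) <-> (Z.abs x <= Z.of_nat n)%Z.
Proof.
induction n as [| n IH]; simpl symlist; simpl In; [lia |]; rewrite IH; lia.
Qed.

Lemma NoDup_symlist (n : nat) : NoDup (symlist n).
Proof.
induction n as [| n IH]; simpl; [repeat constructor; simpl; tauto |].
constructor; [| constructor; [rewrite in_symlist; lia | exact IH]].
simpl; rewrite in_symlist; lia.
Qed.

(** The factors at [k] and [- k] combine into factors of the sine products at [w], [w - z] and
    [w + z]. *)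
Lemma row_partial_product (w z : C) (n : nat) : (forall k : Z, w + IZR k <> 0) ->
  let S a := PI * Ci * a * big Cmult 1 (fun k => 1 - a ^ 2 / INR k ^ 2) (seq 1 n) in
  big Cmult 1 (fun k : Z => 1 - z ^ 2 / (w + IZR k) ^ 2) (symlist n) * S w ^ 2 = S (w - z) * S (w + z).
Proof.
intros Hw S; unfold S; clear S; induction n as [| n IH].
- simpl; assert (H : w <> 0) by (rewrite <- (Cplus_0_r w); exact (Hw 0%Z)); field; exact H.
- assert (Hk := INR_C_neq_0 (S n) ltac:(unfold pos; lia)).
  assert (H1 := Hw (Z.of_nat (S n))); assert (H2 := Hw (- Z.of_nat (S n))%Z).
  rewrite !big_seq_S; cbn [symlist big fold_right]; rewrite opp_IZR, RtoC_opp in *.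
  rewrite <- INR_IZR_INZ in *; replace (1 + n)%nat with (S n) by lia.
  fold (big Cmult 1 (fun k : Z => 1 - z ^ 2 / (w + IZR k) ^ 2) (symlist n)).
  set (K := RtoC (INR (S n))) in *.
  set (B := big Cmult 1 (fun k : Z => 1 - z ^ 2 / (w + IZR k) ^ 2) (symlist n)) in *.
  set (B1 := big Cmult 1 (fun k => 1 - w ^ 2 / INR k ^ 2) (seq 1 n)) in *.
  set (B2 := big Cmult 1 (fun k => 1 - (w - z) ^ 2 / INR k ^ 2) (seq 1 n)) in *.
  set (B3 := big Cmult 1 (fun k => 1 - (w + z) ^ 2 / INR k ^ 2) (seq 1 n)) in *.
  transitivity (B * (PI * Ci * w * B1) ^ 2 *
    ((1 - z ^ 2 / (w + K) ^ 2) * (1 - z ^ 2 / (w + - K) ^ 2) * (1 - w ^ 2 / K ^ 2) ^ 2)); [ring |].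
  rewrite IH.
  replace ((1 - z ^ 2 / (w + K) ^ 2) * (1 - z ^ 2 / (w + - K) ^ 2) * (1 - w ^ 2 / K ^ 2) ^ 2)
    with ((1 - (w - z) ^ 2 / K ^ 2) * (1 - (w + z) ^ 2 / K ^ 2)) by (field; auto).
  ring.
Qed.

(** The row is [sin (pi (w - z)) sin (pi (w + z)) / sin^2 (pi w)] at [w = m tau], rewritten in terms
    of [u] and [q]. *)
Lemma row_product (tau z : C) (m : nat) : (0 < Im tau)%R -> pos m ->
  has_prod (fun _ => True) (fun n => 1 - z ^ 2 / lat tau (Z.of_nat m, n) ^ 2)
    ((1 - expi 1 z * expi (INR m) tau) * (1 - / expi 1 z * expi (INR m) tau) / (1 - expi (INR m) tau) ^ 2).
Proof.
intros Ht Hm; set (w := INR m * tau).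
assert (Hlat : forall n, lat tau (Z.of_nat m, n) = w + IZR n).
{ intros n; unfold lat, w; simpl; now rewrite <- INR_IZR_INZ. }
assert (Hnz : forall n, lat tau (Z.of_nat m, n) <> 0).
{ intros n; apply lat_neq_0; [exact Ht |]; apply row_pos_nonzero; unfold row_pos, pos in *; simpl; lia. }
assert (Hb : forall n, (Cmod (1 - z ^ 2 / lat tau (Z.of_nat m, n) ^ 2 - 1) <=
  Cmod z ^ 2 * Rpower (Cmod (lat tau (Z.of_nat m, n))) (- (2)))%R).
{ intros n; replace (1 - z ^ 2 / lat tau (Z.of_nat m, n) ^ 2 - 1) with (- (z ^ 2 * / lat tau (Z.of_nat m, n) ^ 2))
    by (unfold Cdiv; ring).
  rewrite Cmod_opp, Cmod_mult, Cmod_pow, Cmod_inv_pow by apply Hnz; right; f_equal; symmetry.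
  apply (Rpower_neg_pow _ 2), Cmod_gt_0, Hnz. }
destruct (conv_exists (op := Cmult) (fun _ : Z => True) (fun n => 1 - z ^ 2 / lat tau (Z.of_nat m, n) ^ 2) _
  (summable_scal _ _ (Cmod z ^ 2) (pow2_ge_0 _) (summable_row tau 2 (Z.of_nat m) Ht ltac:(lra) ltac:(unfold pos in Hm; lia))))
  as [p Hp]; [intros; apply Hb |].
assert (Hq := one_minus_q_neq_0 tau m Ht Hm).
assert (Ew : expi 1 w = expi (INR m) tau) by (unfold expi, w; f_equal; ring).
assert (E : p * Csinh (PI * Ci * w) ^ 2 = Csinh (PI * Ci * (w - z)) * Csinh (PI * Ci * (w + z))).
{ assert (L1 : tends eventually (fun N => big Cmult 1 (fun n => 1 - z ^ 2 / lat tau (Z.of_nat m, n) ^ 2) (symlist N)) p).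
  { apply (conv_exhaust eventually (fun _ => True)); trivial; [apply NoDup_symlist |].
    intros x _; exists (Z.to_nat (Z.abs x)); intros N HN; apply in_symlist; lia. }
  assert (LS : forall a, tends eventually
    (fun N => PI * Ci * a * big Cmult 1 (fun k => 1 - a ^ 2 / INR k ^ 2) (seq 1 N)) (Csinh (PI * Ci * a))).
  { intros a; rewrite <- sinprod_sinh; lim; apply tends_seq_of_conv, sinprod_prod. }
  apply (tends_unique eventually (fun N => big Cmult 1 (fun n => 1 - z ^ 2 / lat tau (Z.of_nat m, n) ^ 2) (symlist N) *
    (PI * Ci * w * big Cmult 1 (fun k => 1 - w ^ 2 / INR k ^ 2) (seq 1 N)) ^ 2)).
  - lim; apply LS.
  - apply (tends_ext _ (fun N => (PI * Ci * (w - z) * big Cmult 1 (fun k => 1 - (w - z) ^ 2 / INR k ^ 2) (seq 1 N)) *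
      (PI * Ci * (w + z) * big Cmult 1 (fun k => 1 - (w + z) ^ 2 / INR k ^ 2) (seq 1 N)))).
    + intros N; rewrite <- row_partial_product by (intros k; rewrite <- Hlat; apply Hnz).
      f_equal; apply big_ext; intros n _; now rewrite Hlat.
    + lim; apply LS. }
rewrite !Csinh_expi in E.
replace (expi 1 (w - z)) with (/ expi 1 z * expi (INR m) tau) in E
  by (rewrite <- Ew; unfold expi; rewrite <- Cexp_opp, <- Cexp_plus; f_equal; ring).
replace (expi 1 (w + z)) with (expi 1 z * expi (INR m) tau) in E
  by (rewrite <- Ew; unfold expi; rewrite <- Cexp_plus; f_equal; ring).
rewrite Ew in E.
replace (- (PI * Ci * (w - z))) with (- (PI * Ci * w) + PI * Ci * z) in E by ring.
replace (- (PI * Ci * (w + z))) with (- (PI * Ci * w) + - (PI * Ci * z)) in E by ring.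
rewrite !Cexp_plus, (Cexp_opp (PI * Ci * z)) in E.
set (u := expi 1 z) in *; set (q := expi (INR m) tau) in *; set (e := Cexp (- (PI * Ci * w))) in *.
set (v := Cexp (PI * Ci * z)) in *.
assert (He : e <> 0) by apply Cexp_neq_0; assert (Hv : v <> 0) by apply Cexp_neq_0.
assert (Hu : u <> 0) by apply expi_neq_0.
assert (H2 : RtoC 2 <> 0) by (apply RtoC_neq_0; lra).
replace ((1 - u * q) * (1 - / u * q) / (1 - q) ^ 2) with p; [exact Hp |].
replace p with (p * (- / 2 * e * (1 - q)) ^ 2 / (- / 2 * e * (1 - q)) ^ 2).
- rewrite E; field; auto.
- field; auto.
Qed.

(** * Absolutely convergent form of the product *)

(** With [b = a^2 / k^2], this is the [k]-th factor in the product for [pi a cot (pi a)], times the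
    exponential that cancels its term of first order in [b]. *)
Definition regfac (b : C) : C := (1 - 4 * b) / (1 - b) ^ 2 * Cexp (2 * b).

Lemma regfac_est (b : C) : (Cmod b <= 1 / 2)%R -> (Cmod (regfac b - 1) <= 500 * Cmod b ^ 2)%R.
Proof.
intros Hb; assert (Hb0 := Cmod_ge_0 b); set (t := Cmod b) in *.
assert (H1 : (1 / 2 <= Cmod (1 - b))%R) by (assert (T := Cmod_triangle_inv 1 b); rewrite Cmod_1 in T; fold t in T; lra).
assert (Hn : 1 - b <> 0) by (apply Cmod_gt_0; lra).
set (rho := Cexp (2 * b) - 1 - 2 * b).
assert (Hrho : (Cmod rho <= 36 * t ^ 2)%R).
{ unfold rho; eapply Rle_trans; [apply Cexp_est2 |]; rewrite Cmod_mult, Cmod_R, Rabs_pos_eq by lra; fold t.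
  assert (exp (2 * t) <= 3)%R by (eapply Rle_trans; [apply exp_le | apply exp_le_3]; lra).
  replace (36 * t ^ 2)%R with (3 * (2 * t) ^ 2 * 3)%R by ring.
  apply Rmult_le_compat_l; [assert (H9 := pow2_ge_0 (2 * t)); lra | assumption]. }
replace (regfac b - 1) with ((- (9) * b ^ 2 + (1 - 4 * b) * rho) / (1 - b) ^ 2).
2:{ unfold regfac; replace (Cexp (2 * b)) with (1 + 2 * b + rho) by (unfold rho; ring); field; exact Hn. }
rewrite Cmod_div, Cmod_pow by (now apply Cpow2_neq_0).
assert (Hnum : (Cmod (- (9) * b ^ 2 + (1 - 4 * b) * rho) <= 117 * t ^ 2)%R).
{ eapply Rle_trans; [apply Cmod_triangle |]; rewrite !Cmod_mult, Cmod_opp, Cmod_pow, Cmod_R, Rabs_pos_eq by lra; fold t.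
  assert (H4 : (Cmod (1 - 4 * b) <= 3)%R).
  { eapply Rle_trans; [apply Cmod_triangle_sub |]; rewrite Cmod_1, Cmod_mult, Cmod_R, Rabs_pos_eq by lra; fold t; lra. }
  assert (Cmod (1 - 4 * b) * Cmod rho <= 3 * (36 * t ^ 2))%R by (apply Rmult_le_compat; trivial; apply Cmod_ge_0).
  lra. }
assert (Hden : (1 / 4 <= Cmod (1 - b) ^ 2)%R) by nra.
apply Rle_div_l; [lra |].
assert (Ht2 := pow2_ge_0 t).
assert (500 * t ^ 2 * (1 / 4) <= 500 * t ^ 2 * Cmod (1 - b) ^ 2)%R by (apply Rmult_le_compat_l; lra).
lra.
Qed.

Lemma regfac_tends {T : Type} (F : (T -> Prop) -> Prop) {FF : Filter F} (w : T -> C) (w0 : C) :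
  1 - w0 <> 0 -> tends F w w0 -> tends F (fun t => regfac (w t)) (regfac w0).
Proof.
intros Hn Hw; unfold regfac; lim; now apply Cpow2_neq_0.
Qed.

Lemma has_prod_regfac {T : Type} (A : T -> Prop) (b : T -> C) (p4 p1 S : C) :
  p1 <> 0 -> has_prod A (fun x => 1 - 4 * b x) p4 -> has_prod A (fun x => 1 - b x) p1 ->
  has_sum A b S -> has_prod A (fun x => regfac (b x)) (p4 / p1 ^ 2 * Cexp (2 * S)).
Proof.
intros Hp1 H4 H1 HS; unfold regfac.
apply (conv_op (op := Cmult) A (fun x => (1 - 4 * b x) / (1 - b x) ^ 2) (fun x => Cexp (2 * b x))).
- apply (conv_op (op := Cmult) A (fun x => 1 - 4 * b x) (fun x => / (1 - b x) ^ 2)); [exact H4 |].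
  apply has_prod_inv; [now apply Cpow2_neq_0 | now apply has_prod_pow].
- apply has_prod_Cexp; now apply has_sum_scal.
Qed.

Lemma regfac_cot (a Z2 : C) : has_sum pos (fun k => / RtoC (INR k) ^ 2) Z2 -> Csinh (PI * Ci * a) <> 0 ->
  has_prod pos (fun k => regfac (a ^ 2 / INR k ^ 2))
    (sinprod (2 * a) / sinprod a ^ 2 * Cexp (2 * (a ^ 2 * Z2))).
Proof.
intros HZ Ha; apply has_prod_regfac.
- now apply sinprod_neq_0.
- generalize (sinprod_prod (2 * a)); apply conv_ext; intros k Hk; field; now apply INR_C_neq_0.
- apply sinprod_prod.
- apply (conv_ext _ (fun k => a ^ 2 * / INR k ^ 2)); [intros; reflexivity |]; now apply has_sum_scal.
Qed.

(** The product over the row [m] of the factors [1 - z^2 / (m tau + n)^2]. *)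
Definition rowfac (tau z : C) (m : nat) : C :=
  (1 - expi 1 z * expi (INR m) tau) * (1 - / expi 1 z * expi (INR m) tau) / (1 - expi (INR m) tau) ^ 2.

(** [Theta] without the Gaussian factor and the factor [2 sinh (pi i z)]. *)
Definition thetafac (tau z : C) : C :=
  qpoch tau (expi 1 z) * qpoch tau (/ expi 1 z) / qpoch tau 1 ^ 2.

Lemma rowfac_prod (tau z : C) : (0 < Im tau)%R -> has_prod pos (rowfac tau z) (thetafac tau z).
Proof.
intros Ht; unfold rowfac, thetafac.
apply (conv_op (op := Cmult) pos (fun m => (1 - expi 1 z * expi (INR m) tau) * (1 - / expi 1 z * expi (INR m) tau))
  (fun m => / (1 - expi (INR m) tau) ^ 2)).
- apply (conv_op (op := Cmult) pos); now apply qpoch_prod.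
- apply has_prod_inv; [now apply Cpow2_neq_0, qpoch_1_neq_0 |]; apply has_prod_pow.
  apply (conv_ext _ (fun m => 1 - 1 * expi (INR m) tau)); [intros; ring | now apply qpoch_prod].
Qed.

Lemma lattice_factor_neq_0 (tau z : C) (m : nat) : (in_lattice tau z -> z = 0) -> z <> 0 ->
  1 - expi 1 z * expi (INR m) tau <> 0 /\ 1 - / expi 1 z * expi (INR m) tau <> 0.
Proof.
intros Hz Hz0; split; intros E.
- destruct (expi_eq_1 (z + INR m * tau)) as [n Hn].
  { rewrite <- E; do 2 f_equal; unfold expi; rewrite <- Cexp_plus; f_equal; ring. }
  apply Hz0, Hz; exists (- Z.of_nat m)%Z, n; rewrite opp_IZR, <- INR_IZR_INZ, <- Hn, RtoC_opp; ring.
- destruct (expi_eq_1 (- z + INR m * tau)) as [n Hn].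
  { rewrite <- E; do 2 f_equal; unfold expi; rewrite <- Cexp_opp, <- Cexp_plus; f_equal; ring. }
  apply Hz0, Hz; exists (Z.of_nat m), (- n)%Z; rewrite opp_IZR, <- INR_IZR_INZ, RtoC_opp, <- Hn; ring.
Qed.

Lemma thetafac_neq_0 (tau z : C) : (0 < Im tau)%R -> (in_lattice tau z -> z = 0) -> z <> 0 -> thetafac tau z <> 0.
Proof.
intros Ht Hz Hz0; unfold thetafac.
apply Cmult_neq_0.
- apply Cmult_neq_0; apply qpoch_neq_0; trivial; intros n _; now apply lattice_factor_neq_0.
- intros E; assert (H := qpoch_1_neq_0 tau Ht); assert (H2 := Cpow2_neq_0 _ H).
  apply C1_neq_0; rewrite <- (Cinv_r _ H2), E; ring.
Qed.

(** * Indexing by primitive vectors and multiples *)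

(** Representatives of the nonzero lattice vectors modulo sign. *)
Definition upper (mn : Z * Z) : Prop := (0 < fst mn \/ (fst mn = 0 /\ 0 < snd mn))%Z.
Definition prim (mn : Z * Z) : Prop := upper mn /\ Z.gcd (fst mn) (snd mn) = 1%Z.

Definition mulidx (x : nat * (Z * Z)) : Z * Z :=
  (Z.of_nat (fst x) * fst (snd x), Z.of_nat (fst x) * snd (snd x))%Z.

Definition multiples (x : nat * (Z * Z)) : Prop := pos (fst x) /\ prim (snd x).

Lemma upper_nonzero (mn : Z * Z) : upper mn -> nonzero mn.
Proof. unfold upper, nonzero; intros H E; subst; simpl in H; lia. Qed.

Lemma prim_nonzero (mn : Z * Z) : prim mn -> nonzero mn.
Proof. intros [H _]; now apply upper_nonzero. Qed.

Lemma mulidx_upper (x : nat * (Z * Z)) : multiples x -> upper (mulidx x).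
Proof. destruct x as [k [m n]]; unfold multiples, prim, upper, mulidx, pos; simpl; intros [H1 [H2 _]]; nia. Qed.

(** The multiple [k] is the greatest common divisor of the coordinates. *)
Lemma mulidx_inj (x y : nat * (Z * Z)) : multiples x -> multiples y -> mulidx x = mulidx y -> x = y.
Proof.
destruct x as [k [m n]], y as [k' [m' n']]; unfold multiples, prim, mulidx, pos; simpl.
intros [H1 [_ H2]] [H3 [_ H4]] E; injection E; intros E2 E1.
(* both are the gcd of the coordinates of the common multiple *)
assert (G : Z.of_nat k = Z.of_nat k').
{ assert (G1 := Z.gcd_mul_mono_l_nonneg m n (Z.of_nat k) ltac:(lia)).
  assert (G2 := Z.gcd_mul_mono_l_nonneg m' n' (Z.of_nat k') ltac:(lia)).
  rewrite H2 in G1; rewrite H4 in G2; rewrite E1, E2 in G1; lia. }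
rewrite G in E1, E2; apply Z.mul_reg_l in E1, E2; try lia.
apply Nat2Z.inj in G; now subst.
Qed.

Lemma mulidx_surj (y : Z * Z) : upper y -> exists x, multiples x /\ mulidx x = y.
Proof.
destruct y as [m n]; intros Hy; set (g := Z.gcd m n).
assert (Hg0 := Z.gcd_nonneg m n); fold g in Hg0.
assert (Hg : (0 < g)%Z).
{ destruct (Z.eq_dec g 0) as [E | E]; [| lia].
  assert (m = 0)%Z by (now apply Z.gcd_eq_0_l in E); assert (n = 0)%Z by (now apply Z.gcd_eq_0_r in E).
  unfold upper in Hy; simpl in Hy; lia. }
destruct (Z.gcd_divide_l m n) as [m' Em]; destruct (Z.gcd_divide_r m n) as [n' En]; fold g in Em, En.
exists (Z.to_nat g, (m', n')); unfold multiples, prim, mulidx, pos; simpl; rewrite Z2Nat.id by lia.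
split; [split; [lia | split] |].
- unfold upper in *; simpl in *; nia.
- assert (G := Z.gcd_mul_mono_r_nonneg m' n' g Hg0); rewrite <- Em, <- En in G; fold g in G; nia.
- f_equal; lia.
Qed.

Lemma conv_multiples {op e} (f : Z * Z -> C) (p : C) :
  conv op e multiples (fun x => f (mulidx x)) p <-> conv op e upper f p.
Proof. apply conv_reindex; [apply mulidx_upper | apply mulidx_inj | apply mulidx_surj]. Qed.

Lemma lat_mulidx (tau : C) (x : nat * (Z * Z)) : lat tau (mulidx x) = INR (fst x) * lat tau (snd x).
Proof. destruct x as [k [m n]]; unfold lat, mulidx; simpl; rewrite !mult_IZR, !RtoC_mult, <- !INR_IZR_INZ; ring. Qed.

Lemma conv_upper {op e} `{CMonoid op e} (f : Z * Z -> C) (p0 p1 : C) :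
  conv op e pos (fun n => f (0%Z, Z.of_nat n)) p0 -> conv op e row_pos f p1 -> conv op e upper f (op p0 p1).
Proof.
intros H0 H1; apply (conv_iff (fun mn => (fst mn = 0 /\ 0 < snd mn)%Z \/ row_pos mn)).
{ intros mn; unfold upper, row_pos; lia. }
apply conv_union; [unfold row_pos; lia | | exact H1].
apply (conv_reindex pos _ (fun n => (0%Z, Z.of_nat n)) f p0); trivial; unfold pos; simpl.
- intros; lia.
- intros x y _ _ E; injection E; lia.
- intros [m n] [E1 E2]; simpl in *; exists (Z.to_nat n); split; [lia |]; subst; f_equal; lia.
Qed.

(** * Sums over primitive vectors *)

Lemma eis_mult (s : R) (x y : C) : x <> 0 -> y <> 0 -> eis s (x * y) = eis s x * eis s y.
Proof.
intros Hx Hy; assert (Hx' := proj1 (Cmod_gt_0 _) Hx); assert (Hy' := proj1 (Cmod_gt_0 _) Hy).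
unfold eis; rewrite Cmod_mult, <- Rpower_mult_distr, RtoC_mult by assumption.
field; auto.
Qed.

Lemma eis_INR (s : R) (k : nat) : pos k -> Cmod (eis s (INR k)) = Rpower (INR k) (- (2 + s)).
Proof. intros Hk; rewrite Cmod_eis, Cmod_INR by (now apply INR_C_neq_0); reflexivity. Qed.

Lemma eis_0 (w : C) : eis 0 w = / w ^ 2.
Proof. unfold eis; rewrite Rpower_0_r; ring. Qed.

Lemma zeta_sum (s : R) : (0 <= s)%R -> exists p, has_sum pos (fun k => eis s (INR k)) p.
Proof.
intros Hs; apply (has_sum_exists _ _ (fun k => Rpower (INR k) (- (2 + s)))); [apply summable_pos_power; lra |].
intros k Hk; right; now apply eis_INR.
Qed.

Lemma zeta_tends (Zt : R -> C) (Z2 : C) :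
  (forall s, (0 < s <= 1)%R -> has_sum pos (fun k => eis s (INR k)) (Zt s)) ->
  has_sum pos (fun k => / RtoC (INR k) ^ 2) Z2 -> tends (at_right 0) Zt Z2.
Proof.
intros HZ HZ2.
apply (conv_dominated (op := Cplus) (at_right 0) pos (fun k => Rpower (INR k) (- (2)))
  (fun s k => eis s (INR k)) (fun k => / RtoC (INR k) ^ 2)); trivial.
- apply summable_pos_power; lra.
- apply (at_right_0 _ 1); [lra |]; intros s Hs k Hk.
  replace (eis s (INR k) - 0) with (eis s (INR k)) by ring; rewrite eis_INR by exact Hk.
  assert (H1 := pos_INR1 k Hk); rewrite Ropp_plus_distr, Rpower_plus.
  rewrite <- (Rmult_1_r (Rpower (INR k) (- (2)))) at 2; apply Rmult_le_compat_l; [left; apply Rpower_gt_0 |].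
  rewrite <- (Rpower_1_l (- s)); apply Rpower_neg_le; lra.
- intros k _; apply eis_tends.
- apply (at_right_0 _ 1); [lra |]; intros s Hs; apply HZ; lra.
Qed.

(** The partial sums are real and at least 1. *)
Lemma zeta2_neq_0 (Z2 : C) : has_sum pos (fun k => / RtoC (INR k) ^ 2) Z2 -> Z2 <> 0.
Proof.
intros H E; apply tends_seq_of_conv in H; destruct (H 1%R Rlt_0_1) as [N HN].
specialize (HN (S N) ltac:(lia)); rewrite E in HN.
assert (HS : forall l, (forall x, In x l -> pos x) ->
  big Cplus 0 (fun k => / RtoC (INR k) ^ 2) l = RtoC (rsum (fun k => / INR k ^ 2)%R l)).
{ induction l as [| a l IH]; intros Hl; [reflexivity |]; cbn [big rsum fold_right].
  fold (big Cplus 0 (fun k => / RtoC (INR k) ^ 2) l); rewrite IH by (intros; apply Hl; now right).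
  assert (Ha := pos_INR1 a (Hl a (or_introl eq_refl))).
  rewrite RtoC_plus, RtoC_inv, RtoC_pow by (apply pow_nonzero; lra); reflexivity. }
rewrite HS in HN by (intros x Hx; apply in_seq in Hx; unfold pos; lia).
rewrite <- RtoC_minus, Cmod_R, Rminus_0_r in HN; cbn [seq rsum fold_right] in HN.
assert (H0 : (0 <= rsum (fun k => / INR k ^ 2)%R (seq 2 N))%R).
{ apply rsum_ge_0; intros x Hx; apply in_seq in Hx; left; apply Rinv_0_lt_compat, pow_lt, lt_0_INR; lia. }
unfold rsum in H0; simpl (INR 1) in HN; rewrite Rabs_pos_eq in HN; [| rewrite pow1, Rinv_1; lra].
rewrite pow1, Rinv_1 in HN; lra.
Qed.

(** Sorting the lattice vectors by their content [k] makes the lattice sum a zeta value times the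
    sum over primitive vectors. *)
Lemma primitive_sum (tau : C) (s : R) (Zt K : C) : (0 < Im tau)%R -> Zt <> 0 ->
  has_sum pos (fun k => eis s (INR k)) Zt -> has_sum row_pos (fun mn => eis s (lat tau mn)) K ->
  has_sum prim (fun mn => eis s (lat tau mn)) ((Zt + K) / Zt).
Proof.
intros Ht HZ0 HZ HK.
assert (HU : has_sum upper (fun mn => eis s (lat tau mn)) (Zt + K)).
{ apply conv_upper; [| exact HK]; revert HZ; apply conv_ext; intros k _; f_equal; unfold lat; simpl.
  rewrite <- INR_IZR_INZ; ring. }
apply conv_multiples in HU.
assert (HP : has_sum prim (fun mn => Zt * eis s (lat tau mn)) (Zt + K)).
{ apply (conv_snd pos prim (fun x => eis s (lat tau (mulidx x)))); [| exact HU].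
  intros mn Hmn; rewrite Cmult_comm.
  apply (conv_ext _ (fun k => eis s (lat tau mn) * eis s (INR k))); [| now apply has_sum_scal].
  intros k Hk; rewrite lat_mulidx; simpl; rewrite eis_mult; [ring | now apply INR_C_neq_0 |].
  now apply lat_neq_0, prim_nonzero. }
apply (has_sum_scal _ _ _ (/ Zt)) in HP; replace ((Zt + K) / Zt) with (/ Zt * (Zt + K)) by (unfold Cdiv; ring).
revert HP; apply conv_ext; intros mn _; field; exact HZ0.
Qed.

(** * Convergence of the regularised product *)

(** The regularised factor at the lattice vector [k omega]. Only [omega], not [k], enters through
    [|omega|^s], since the product to be computed is taken over primitive [omega]. *)
Definition regterm (tau z : C) (s : R) (x : nat * (Z * Z)) : C :=
  regfac (z ^ 2 * eis s (lat tau (snd x)) / INR (fst x) ^ 2).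

Lemma preimage_list (E : list (Z * Z)) : exists E', forall x, multiples x -> In (mulidx x) E -> In x E'.
Proof.
induction E as [| y E [E' IH]]; [exists nil; intros x _ [] |].
destruct (classic (exists x, multiples x /\ mulidx x = y)) as [[x0 [H1 H2]] | H].
- exists (x0 :: E'); intros x Hx [Ey | Hin]; [left | right; auto].
  apply mulidx_inj; trivial; congruence.
- exists E'; intros x Hx [Ey | Hin]; [| auto]; exfalso; apply H; exists x; auto.
Qed.

(** The argument of [regfac] is [O(|k omega|^(-2))] uniformly in [s], and [regfac] is 1 up to second
    order. *)
Lemma regterm_bound (tau z : C) : (0 < Im tau)%R -> exists M E, (0 <= M)%R /\
  forall s x, (0 <= s <= 1)%R -> multiples x -> ~ In x E ->
  (Cmod (regterm tau z s x - 1) <= M * / Cmod (lat tau (mulidx x)) ^ 4)%R.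
Proof.
intros Ht; destruct (lat_ge tau Ht) as [c [Hc Hlat]].
assert (Hic : (0 < / c)%R) by (now apply Rinv_0_lt_compat).
set (M := (Cmod z ^ 2 * (1 + / c))%R).
assert (HM : (0 <= M)%R) by (apply Rmult_le_pos; [apply pow2_ge_0 | lra]).
destruct (lat_finite tau (1 + 2 * M) Ht) as [E0 HE0]; destruct (preimage_list E0) as [E HE].
exists (500 * M ^ 2)%R, E; split; [assert (H := pow2_ge_0 M); lra |].
intros s [k mn] Hs Hx Hn; unfold regterm; cbn [fst snd].
assert (Hbig : (1 + 2 * M < Cmod (lat tau (mulidx (k, mn))))%R).
{ apply Rnot_le_lt; intros H; apply Hn, HE; auto. }
rewrite lat_mulidx in *; cbn [fst snd] in *; destruct Hx as [Hk Hmn]; cbn [fst snd] in *.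
set (w := lat tau mn) in *.
assert (Hw0 : w <> 0) by (now apply lat_neq_0, prim_nonzero).
assert (Hw := proj1 (Cmod_gt_0 _) Hw0); assert (Hk1 := pos_INR1 k Hk); assert (Hk0 := INR_C_neq_0 k Hk).
rewrite Cmod_mult, Cmod_INR in *.
set (r := (INR k * Cmod w)%R) in *.
set (b := z ^ 2 * eis s w / INR k ^ 2).
assert (HRp : (Rpower (Cmod w) (- s) <= 1 + / c)%R).
{ assert (Hcw : (c <= Cmod w)%R).
  { destruct (Hlat mn (prim_nonzero mn Hmn)) as [H1 _]; fold w in H1.
    assert (H2 := Rabs_pos (IZR (fst mn))); nra. }
  apply Rle_trans with (Rpower c (- s)); [apply Rpower_neg_le; lra |].
  destruct (Rle_dec 1 c) as [H1 | H1].
  - apply Rle_trans with 1%R; [rewrite <- (Rpower_1_l (- s)); apply Rpower_neg_le; lra | lra].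
  - rewrite Rpower_Ropp; apply Rle_trans with (/ c)%R; [| lra]; apply Rinv_le_contravar; [exact Hc |].
    rewrite <- (Rpower_1 c) at 1 by exact Hc.
    unfold Rpower; apply exp_le; assert (ln c <= 0)%R by (rewrite <- ln_1; apply Rcomplements.ln_le; lra); nra. }
assert (Hr : (0 < r)%R) by (unfold r; apply Rmult_lt_0_compat; lra).
assert (Hb : (Cmod b <= M * / r ^ 2)%R).
{ unfold b, eis; rewrite Cmod_div, !Cmod_mult, !Cmod_pow, Cmod_inv_pow, Cmod_R, Cmod_INR, (Rabs_pos_eq (Rpower _ _))
    by (auto using Cpow2_neq_0; left; apply Rpower_gt_0).
  assert (Hiw : (0 < / Cmod w ^ 2)%R) by (apply Rinv_0_lt_compat, pow_lt, Hw).
  assert (Hik : (0 < / INR k ^ 2)%R) by (apply Rinv_0_lt_compat, pow_lt; lra).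
  replace (M * / r ^ 2)%R with (Cmod z ^ 2 * (/ Cmod w ^ 2 * (1 + / c)) * / INR k ^ 2)%R
    by (unfold M, r; field; repeat split; lra).
  unfold Rdiv; apply Rmult_le_compat_r; [lra |]; apply Rmult_le_compat_l; [apply pow2_ge_0 |].
  apply Rmult_le_compat_l; lra. }
assert (Hr2 : (1 + 2 * M < r ^ 2)%R) by nra.
assert (Hb2 : (M * / r ^ 2 <= 1 / 2)%R).
{ apply Rmult_le_reg_r with (r ^ 2)%R; [lra |]; rewrite Rmult_assoc, Rinv_l by lra; lra. }
eapply Rle_trans; [apply regfac_est; lra |].
replace (500 * M ^ 2 * / r ^ 4)%R with (500 * (M * / r ^ 2) ^ 2)%R by (field; lra).
apply Rmult_le_compat_l; [lra |]; apply pow_incr; split; [apply Cmod_ge_0 | exact Hb].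
Qed.

Lemma summable_multiples (tau : C) (M : R) : (0 < Im tau)%R -> (0 <= M)%R ->
  summable multiples (fun x => M * / Cmod (lat tau (mulidx x)) ^ 4)%R.
Proof.
intros Ht HM; apply summable_scal; [exact HM |].
apply (summable_inj multiples nonzero mulidx (fun mn => / Cmod (lat tau mn) ^ 4)%R).
- intros x Hx; now apply upper_nonzero, mulidx_upper.
- exact mulidx_inj.
- apply summable_lattice_pow; [exact Ht | lia].
Qed.

Lemma regterm_prod_exists (tau z : C) (s : R) (A : nat * (Z * Z) -> Prop) : (0 < Im tau)%R -> (0 <= s <= 1)%R ->
  (forall x, A x -> multiples x) -> exists p, has_prod A (regterm tau z s) p.
Proof.
intros Ht Hs HA; destruct (regterm_bound tau z Ht) as [M [E [HM HE]]].
apply (conv_exists (op := Cmult) A _ (fun x => Cmod (regterm tau z s x - 1))); [| intros; apply Rle_refl].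
apply (summable_finite_exception _ E); [intros; apply Cmod_ge_0 |].
apply (summable_le _ (fun x => M * / Cmod (lat tau (mulidx x)) ^ 4)%R).
- intros x [H1 H2]; split; [apply Cmod_ge_0 | apply HE; auto].
- apply (summable_sub multiples); [intros x [H1 _]; auto | now apply summable_multiples].
Qed.

Lemma nonlattice_ratio (tau z : C) (mn : Z * Z) (k : Z) : (in_lattice tau z -> z = 0) -> z <> 0 -> z <> IZR k * lat tau mn.
Proof.
intros Hz Hz0 E; apply Hz0, Hz; destruct mn as [m n]; exists (k * m)%Z, (k * n)%Z.
rewrite E; unfold lat; simpl; rewrite !mult_IZR, !RtoC_mult; ring.
Qed.

Lemma one_minus_sq_neq_0 (a b : C) : b <> 0 -> a <> b -> a <> - b -> 1 - a ^ 2 / b ^ 2 <> 0.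
Proof.
intros Hb H1 H2 E; assert (H : (b - a) * (b + a) = 0).
{ replace ((b - a) * (b + a)) with ((1 - a ^ 2 / b ^ 2) * b ^ 2) by (field; exact Hb); rewrite E; ring. }
assert (N1 : b - a <> 0) by (intros E1; apply H1; replace a with (b - (b - a)) by ring; rewrite E1; ring).
assert (N2 : b + a <> 0) by (intros E1; apply H2; replace a with (b + a - b) by ring; rewrite E1; ring).
exact (Cmult_neq_0 _ _ N1 N2 H).
Qed.

Lemma regterm_prod_tends (tau z : C) (P : R -> C) (P0 : C) : (0 < Im tau)%R ->
  (in_lattice tau z -> z = 0) -> z <> 0 ->
  (forall s, (0 < s <= 1)%R -> has_prod multiples (regterm tau z s) (P s)) ->
  has_prod multiples (regterm tau z 0) P0 -> tends (at_right 0) P P0.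
Proof.
intros Ht Hz Hz0 HP HP0; destruct (regterm_bound tau z Ht) as [M [E [HM HE]]].
apply (conv_dominated_except (op := Cmult) (at_right 0) multiples E _ (regterm tau z) (regterm tau z 0) P P0
  (summable_multiples tau M Ht HM)); [| | | exact HP0].
- apply (at_right_0 _ 1); [lra |]; intros s Hs x Hx Hn; apply HE; trivial; lra.
- intros [k mn] [Hk Hmn]; unfold regterm; cbn [fst snd] in *.
  assert (Hw : lat tau mn <> 0) by (now apply lat_neq_0, prim_nonzero).
  assert (Hk0 := INR_C_neq_0 k Hk).
  apply regfac_tends; [lim | |].
  + rewrite eis_0; replace (z ^ 2 * / lat tau mn ^ 2 / INR k ^ 2) with (z ^ 2 / (INR k * lat tau mn) ^ 2) by (field; auto).
    rewrite INR_IZR_INZ in *; apply one_minus_sq_neq_0.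
    * now apply Cmult_neq_0.
    * now apply nonlattice_ratio.
    * replace (- (IZR (Z.of_nat k) * lat tau mn)) with (IZR (- Z.of_nat k) * lat tau mn)
        by (rewrite opp_IZR, RtoC_opp; ring).
      now apply nonlattice_ratio.
  + rewrite eis_0; lim.
- apply (at_right_0 _ 1); [lra |]; intros s Hs; apply HP; lra.
Qed.

(** * The product at [s = 0], in terms of theta products *)

(** At [s = 0] the factors depend on the lattice vector alone and may be multiplied by rows. The row
    [m = 0] gives the cotangent at [z]; the rows with positive [m] give the theta products, and their
    exponentials add up to the Eisenstein sum [D0]. *)
Lemma lattice_product (tau z Z2 D0 : C) (P0 : C) : (0 < Im tau)%R -> (in_lattice tau z -> z = 0) -> z <> 0 ->
  has_sum pos (fun k => / RtoC (INR k) ^ 2) Z2 ->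
  has_sum row_pos (fun mn => hecke_rem 0 (lat tau mn)) D0 ->
  has_prod multiples (regterm tau z 0) P0 ->
  P0 = sinprod (2 * z) / sinprod z ^ 2 * Cexp (2 * (z ^ 2 * Z2)) *
    (thetafac tau (2 * z) / thetafac tau z ^ 2 * Cexp (2 * (z ^ 2 * D0))).
Proof.
intros Ht Hz Hz0 HZ2 HD0 HP0.
set (f := fun mn => regfac (z ^ 2 / lat tau mn ^ 2)).
assert (Hf : forall x, multiples x -> regterm tau z 0 x = f (mulidx x)).
{ intros x [Hx1 Hx2]; unfold regterm, f; rewrite eis_0, lat_mulidx; f_equal; field; split.
  - now apply lat_neq_0, prim_nonzero.
  - now apply INR_C_neq_0. }
assert (HU : has_prod upper f P0).
{ apply (conv_multiples f); revert HP0; apply conv_ext; exact Hf. }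
assert (Hsinh : Csinh (PI * Ci * z) <> 0).
{ intros E; destruct (Csinh_zero z E) as [n Hn].
  apply (nonlattice_ratio tau z (0%Z, 1%Z) n Hz Hz0); rewrite Hn; unfold lat; simpl; ring. }
assert (H0 : has_prod pos (fun n => f (0%Z, Z.of_nat n)) (sinprod (2 * z) / sinprod z ^ 2 * Cexp (2 * (z ^ 2 * Z2)))).
{ generalize (regfac_cot z Z2 HZ2 Hsinh); apply conv_ext; intros n _; unfold f, lat; simpl.
  rewrite <- INR_IZR_INZ; replace (0 * tau + INR n) with (RtoC (INR n)) by ring; reflexivity. }
assert (Hrow : exists p, has_prod row_pos f p).
{ destruct (regterm_prod_exists tau z 0 (fun x => multiples x /\ row_pos (mulidx x)) Ht ltac:(lra)) as [p Hp]; [tauto |].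
  exists p; apply (conv_reindex (fun x => multiples x /\ row_pos (mulidx x)) row_pos mulidx f p).
  - tauto.
  - intros x y [Hx _] [Hy _]; now apply mulidx_inj.
  - intros y Hy; destruct (mulidx_surj y) as [x [Hx E]]; [unfold row_pos, upper in *; lia |].
    exists x; subst; auto.
  - revert Hp; apply conv_ext; intros x [Hx _]; now apply Hf. }
destruct Hrow as [p1 Hp1].
destruct (eisenstein_rows tau D0 Ht HD0) as [Rw [HRw Hrows]].
assert (H1 : has_prod pos (fun m => rowfac tau (2 * z) m / rowfac tau z m ^ 2 * Cexp (2 * (z ^ 2 * Rw m))) p1).
{ apply (conv_row_nat f); [| exact Hp1]; intros m Hm.
  assert (Hnz : forall n, lat tau (Z.of_nat m, n) <> 0).
  { intros n; apply lat_neq_0; [exact Ht |]; apply row_pos_nonzero; unfold row_pos, pos in *; simpl; lia. }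
  apply (has_prod_regfac (fun _ => True) (fun n => z ^ 2 / lat tau (Z.of_nat m, n) ^ 2)).
  - unfold rowfac; destruct (lattice_factor_neq_0 tau z m Hz Hz0) as [N1 N2].
    assert (N3 := one_minus_q_neq_0 tau m Ht Hm).
    apply Cmult_neq_0; [now apply Cmult_neq_0 |].
    intros E; assert (N4 := Cpow2_neq_0 _ N3); apply C1_neq_0; rewrite <- (Cinv_r _ N4), E; ring.
  - generalize (row_product tau (2 * z) m Ht Hm); apply conv_ext; intros n _; field; apply Hnz.
  - exact (row_product tau z m Ht Hm).
  - generalize (has_sum_scal _ _ _ (z ^ 2) (Hrows m Hm)); apply conv_ext; intros; reflexivity. }
assert (H2 : has_prod pos (fun m => rowfac tau (2 * z) m / rowfac tau z m ^ 2 * Cexp (2 * (z ^ 2 * Rw m)))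
  (thetafac tau (2 * z) / thetafac tau z ^ 2 * Cexp (2 * (z ^ 2 * D0)))).
{ assert (N := thetafac_neq_0 tau z Ht Hz Hz0).
  apply (conv_op (op := Cmult) pos (fun m => rowfac tau (2 * z) m / rowfac tau z m ^ 2) (fun m => Cexp (2 * (z ^ 2 * Rw m)))).
  - apply (conv_op (op := Cmult) pos (rowfac tau (2 * z)) (fun m => / rowfac tau z m ^ 2)); [now apply rowfac_prod |].
    apply has_prod_inv; [now apply Cpow2_neq_0 |]; apply has_prod_pow; now apply rowfac_prod.
  - apply has_prod_Cexp; apply has_sum_scal; now apply has_sum_scal. }
rewrite <- (conv_unique _ _ _ _ H1 H2).
exact (conv_unique _ _ _ _ HU (conv_upper f _ _ H0 Hp1)).
Qed.

(** * From primitive vectors to the set [X tau s] *)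

(** The point [z / (omega |omega|^(s/2))], whose cotangent is the factor of the product at [omega]. *)
Definition cotarg (tau z : C) (s : R) (mn : Z * Z) : C :=
  z / lat tau mn * Rpower (Cmod (lat tau mn)) (- (s / 2)).

Definition Xelt (tau : C) (s : R) (mn : Z * Z) : C := / (lat tau mn ^ 2 * Rpower (Cmod (lat tau mn)) s).

Lemma Xelt_eis (tau : C) (s : R) (mn : Z * Z) : lat tau mn <> 0 -> Xelt tau s mn = eis s (lat tau mn).
Proof.
intros Hw; unfold Xelt, eis; assert (H := Rpower_gt_0 (Cmod (lat tau mn)) s).
assert (RtoC (Rpower (Cmod (lat tau mn)) s) <> 0) by (apply RtoC_neq_0; lra).
rewrite Rpower_Ropp, RtoC_inv by lra; field; auto.
Qed.

Lemma cotarg_sq (tau z : C) (s : R) (mn : Z * Z) : lat tau mn <> 0 ->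
  cotarg tau z s mn ^ 2 = z ^ 2 * eis s (lat tau mn).
Proof.
intros Hw; unfold cotarg, eis.
assert (E : RtoC (Rpower (Cmod (lat tau mn)) (- s)) =
  RtoC (Rpower (Cmod (lat tau mn)) (- (s / 2))) * RtoC (Rpower (Cmod (lat tau mn)) (- (s / 2)))).
{ rewrite <- RtoC_mult, <- Rpower_plus; do 2 f_equal; field. }
rewrite E; field; exact Hw.
Qed.

Lemma cotarg_neq_0 (tau z : C) (s : R) (mn : Z * Z) : lat tau mn <> 0 -> z <> 0 -> cotarg tau z s mn <> 0.
Proof.
intros Hw Hz; unfold cotarg, Cdiv; apply Cmult_neq_0.
- apply Cmult_neq_0; [exact Hz |]; apply Cmod_gt_0; rewrite Cmod_inv by exact Hw.
  now apply Rinv_0_lt_compat, Cmod_gt_0.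
- apply RtoC_neq_0; assert (H := Rpower_gt_0 (Cmod (lat tau mn)) (- (s / 2))); lra.
Qed.

Lemma lat_inj (tau : C) (x y : Z * Z) : (0 < Im tau)%R -> lat tau x = lat tau y -> x = y.
Proof.
intros Ht E; assert (E1 := f_equal Im E); assert (E2 := f_equal Re E); rewrite !lat_im in E1; rewrite !lat_re in E2.
apply Rmult_eq_reg_r in E1; [| lra]; rewrite E1 in E2.
assert (E3 : IZR (snd x) = IZR (snd y)) by lra.
apply eq_IZR in E1, E3; destruct x, y; simpl in *; congruence.
Qed.

(** The modulus of the element determines [|omega|], then the element determines [omega^2]; so
    [omega] is known up to sign, and the representatives exclude one of the signs. *)
Lemma Xelt_inj (tau : C) (s : R) (x y : Z * Z) : (0 < Im tau)%R -> (0 < s)%R -> upper x -> upper y ->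
  Xelt tau s x = Xelt tau s y -> x = y.
Proof.
intros Ht Hs Hx Hy E.
assert (Wx := lat_neq_0 tau x Ht (upper_nonzero x Hx)); assert (Wy := lat_neq_0 tau y Ht (upper_nonzero y Hy)).
assert (Px := proj1 (Cmod_gt_0 _) Wx); assert (Py := proj1 (Cmod_gt_0 _) Wy).
rewrite !Xelt_eis in E by assumption.
assert (Em : Cmod (lat tau x) = Cmod (lat tau y)).
{ apply (f_equal Cmod) in E; rewrite !Cmod_eis in E by assumption.
  unfold Rpower in E; apply exp_inv in E; apply ln_inv; trivial.
  apply Rmult_eq_reg_l with (- (2 + s))%R; lra. }
unfold eis in E; rewrite Em in E.
assert (HR : RtoC (Rpower (Cmod (lat tau y)) (- s)) <> 0).
{ apply RtoC_neq_0; assert (H := Rpower_gt_0 (Cmod (lat tau y)) (- s)); lra. }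
set (a := lat tau x) in *; set (b := lat tau y) in *; set (P := RtoC (Rpower (Cmod b) (- s))) in *.
assert (Esq : (a - b) * (a + b) = 0).
{ replace ((a - b) * (a + b)) with ((/ b ^ 2 * P - / a ^ 2 * P) * (a ^ 2 * b ^ 2) / P) by (field; auto).
  rewrite E; unfold Cdiv; ring. }
destruct (Ceq_dec (a - b) 0) as [E1 | N1].
- apply (lat_inj tau); [exact Ht |]; fold a b; replace a with (a - b + b) by ring; rewrite E1; ring.
- destruct (Ceq_dec (a + b) 0) as [E2 | N2]; [exfalso | destruct (Cmult_neq_0 _ _ N1 N2 Esq)].
  assert (E3 : x = (- fst y, - snd y)%Z).
  { apply (lat_inj tau); [exact Ht |]; fold a; unfold lat; simpl; rewrite !opp_IZR, !RtoC_opp.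
    replace a with (a + b - b) by ring; rewrite E2; unfold b, lat; ring. }
  subst x; unfold upper in *; simpl in *; lia.
Qed.

Lemma X_surj (tau : C) (s : R) (v : C) : X tau s v -> exists mn, prim mn /\ Xelt tau s mn = v.
Proof.
intros [m [n [Hg E]]]; cbv zeta in E.
destruct (classic (upper (m, n))) as [H | H].
- exists (m, n); split; [split; [exact H | exact Hg] |]; rewrite E; reflexivity.
- exists (- m, - n)%Z; split; [split; simpl |].
  + unfold upper in *; simpl in *.
    assert (~ (m = 0 /\ n = 0)%Z) by (intros [-> ->]; simpl in Hg; lia); lia.
  + rewrite Z.gcd_opp_l, Z.gcd_opp_r; exact Hg.
  + rewrite E; unfold Xelt; assert (El : lat tau (- m, - n)%Z = - (IZR m * tau + IZR n))
      by (unfold lat; simpl; rewrite !opp_IZR, !RtoC_opp; ring).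
    rewrite El, Cmod_opp; f_equal; ring.
Qed.

Lemma X_prim (tau : C) (s : R) (mn : Z * Z) : prim mn -> X tau s (Xelt tau s mn).
Proof. intros [_ H]; exists (fst mn), (snd mn); split; [exact H | reflexivity]. Qed.

Lemma conv_X {op e} (tau : C) (s : R) (f : C -> C) (p : C) : (0 < Im tau)%R -> (0 < s)%R ->
  (conv op e prim (fun mn => f (Xelt tau s mn)) p <-> conv op e (X tau s) f p).
Proof.
intros Ht Hs; apply conv_reindex; [intros; now apply X_prim | | apply X_surj].
intros x y [Hx _] [Hy _]; now apply Xelt_inj.
Qed.

Lemma Xelt_arg (tau z : C) (s : R) (mn : Z * Z) : lat tau mn <> 0 ->
  Xelt tau s mn * (PI * Ci * z) ^ 2 = (PI * Ci * cotarg tau z s mn) * (PI * Ci * cotarg tau z s mn).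
Proof.
intros Hw; rewrite Xelt_eis by exact Hw.
replace (PI * Ci * cotarg tau z s mn * (PI * Ci * cotarg tau z s mn)) with ((PI * Ci) ^ 2 * cotarg tau z s mn ^ 2) by ring.
rewrite cotarg_sq by exact Hw; ring.
Qed.

Lemma Q_L_Xelt (tau z : C) (s : R) (mn : Z * Z) : lat tau mn <> 0 -> z <> 0 ->
  Csinh (PI * Ci * cotarg tau z s mn) <> 0 ->
  Q_L (Xelt tau s mn * (PI * Ci * z) ^ 2) = sinprod (2 * cotarg tau z s mn) / sinprod (cotarg tau z s mn) ^ 2.
Proof.
intros Hw Hz Hs; rewrite Xelt_arg by exact Hw; rewrite Q_L_sqr by (apply Cmult_neq_0; [apply PICi_neq_0 | now apply cotarg_neq_0]).
now apply cot_sinprod.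
Qed.

Lemma Csinh_opp (y : C) : Csinh (- y) = - Csinh y.
Proof. unfold Csinh; replace (- - y) with y by ring; unfold Cdiv; ring. Qed.

(** The square root chosen by [Csqrt] is [y] or [- y], and [sinh] is odd. *)
Lemma no_pole (y : C) : Csinh y <> 0 -> ~ Q_L_pole (y * y).
Proof.
intros Hy [_ H]; apply Hy; assert (E := Csqrt_sqr (y * y)); set (r := Csqrt (y * y)) in *.
destruct (Ceq_dec (r - y) 0) as [E1 | N1].
- replace y with (r - (r - y)) by ring; rewrite E1; replace (r - 0) with r by ring; exact H.
- destruct (Ceq_dec (r + y) 0) as [E2 | N2].
  + replace y with (r + y + - r) by ring; rewrite E2, Cplus_0_l, Csinh_opp, H; ring.
  + exfalso; apply (Cmult_neq_0 _ _ N1 N2).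
    replace ((r - y) * (r + y)) with (r * r - y * y) by ring; rewrite E; ring.
Qed.

Definition pole_free (tau z : C) (s : R) : Prop :=
  forall mn, prim mn -> Csinh (PI * Ci * cotarg tau z s mn) <> 0.

(** For large [omega] the argument has modulus strictly between 0 and 1, and each of the finitely
    many others tends to the non-integer [z / omega]. *)
Lemma pole_free_eventually (tau z : C) : (0 < Im tau)%R -> (in_lattice tau z -> z = 0) -> z <> 0 ->
  at_right 0 (pole_free tau z).
Proof.
intros Ht Hz Hz0; destruct (lat_finite tau (1 + Cmod z) Ht) as [E HE].
assert (HF : at_right 0 (fun s => forall mn, In mn E -> prim mn -> Csinh (PI * Ci * cotarg tau z s mn) <> 0)).
{ clear HE; induction E as [| mn E IH].
  - apply filter_forall; intros s x [].
  - assert (H1 : at_right 0 (fun s => prim mn -> Csinh (PI * Ci * cotarg tau z s mn) <> 0)).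
    { destruct (classic (prim mn)) as [Hmn | Hmn]; [| apply filter_forall; tauto].
      assert (Hw : lat tau mn <> 0) by (now apply lat_neq_0, prim_nonzero).
      assert (HL : tends (at_right 0) (fun s => sinprod (cotarg tau z s mn)) (sinprod (z / lat tau mn * 1))).
      { apply sinprod_tends; [lim |]; unfold cotarg; apply tends_mult; lim.
        replace (RtoC 1) with (RtoC (Rpower (Cmod (lat tau mn)) (- (0 / 2))))
          by (unfold Rdiv; now rewrite Rmult_0_l, Rpower_0_r).
        apply (tends_at_right_0 (fun s => Rpower (Cmod (lat tau mn)) (- (s / 2)))); unfold Rpower; auto_derive; trivial. }
      rewrite Cmult_1_r in HL.
      assert (HN : sinprod (z / lat tau mn) <> 0).
      { apply sinprod_neq_0; intros Es; destruct (Csinh_zero _ Es) as [n Hn].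
        apply (nonlattice_ratio tau z mn n Hz Hz0); rewrite <- Hn; field; exact Hw. }
      generalize (tends_eventually_neq_0 _ _ _ HN HL); apply filter_imp; intros s Hs _.
      rewrite <- sinprod_sinh; apply Cmult_neq_0; [| exact Hs].
      apply Cmult_neq_0; [apply PICi_neq_0 | now apply cotarg_neq_0]. }
    generalize (filter_and _ _ H1 IH); apply filter_imp; intros s [H2 H3] x [<- | Hx]; auto. }
assert (H01 : at_right 0 (fun s => 0 < s <= 1)%R) by (apply (at_right_0 _ 1); [lra | intros; lra]).
generalize (filter_and _ _ HF H01); apply filter_imp; intros s [H1 H2] mn Hmn.
destruct (classic (In mn E)) as [Hin | Hin]; [auto |].
assert (Hw : lat tau mn <> 0) by (now apply lat_neq_0, prim_nonzero).
assert (Hbig : (1 + Cmod z < Cmod (lat tau mn))%R) by (apply Rnot_le_lt; auto).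
intros Es; destruct (Csinh_zero _ Es) as [n Hn].
assert (Hn0 : n <> 0%Z) by (intros ->; apply (cotarg_neq_0 tau z s mn Hw Hz0); exact Hn).
apply (f_equal Cmod) in Hn; rewrite Cmod_R, <- abs_IZR in Hn.
assert (Hn1 : (1 <= IZR (Z.abs n))%R) by (apply IZR_le; lia).
rewrite <- Hn in Hn1; unfold cotarg in Hn1.
assert (Hz1 := Cmod_ge_0 z).
rewrite Cmod_mult, Cmod_div, Cmod_R, Rabs_pos_eq in Hn1 by (trivial; left; apply Rpower_gt_0).
assert (Hp : (Rpower (Cmod (lat tau mn)) (- (s / 2)) <= 1)%R).
{ rewrite <- (Rpower_1_l (- (s / 2))); apply Rpower_neg_le; lra. }
assert (Hq : (0 <= Cmod z / Cmod (lat tau mn) < 1)%R).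
{ split; [apply Rmult_le_pos; [lra | left; apply Rinv_0_lt_compat; lra] | apply Rlt_div_l; lra]. }
assert (Hp0 := Rpower_gt_0 (Cmod (lat tau mn)) (- (s / 2))).
assert (Cmod z / Cmod (lat tau mn) * Rpower (Cmod (lat tau mn)) (- (s / 2)) <= Cmod z / Cmod (lat tau mn) * 1)%R
  by (apply Rmult_le_compat_l; lra).
lra.
Qed.

(** Regularisation multiplies the factor at [omega] by an exponential of
    [2 zeta(2) z^2 / (omega^2 |omega|^s)]; dividing these out leaves one exponential of the
    Eisenstein sum over primitive vectors. *)
Lemma X_product (tau z : C) (s : R) (Z2 E P : C) : (0 < Im tau)%R -> z <> 0 -> (0 < s)%R -> pole_free tau z s ->
  has_sum pos (fun k => / RtoC (INR k) ^ 2) Z2 ->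
  has_sum prim (fun mn => eis s (lat tau mn)) E ->
  has_prod multiples (regterm tau z s) P ->
  has_prod (X tau s) (fun x => Q_L (x * (PI * Ci * z) ^ 2)) (P * Cexp (- (2) * (z ^ 2 * Z2) * E)).
Proof.
intros Ht Hz Hs Hpf HZ HE HP; apply conv_X; trivial.
assert (H1 : has_prod prim (fun mn => sinprod (2 * cotarg tau z s mn) / sinprod (cotarg tau z s mn) ^ 2 *
  Cexp (2 * (cotarg tau z s mn ^ 2 * Z2))) P).
{ apply (conv_snd pos prim (regterm tau z s)); [| exact HP]; intros mn Hmn.
  assert (Hw : lat tau mn <> 0) by (now apply lat_neq_0, prim_nonzero).
  generalize (regfac_cot (cotarg tau z s mn) Z2 HZ (Hpf mn Hmn)); apply conv_ext; intros k _.
  unfold regterm; simpl fst; simpl snd; rewrite cotarg_sq by exact Hw; reflexivity. }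
assert (H2 := has_prod_Cexp _ _ _ (has_sum_scal _ _ _ (- (2) * (z ^ 2 * Z2)) HE)).
generalize (conv_op _ _ _ _ _ H1 H2); apply conv_ext; intros mn Hmn.
assert (Hw : lat tau mn <> 0) by (now apply lat_neq_0, prim_nonzero).
rewrite Q_L_Xelt by (trivial; now apply Hpf).
rewrite <- Cmult_assoc, <- Cexp_plus, cotarg_sq by exact Hw.
replace (2 * (z ^ 2 * eis s (lat tau mn) * Z2) + - (2) * (z ^ 2 * Z2) * eis s (lat tau mn)) with (RtoC 0) by ring.
rewrite Cexp_0; ring.
Qed.

(** The Gaussian factors combine to [exp ((4 - 2) pi z^2 / (2 Im tau))]. *)
Lemma Theta_ratio (tau y : C) : (0 < Im tau)%R -> y <> 0 -> sinprod y <> 0 -> thetafac tau y <> 0 ->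
  PI * Ci * y * (Theta (2 * y) tau / Theta y tau ^ 2) =
  sinprod (2 * y) / sinprod y ^ 2 * (thetafac tau (2 * y) / thetafac tau y ^ 2) * Cexp (PI * y ^ 2 / Im tau).
Proof.
intros Ht Hy HS HT; rewrite !Theta_product by exact Ht.
fold (thetafac tau y) (thetafac tau (2 * y)).
rewrite <- !sinprod_sinh.
set (x := PI / 2 * (y ^ 2 / Im tau)).
assert (H2 : RtoC 2 <> 0) by (apply RtoC_neq_0; lra).
assert (Hi : RtoC (Im tau) <> 0) by (apply RtoC_neq_0; lra).
replace (PI / 2 * ((2 * y) ^ 2 / Im tau)) with (x + x + (x + x)) by (unfold x; field; auto).
replace (PI * y ^ 2 / Im tau) with (x + x) by (unfold x; field; auto).
rewrite !Cexp_plus; assert (Hx := Cexp_neq_0 x); assert (HP := PICi_neq_0).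
assert (Hp1 : RtoC PI <> 0) by (intros E; apply HP; rewrite E; ring).
assert (Hp2 : Ci <> 0) by (intros E; apply HP; rewrite E; ring).
field; repeat split; trivial.
Qed.

(** The exponentials of [zeta(2)] and of [D0] in the limit of the regularised product cancel against
    those of the Eisenstein sum. What remains is the correction term of Hecke's limit, which is
    the Gaussian factor of the theta quotient. *)
Lemma nonzero_case (tau z : C) : (0 < Im tau)%R -> (in_lattice tau z -> z = 0) -> z <> 0 ->
  exists Fs : R -> C,
  at_right 0 (fun s => has_prod (X tau s) (fun x => Q_L (x * (PI * Ci * z) ^ 2)) (Fs s)) /\
  tends (at_right 0) Fs (PI * Ci * z * (Theta (2 * z) tau / Theta z tau ^ 2)).
Proof.
intros Ht Hz Hz0.
destruct (choice_on (fun s => 0 < s <= 1)%R (fun s p => has_sum row_pos (fun mn => eis s (lat tau mn)) p) 0)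
  as [K HK']; [intros s [Hs _]; apply eis_lattice_sum; trivial; exact row_pos_nonzero |].
destruct (choice_on (fun s => 0 < s <= 1)%R (fun s p => has_sum pos (fun k => eis s (INR k)) p) 0)
  as [Zt HZ']; [intros s Hs; apply zeta_sum; lra |].
destruct (choice_on (fun s => 0 < s <= 1)%R (fun s p => has_prod multiples (regterm tau z s) p) 0)
  as [P HP']; [intros s Hs; apply regterm_prod_exists; trivial; lra |].
destruct (hecke_rem_sum tau 0 Ht ltac:(lra)) as [D0 HD0].
destruct (regterm_prod_exists tau z 0 multiples Ht ltac:(lra) (fun x H => H)) as [P0 HP0].
destruct (zeta_sum 0 ltac:(lra)) as [Z2 HZ2].
assert (HZ2' : has_sum pos (fun k => / RtoC (INR k) ^ 2) Z2) by (revert HZ2; apply conv_ext; intros; apply eis_0).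
assert (NZ2 := zeta2_neq_0 Z2 HZ2').
assert (LK := hecke_limit tau K D0 Ht HK' HD0).
assert (LZ := zeta_tends Zt Z2 HZ' HZ2').
assert (LP := regterm_prod_tends tau z P P0 Ht Hz Hz0 HP' HP0).
exists (fun s => P s * Cexp (- (2) * (z ^ 2 * Z2) * ((Zt s + K s) / Zt s))); split.
- assert (H01 : at_right 0 (fun s => 0 < s <= 1)%R) by (apply (at_right_0 _ 1); [lra | intros; lra]).
  generalize (filter_and _ _ H01 (filter_and _ _ (pole_free_eventually tau z Ht Hz Hz0)
    (tends_eventually_neq_0 _ _ _ NZ2 LZ))).
  apply filter_imp; intros s [Hs [Hpf HZs]].
  apply X_product; auto; [lra |]; apply primitive_sum; auto.
- assert (HT := thetafac_neq_0 tau z Ht Hz Hz0).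
  assert (HS : sinprod z <> 0).
  { apply sinprod_neq_0; intros E; destruct (Csinh_zero z E) as [n Hn].
    apply (nonlattice_ratio tau z (0%Z, 1%Z) n Hz Hz0); rewrite Hn; unfold lat; simpl; ring. }
  rewrite Theta_ratio by assumption.
  assert (H2 : RtoC 2 <> 0) by (apply RtoC_neq_0; lra).
  assert (Hi : RtoC (Im tau) <> 0) by (apply RtoC_neq_0; lra).
  replace (sinprod (2 * z) / sinprod z ^ 2 * (thetafac tau (2 * z) / thetafac tau z ^ 2) * Cexp (PI * z ^ 2 / Im tau))
    with (P0 * Cexp (- (2) * (z ^ 2 * Z2) * ((Z2 + (D0 - PI / (2 * Im tau))) / Z2))).
  + lim.
  + rewrite (lattice_product tau z Z2 D0 P0 Ht Hz Hz0 HZ2' HD0 HP0).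
    replace (- (2) * (z ^ 2 * Z2) * ((Z2 + (D0 - PI / (2 * Im tau))) / Z2))
      with (PI * z ^ 2 / Im tau + (- (2 * (z ^ 2 * Z2)) + - (2 * (z ^ 2 * D0)))) by (field; auto).
    rewrite !Cexp_plus, !Cexp_opp.
    assert (X1 := Cexp_neq_0 (2 * (z ^ 2 * Z2))); assert (X2 := Cexp_neq_0 (2 * (z ^ 2 * D0))).
    field; repeat split; trivial.
Qed.

(** * The removable singularity at [z = 0] *)

Lemma Q_L_0 : Q_L 0 = 1.
Proof. unfold Q_L; destruct (Ceq_dec 0 0) as [_ | H]; [reflexivity | now destruct H]. Qed.

Lemma tends_id_locally (p : C) : tends (locally p) (fun y : C => y) p.
Proof. apply tends_filterlim; [lim |]; apply filterlim_id. Qed.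

(** All products involved are continuous and equal to 1 at [z = 0], once the sines are written as
    [pi i y] times a product. *)
Lemma Theta_ratio_0 (tau : C) : (0 < Im tau)%R ->
  tends (locally' (T := C_UniformSpace) (RtoC 0))
    (fun y => PI * Ci * y * (Theta (2 * y) tau / Theta y tau ^ 2)) 1.
Proof.
intros Ht; assert (Hi : RtoC (Im tau) <> 0) by (apply RtoC_neq_0; lra).
set (F := locally (T := C_UniformSpace) (RtoC 0)).
assert (HFP : ProperFilter F) by (unfold F; typeclasses eauto).
assert (Hid : tends F (fun y => y) 0) by apply tends_id_locally.
assert (H2y : tends F (fun y => 2 * y) 0).
{ replace (RtoC 0) with (2 * 0) by ring; lim. }
assert (Hu : forall w : C -> C, tends F w 0 -> tends F (fun y => expi 1 (w y)) 1).
{ intros w Hw; unfold expi.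
  assert (H : tends F (fun y => Cexp (2 * PI * Ci * 1 * w y)) (Cexp (2 * PI * Ci * 1 * 0))).
  { lim. }
  replace (2 * PI * Ci * 1 * 0) with (RtoC 0) in H by ring; rewrite Cexp_0 in H; exact H. }
assert (HS : forall w : C -> C, tends F w 0 -> tends F (fun y => sinprod (w y)) 1).
{ intros w Hw; rewrite <- sinprod_0; now apply sinprod_tends. }
assert (HT : forall w : C -> C, tends F w 0 -> tends F (fun y => thetafac tau (w y)) 1).
{ intros w Hw; unfold thetafac; assert (HQ := qpoch_1_neq_0 tau Ht).
  assert (H : tends F (fun y => qpoch tau (expi 1 (w y)) * qpoch tau (/ expi 1 (w y)) / qpoch tau 1 ^ 2)
    (qpoch tau 1 * qpoch tau (/ 1) / qpoch tau 1 ^ 2)).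
  { assert (H1 := Hu w Hw); lim; apply qpoch_tends; lim; apply C1_neq_0. }
  replace (qpoch tau 1 * qpoch tau (/ 1) / qpoch tau 1 ^ 2) with (RtoC 1) in H; [exact H |].
  replace (/ 1) with (RtoC 1) by (field; apply C1_neq_0); field; exact HQ. }
assert (HL : tends F (fun y => sinprod (2 * y) / sinprod y ^ 2 * (thetafac tau (2 * y) / thetafac tau y ^ 2) *
  Cexp (PI * y ^ 2 / Im tau)) 1).
{ assert (H : tends F (fun y => sinprod (2 * y) / sinprod y ^ 2 * (thetafac tau (2 * y) / thetafac tau y ^ 2) *
    Cexp (PI * y ^ 2 / Im tau)) (1 / 1 ^ 2 * (1 / 1 ^ 2) * Cexp (PI * 0 ^ 2 / Im tau))).
  { assert (N1 : RtoC 1 ^ 2 <> 0) by (apply Cpow2_neq_0, C1_neq_0).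
    assert (S1 := HS _ Hid); assert (S2 := HS _ H2y); assert (T1 := HT _ Hid); assert (T2 := HT _ H2y).
    clear Hu HS HT; lim. }
  replace (1 / 1 ^ 2 * (1 / 1 ^ 2) * Cexp (PI * 0 ^ 2 / Im tau)) with (RtoC 1) in H; [exact H |].
  replace (PI * 0 ^ 2 / Im tau) with (RtoC 0) by (field; exact Hi); rewrite Cexp_0; field; apply C1_neq_0. }
intros eps Heps.
generalize (filter_and _ _ (HL eps Heps) (filter_and _ _ (tends_eventually_neq_0 _ _ _ C1_neq_0 (HS _ Hid))
  (tends_eventually_neq_0 _ _ _ C1_neq_0 (HT _ Hid)))).
unfold locally', within; apply filter_imp; intros y [H1 [H2 H3]] Hy.
rewrite Theta_ratio; assumption.
Qed.

Theorem theorem1p2 :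
  forall z tau : C,
    (0 < Im tau)%R ->
    (in_lattice tau z -> z = 0) ->
    at_right 0 (fun s : R => L_defined (X tau s) ((PI * Ci * z) ^ 2)) /\
    exists v : C,
      removable_value
        (fun y : C => PI * Ci * y * (Theta (2 * y) tau / Theta y tau ^ 2)) 0 z v /\
      filterlim (fun s : R => L (X tau s) ((PI * Ci * z) ^ 2))
        (at_right 0) (locally v).
Proof.
intros z tau Ht Hz; destruct (Ceq_dec z 0) as [-> | Hz0].
- assert (E : forall x : C, x * (PI * Ci * 0) ^ 2 = 0) by (intros; ring).
  assert (HP : forall s, has_prod (X tau s) (fun x => Q_L (x * (PI * Ci * 0) ^ 2)) 1).
  { intros s; apply (conv_ext _ (fun _ => RtoC 1)); [| apply conv_unit].
    intros x _; now rewrite E, Q_L_0. }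
  split.
  + apply filter_forall; intros s; split.
    * intros x _ [H _]; apply H, E.
    * exists 1; apply tends_filterlim; [lim | apply HP].
  + exists 1; split.
    * split; [intros H; now destruct H |]; intros _.
      apply tends_filterlim; [unfold locally'; typeclasses eauto | now apply Theta_ratio_0].
    * apply tends_filterlim; [lim |].
      apply (tends_ext _ (fun _ => RtoC 1)); [| lim].
      intros s; unfold L; symmetry; apply (Cprod_over_unique _ _ 1).
      apply tends_filterlim; [lim | exact (HP s)].
- destruct (nonzero_case tau z Ht Hz Hz0) as [Fs [HFs HL]]; split.
  + assert (Hpf := pole_free_eventually tau z Ht Hz Hz0).
    generalize (filter_and _ _ Hpf HFs); apply filter_imp; intros s [H1 H2]; split.
    * intros x Hx; destruct (X_surj tau s x Hx) as [mn [Hmn <-]].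
      rewrite Xelt_arg by (now apply lat_neq_0, prim_nonzero); apply no_pole; now apply H1.
    * exists (Fs s); apply tends_filterlim; [lim | exact H2].
  + eexists; split.
    * split; [intros _; reflexivity | intros H; now destruct Hz0].
    * apply tends_filterlim; [lim |].
      revert HL; apply tends_ext_F; [lim |].
      revert HFs; apply filter_imp; intros s Hs; unfold L; symmetry.
      apply (Cprod_over_unique _ _ (Fs s)); apply tends_filterlim; [lim | exact Hs].
Qed.
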